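(* Fix $c>0$, $u_{X_1}\ge0$, $0\le a_i\le b_i\le1$ and boxes $B_i=\{x\in\mathcal{D}_0:\underline{x}_{ji}\le x_j\le\bar x_{ji},j=1,\dots,d\}$ ($i=1,\dots,n$, $x_{j0}\le\underline{x}_{ji}\le\bar x_{ji}\le\infty$), and $S=\{x\in\mathcal{D}_0:g_1(x_2,\dots,x_d)\le x_1\le g_2(x_2,\dots,x_d)\}$ with measurable $g_1\le g_2$ from $[x_{20},\infty)\times\cdots\times[x_{d0},\infty)$ to $[x_{10},\infty]$. The 1-POU-DRO problem is: maximize $P(S)$ over finite measures $P$ on $\mathcal{D}_0$ such that $P(\mathcal{D}_0)=c$, $P/c$ is 1-POU about $x_0$, $P(\{x_1=x_{10}\})=0$, $f_{X_1}(x_{10})\le u_{X_1}$, and $a_ic\le P(B_i)\le b_ic$ for $i=1,\dots,n$. This problem is equivalent to (has the same optimal value as) the moment problem: maximize $c\,E_Q\big[\frac{\min(g_2(Z_2,\dots,Z_d),Z_1)-\min(g_1(Z_2,\dots,Z_d),Z_1)}{Z_1-x_{10}}\big]$ over probability distributions $Q$ of $Z=(Z_1,\dots,Z_d)\in\mathcal{D}_0$ subject to $E_Q[1/(Z_1-x_{10})]\le u_{X_1}/c$ and $a_i\le E_Q\big[\frac{\min(Z_1,\bar x_{1i})-\min(Z_1,\underline{x}_{1i})}{Z_1-x_{10}}I(\underline{x}_{ji}\le Z_j\le\bar x_{ji},j\ge2)\big]\le b_i$ for $i=1,\dots,n$. Moreover, if $Q^*$ is optimal for the moment problem and $Z^*\sim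 Q^*$, then $cP^*$ is optimal for the 1-POU-DRO problem, where $P^*$ is the distribution of $(x_{10}+U(Z_1^*-x_{10}),Z_2^*,\dots,Z_d^* )$ with $U$ uniform on $(0,1)$ independent of $Z^*$.
   Context: $x_0\in\mathbb{R}\times[-\infty,\infty)^{d-1}$, $\mathcal{D}_0=\{x\ge x_0\}$ (componentwise). A measurable $K\subset\mathcal{D}_0$ is 1-POU about $x_0$ if $x\in K$, $x_1\ge x'_1\ge x_{10}$, $x'_i=x_i$ ($i\ge2$) imply $x'\in K$; a probability distribution on $\mathcal{D}_0$ is 1-POU about $x_0$ if it lies in the closed (weak topology) convex hull of uniform distributions on 1-POU subsets of $\mathcal{D}_0$. $f_{X_1}$ denotes a density on $[x_{10},\infty)$ of the measure $A\mapsto P(\{x\in\mathcal{D}_0:x_1\in A\})$ chosen continuous at $x_{10}$ (such a density exists for 1-POU $P$ with $P(\{x_1=x_{10}\})=0$, and its value at $x_{10}$ is uniquely determined). Conventions: ratios with denominator $Z_1-x_{10}=0$ are $+\infty$ in the first constraint. *)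

(* Defs.v *)
From HB Require Import structures.
From mathcomp Require Import all_boot all_order all_algebra.
From mathcomp Require Import all_classical all_reals all_analysis.
From mathcomp Require Import measurable_realfun.

Set Implicit Arguments.
Unset Strict Implicit.
Unset Printing Implicit Defensive.

Import Order.TTheory GRing.Theory Num.Theory.
Local Open Scope classical_set_scope.
Local Open Scope ring_scope.

(* Points of R^d, d = m.+1, are (m.+1)-tuples of reals, equipped with the
   product (= Borel) sigma-algebra provided by MathComp-Analysis.
   Coordinate x_1 is [tnth x ord0]; coordinates x_2..x_d are
   [tnth x (lift ord0 j)], j : 'I_m, i.e. the entries of [behead_tuple x]. *)

(* d-dimensional Lebesgue measure of a (measurable) set, as the iterated
   one-dimensional Lebesgue integral of its indicator (Tonelli). *)
Fixpoint tvol (R : realType) (n : nat) : (n.-tuple R -> \bar R) -> \bar R :=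
  match n return (n.-tuple R -> \bar R) -> \bar R with
  | 0 => fun f => f [tuple]
  | n'.+1 => fun f =>
      (\int[@lebesgue_measure R]_x tvol (fun t : n'.-tuple R => f (cons_tuple x t)))%E
  end.

Definition lebvol (R : realType) (n : nat) (A : set (n.-tuple R)) : \bar R :=
  tvol (fun t => (\1_A t)%:E).

Section Defs.
Variables (R : realType) (m : nat).
Local Notation T := (m.+1.-tuple R).

(* D_0 = { x >= x_0 } componentwise; x0 j may be -oo *)
Definition D0 (x0 : 'I_m.+1 -> \bar R) : set T :=
  [set t | forall j, (x0 j <= (tnth t j)%:E)%E].

Definition gdom (x0 : 'I_m.+1 -> \bar R) : set (m.-tuple R) :=
  [set y | forall j : 'I_m, (x0 (lift ord0 j) <= (tnth y j)%:E)%E].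

Definition POU1_set (x0 : 'I_m.+1 -> \bar R) (K : set T) : Prop :=
  [/\ measurable K, K `<=` D0 x0 &
      forall t t' : T, K t ->
        (x0 ord0 <= (tnth t' ord0)%:E)%E -> tnth t' ord0 <= tnth t ord0 ->
        (forall j, j != ord0 -> tnth t' j = tnth t j) -> K t'].

Definition uniform_on (U : {measure set T -> \bar R}) (K : set T) : Prop :=
  (0 < lebvol K < +oo)%E /\
  forall A, measurable A ->
    U A = (lebvol (A `&` K) * ((fine (lebvol K))^-1)%:E)%E.

Definition in_POU1_hull (x0 : 'I_m.+1 -> \bar R) (Q : {measure set T -> \bar R})
  : Prop :=
  exists (k : nat) (lam : 'I_k -> R) (Ks : 'I_k -> set T)
         (Us : 'I_k -> {measure set T -> \bar R}),
    [/\ (forall i, 0 <= lam i), \sum_(i < k) lam i = 1,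
        (forall i, POU1_set x0 (Ks i) /\ uniform_on (Us i) (Ks i)) &
        forall A, measurable A -> Q A = (\sum_(i < k) (lam i)%:E * Us i A)%E].

Definition bdd_cont_on (D : set T) (f : T -> R) : Prop :=
  (exists M, forall t, D t -> `|f t| <= M) /\
  forall t, D t -> forall e, 0 < e -> exists2 del, 0 < del &
    forall s, D s -> (forall j, `|tnth s j - tnth t j| < del) -> `|f s - f t| < e.

(* P is a probability distribution on D_0 which is 1-POU about x_0, i.e. it
   lies in the closure, for the weak topology (topology generated by the maps
   P |-> \int f dP, f bounded continuous on D_0), of the convex hull of the
   uniform distributions on 1-POU subsets of D_0. *)
Definition POU1_dist (x0 : 'I_m.+1 -> \bar R) (P : {measure set T -> \bar R})
  : Prop :=
  [/\ P setT = 1%E, P (~` D0 x0) = 0%E &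
      forall (k : nat) (fs : 'I_k -> T -> R) (e : R),
        (forall i, bdd_cont_on (D0 x0) (fs i)) -> 0 < e ->
        exists Q : {measure set T -> \bar R}, in_POU1_hull x0 Q /\
          forall i, `|Rintegral P (D0 x0) (fs i) - Rintegral Q (D0 x0) (fs i)| < e].

Definition dens_x10_le (x0 : 'I_m.+1 -> \bar R) (x10 u : R)
  (P : {measure set T -> \bar R}) : Prop :=
  exists fd : R -> R,
    [/\ (forall x, x10 <= x -> 0 <= fd x),
        measurable_fun [set x | x10 <= x] fd,
        (forall A : set R, measurable A -> A `<=` [set x | x10 <= x] ->
          P [set t | D0 x0 t /\ A (tnth t ord0)] =
            (\int[@lebesgue_measure R]_(x in A) (fd x)%:E)%E),
        (forall e, 0 < e -> exists2 del, 0 < del &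
           forall x, x10 <= x < x10 + del -> `|fd x - fd x10| < e) &
        fd x10 <= u].

Definition rest (t : T) : m.-tuple R := behead_tuple t.

Definition box (x0 : 'I_m.+1 -> \bar R) (lo hi : 'I_m.+1 -> \bar R) : set T :=
  [set t | D0 x0 t /\ forall j, (lo j <= (tnth t j)%:E <= hi j)%E].

Definition Sset (x0 : 'I_m.+1 -> \bar R) (g1 g2 : m.-tuple R -> \bar R) : set T :=
  [set t | D0 x0 t /\ (g1 (rest t) <= (tnth t ord0)%:E <= g2 (rest t))%E].

Definition DRO_feasible (x0 : 'I_m.+1 -> \bar R) (x10 c u : R) (n : nat)
  (a b : 'I_n -> R) (lo hi : 'I_n -> 'I_m.+1 -> \bar R)
  (P : {measure set T -> \bar R}) : Prop :=
  [/\ P (~` D0 x0) = 0%E, P setT = c%:E,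
      (exists Pn : {measure set T -> \bar R},
        (forall A, measurable A -> P A = (c%:E * Pn A)%E) /\ POU1_dist x0 Pn),
      P [set t | tnth t ord0 = x10] = 0%E &
      dens_x10_le x0 x10 u P /\
      forall i, ((a i * c)%:E <= P (box x0 (lo i) (hi i)) <= (b i * c)%:E)%E].

Definition DRO_value (x0 : 'I_m.+1 -> \bar R) (x10 c u : R) (n : nat)
  (a b : 'I_n -> R) (lo hi : 'I_n -> 'I_m.+1 -> \bar R)
  (g1 g2 : m.-tuple R -> \bar R) : \bar R :=
  ereal_sup [set r | exists P : {measure set T -> \bar R},
    DRO_feasible x0 x10 c u a b lo hi P /\ r = P (Sset x0 g1 g2)].

Definition inv_gap (x10 : R) (z : T) : \bar R :=
  if tnth z ord0 == x10 then +oo%E else ((tnth z ord0 - x10)^-1)%:E.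

Definition obj_fun (x10 : R) (g1 g2 : m.-tuple R -> \bar R) (z : T) : \bar R :=
  ((Order.min (g2 (rest z)) (tnth z ord0)%:E
    - Order.min (g1 (rest z)) (tnth z ord0)%:E)
   * ((tnth z ord0 - x10)^-1)%:E)%E.

Definition box_fun (x10 : R) (lo hi : 'I_m.+1 -> \bar R) (z : T) : \bar R :=
  ((Order.min (tnth z ord0)%:E (hi ord0) - Order.min (tnth z ord0)%:E (lo ord0))
   * ((tnth z ord0 - x10)^-1)%:E
   * (\1_[set y : T | forall j : 'I_m,
            (lo (lift ord0 j) <= (tnth y (lift ord0 j))%:E <= hi (lift ord0 j))%E] z)%:E)%E.

Definition moment_feasible (x0 : 'I_m.+1 -> \bar R) (x10 c u : R) (n : nat)
  (a b : 'I_n -> R) (lo hi : 'I_n -> 'I_m.+1 -> \bar R)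
  (Q : {measure set T -> \bar R}) : Prop :=
  [/\ Q setT = 1%E, Q (~` D0 x0) = 0%E,
      (\int[Q]_(z in D0 x0) inv_gap x10 z <= (u / c)%:E)%E &
      forall i, ((a i)%:E <= \int[Q]_(z in D0 x0) box_fun x10 (lo i) (hi i) z
                 <= (b i)%:E)%E].

Definition moment_obj (x0 : 'I_m.+1 -> \bar R) (x10 c : R) (g1 g2 : m.-tuple R -> \bar R)
  (Q : {measure set T -> \bar R}) : \bar R :=
  (c%:E * \int[Q]_(z in D0 x0) obj_fun x10 g1 g2 z)%E.

Definition moment_value (x0 : 'I_m.+1 -> \bar R) (x10 c u : R) (n : nat)
  (a b : 'I_n -> R) (lo hi : 'I_n -> 'I_m.+1 -> \bar R)
  (g1 g2 : m.-tuple R -> \bar R)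
  : \bar R :=
  ereal_sup [set r | exists Q : {measure set T -> \bar R},
    moment_feasible x0 x10 c u a b lo hi Q /\ r = moment_obj x0 x10 c g1 g2 Q].

Definition stretch (x10 : R) (z : T) (s : R) : T :=
  cons_tuple (x10 + s * (tnth z ord0 - x10)) (rest z).

End Defs.

(* Main.v *)
Require Import Defs.
From HB Require Import structures.
From mathcomp Require Import all_boot all_order all_algebra.
From mathcomp Require Import all_classical all_reals all_analysis.
From mathcomp Require Import measurable_realfun.
From mathcomp Require Import ring lra.

Set Implicit Arguments.
Unset Strict Implicit.
Unset Printing Implicit Defensive.

Import Order.TTheory GRing.Theory Num.Theory.
Import numFieldNormedType.Exports.
Local Open Scope classical_set_scope.
Local Open Scope ring_scope.

(* Slicing along the first coordinate, a uniform law on a 1-POU set is a mixture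
   of uniform laws on segments [x10, z1]; being such a mixture is exactly what
   survives in the closed hull.

   From Q to P: approximate stretch_law Q (the law of the point at relative
   height U below z) by finite combinations of point masses z, and thicken the
   segment below each z to a thin 1-POU cuboid.

   From P to Q: every 1-POU distribution satisfies P (A - tau e1) >= P A to the
   right of x10 (a closed condition once tested on continuous functions), so for
   fixed B the measure P (dx1, B) has a nonincreasing density S(x, B), obtained
   as the limit of the increments 2^n P (]x, x + 2^-n], B), which increase with n.
   The functions S(., B) are the survival functions of a measure
   M ({z1 > x} x B), realised by a quantile transform, and Q = (z1 - x10) M.  The
   total mass of M is S(x10), the density of P at x10. *)

(** Uniform laws are only available on sets of positive volume, while the extreme laws of the
    mixture, uniform on segments, are singular. So the two problems are compared only through weak
    limits. Translation monotonicity survives them because it is linear in P and involves just two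
    test functions at a time, which one weak neighbourhood controls.

    The obstacle in recovering Q is that S(x, B) is built separately for each B, while survival
    functions given (x_2, ..., x_d) are wanted for all x at once. Hence only the increments of
    countable index, at stages n and rational points q, get Radon-Nikodym densities with respect to
    the law of (x_2, ..., x_d); real points x follow by right-continuity.

    Dyadic windows are used because each splits into two windows of the next stage. The increments
    are then monotone in n at every x, including x = x10, so no almost-everywhere differentiation
    intervenes and the density bound at the single point x10 can be used. *)

Lemma measurable_bool d (T : measurableType d) (b : T -> bool) :
  measurable_fun setT b -> measurable [set x | b x].
Proof. by move=> mb; rewrite -[X in measurable X]setTI; exact: (mb measurableT [set true]). Qed.

(** * Measures and integrals *)

Section ImageMeasure.
Context d d' (T : measurableType d) (T' : measurableType d') (R : realType).

Definition image_measure (m : {measure set T -> \bar R}) (f : T -> T')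
  (mf : measurable_fun setT f) : {measure set T' -> \bar R}.
Proof. by refine (pushforward m f). Defined.

Lemma image_measureE m f (mf : measurable_fun setT f) A :
  image_measure m mf A = m (f @^-1` A).
Proof. by []. Qed.

Lemma ge0_integral_image (m : {measure set T -> \bar R}) (f : T -> T')
    (mf : measurable_fun setT f) (h : T' -> \bar R) :
  measurable_fun setT h -> (forall y, 0 <= h y)%E ->
  (\int[image_measure m mf]_y h y = \int[m]_x h (f x))%E.
Proof.
move=> mh h0; by rewrite ge0_integral_pushforward.
Qed.

End ImageMeasure.

Section AsProbability.
Context d (T : measurableType d) (R : realType).

(** An alias keyed by the proof [m1], on which the probability structure can be declared; the
    existential lemmas below hide it behind an equality of set functions. *)
Definition as_probability (m : {measure set T -> \bar R}) (m1 : m setT = 1%E) :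
  set T -> \bar R := m.

HB.instance Definition _ (m : {measure set T -> \bar R}) (m1 : m setT = 1%E) := Measure.copy (as_probability m1) m.
HB.instance Definition _ (m : {measure set T -> \bar R}) (m1 : m setT = 1%E) :=
  Measure_isProbability.Build _ _ _ (as_probability m1) m1.

Definition as_finite (m : {measure set T -> \bar R}) (mfin : fin_num_fun m) :
  set T -> \bar R := m.

HB.instance Definition _ (m : {measure set T -> \bar R}) (mfin : fin_num_fun m) := Measure.copy (as_finite mfin) m.
HB.instance Definition _ (m : {measure set T -> \bar R}) (mfin : fin_num_fun m) :=
  Measure_isFinite.Build _ _ _ (as_finite mfin) mfin.

Lemma probability_of_measure (m : {measure set T -> \bar R}) : m setT = 1%E ->
  exists P : probability T R, P = m :> (set T -> \bar R).
Proof. by move=> m1; exists (as_probability m1). Qed.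

Lemma finite_of_measure (m : {measure set T -> \bar R}) : (m setT < +oo)%E ->
  exists P : {finite_measure set T -> \bar R}, P = m :> (set T -> \bar R).
Proof.
move=> moo; suff mfin : fin_num_fun m by exists (as_finite mfin).
move=> A mA; rewrite ge0_fin_numE// (le_lt_trans _ moo)// le_measure ?inE//.
Qed.

End AsProbability.

Section LebesgueAffine.
Context {R : realType}.
Local Notation mu := (@lebesgue_measure R).

Lemma measurable_affine (o w : R) : measurable_fun setT (fun s : R => o + s * w).
Proof. by apply: measurable_funD => //; apply: measurable_funM. Qed.

(** Uniqueness of Lebesgue measure: its image under s |-> o + s w, multiplied by w, gives half-open
    intervals their length. *)
Lemma ge0_integral_affine (o w : R) (f : R -> \bar R) : 0 < w ->
  measurable_fun setT f -> (forall x, 0 <= f x)%E ->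
  (\int[mu]_s f (o + s * w)%R = (w^-1)%:E * \int[mu]_x f x)%E.
Proof.
move=> w0 mf f0.
have ma : measurable_fun [set: measurableTypeR R] (fun s : R => o + s * w : measurableTypeR R).
  exact: measurable_affine.
pose nu : {measure set (measurableTypeR R) -> \bar R} :=
  mscale (NngNum (ltW w0)) (image_measure mu ma).
have nuE A : measurable A -> mu A = nu A.
  apply: lebesgue_measure_unique => // X [[a b] _ <-] /=.
  rewrite /nu /mscale/= /pushforward/=.
  have -> : (fun s : R => (o + s * w)%R) @^-1` `]a, b]%classic = `](a - o) / w, (b - o) / w]%classic.
    apply/seteqP; split => x /=; rewrite !in_itv/= ltr_pdivrMr// ler_pdivlMr//; lra.
  rewrite !lebesgue_measure_itv/= !lte_fin.
  rewrite ltr_pM2r ?invr_gt0// ltrD2r.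
  case: ifPn => ab; rewrite ?mule0// -!EFinB -EFinM; congr EFin.
  by field; rewrite gt_eqF.
have -> : (\int[mu]_x f x = \int[nu]_x f x)%E.
  by apply: eq_measure_integral => A mA _; exact: nuE.
rewrite ge0_integral_mscale// (ge0_integral_image mu ma mf f0).
rewrite muleA -EFinM mulVf ?gt_eqF// mul1e.
by [].
Qed.

Lemma lebesgue_measure_affine (o w : R) (A : set R) : 0 < w -> measurable A ->
  (mu ((fun s => (o + s * w)%R) @^-1` A) = (w^-1)%:E * mu A)%E.
Proof.
move=> w0 mA.
have mA' : measurable ((fun s => (o + s * w)%R) @^-1` A).
  by rewrite -[X in measurable X]setTI; exact: measurable_affine.
rewrite -[A in RHS]setIT -integral_indic// -(ge0_integral_affine o)//.
- by rewrite -[X in mu X]setIT -integral_indic.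
- exact/measurable_EFinP/measurable_indic.
Qed.

End LebesgueAffine.

Section RestrictedMeasure.
Context d (T : measurableType d) (R : realType).

Lemma ge0_integral_mrestr (m : {measure set T -> \bar R}) (D : set T)
    (mD : measurable D) (f : T -> \bar R) :
  measurable_fun setT f -> (forall x, 0 <= f x)%E ->
  (\int[mrestr m mD]_x f x = \int[m]_(x in D) f x)%E.
Proof.
move=> mf f0.
have D0 : mrestr m mD (~` D) = 0%E by rewrite /mrestr setICl measure0.
rewrite (ge0_negligible_integral _ _ _ _ D0)//; last exact: measurableC.
rewrite setTD setCK; apply: eq_measure_integral => A mA AD.
by rewrite /= /mrestr setIidl.
Qed.

End RestrictedMeasure.

Section DensityMeasure.
Context d (T : measurableType d) (R : realType).

(** The measure with density w is the first marginal of m times Lebesgue measure restricted to the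
    region under the graph of w, so countable additivity comes for free. *)
Lemma density_measure (m : {finite_measure set T -> \bar R}) (w : T -> R) :
  measurable_fun setT w -> (forall x, 0 <= w x) ->
  exists Q : {measure set T -> \bar R}, forall f, measurable_fun setT f ->
    (forall x, 0 <= f x)%E -> (\int[Q]_x f x = \int[m]_x (f x * (w x)%:E))%E.
Proof.
move=> mw w0.
pose D := [set p : T * measurableTypeR R | 0 <= p.2 < w p.1].
have mD : measurable D.
  apply: (@measurable_bool _ _ (fun p : T * measurableTypeR R => (0 <= p.2) && (p.2 < w p.1))). 
  apply: measurable_and; first exact: measurable_fun_ler.
  by apply: measurable_fun_ltr => //; exact: measurableT_comp.
exists (image_measure (mrestr (m \x (@lebesgue_measure R))%E mD) measurable_fst).
move=> f mf f0; rewrite ge0_integral_image//=.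
transitivity (\int[m \x (@lebesgue_measure R)]_(x in D) f x.1)%E.
  apply: (@ge0_integral_mrestr _ _ _ (m \x (@lebesgue_measure R))%E D mD (f \o fst)) => //.
    exact: measurableT_comp.
  by move=> p; exact: f0.
rewrite integral_mkcond fubini_tonelli1//; last 2 first.
- have h := measurable_restrictT (fun x : T * measurableTypeR R => f x.1) mD.
  by apply: (proj1 h); apply: measurable_funTS; apply: (measurableT_comp mf).
- by move=> p; rewrite patchE; case: ifPn.
apply: eq_integral => x _; rewrite /fubini_F.
transitivity (\int[@lebesgue_measure R]_(y in `[0%R, w x[) cst (f x) y)%E.
  rewrite [RHS]integral_mkcond; apply: eq_integral => y _.
  have xyE : ((x, y) \in D) = (y \in `[0%R, w x[%classic).
    by apply/idP/idP => h; rewrite inE/= ?in_itv/=; move: h; rewrite inE/= ?in_itv/=.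
  by rewrite !patchE xyE.
rewrite integral_cst//= lebesgue_measure_itv/= lte_fin oppr0 addr0.
by case: ltP => // w0'; congr (_ * _%:E)%E; apply/eqP; rewrite eq_le w0.
Qed.

End DensityMeasure.

Section IteratedVolume.
Context {R : realType}.
Local Notation mu := (@lebesgue_measure R).

Lemma tvol_ge0 n (f : n.-tuple R -> \bar R) :
  (forall t, 0 <= f t)%E -> (0 <= tvol f)%E.
Proof.
elim: n f => [f f0|n IH f f0] /=; first exact: f0.
by apply: integral_ge0 => x _; apply: IH => t; exact: f0.
Qed.

(** The parameter space X is arbitrary because each induction step moves one tuple coordinate into
    it. *)
Lemma measurable_tvol n d (X : measurableType d) (f : X * n.-tuple R -> \bar R) :
  measurable_fun setT f -> (forall p, 0 <= f p)%E ->
  measurable_fun setT (fun x => tvol (fun t => f (x, t))).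
Proof.
elim: n d X f => [|n IH] d X f mf f0 /=.
  by apply: (measurableT_comp mf); exact: measurable_pair2.
have := IH _ (X * measurableTypeR R)%type (fun p => f (p.1.1, cons_tuple p.1.2 p.2)).
move=> /(_ _ _)/=; set g := (fun p : X * measurableTypeR R => tvol _) => mg.
apply: (@measurable_fun_fubini_tonelli_F _ _ _ _ _ mu g).
  apply: mg => [|p]; last exact: f0.
  apply: (measurableT_comp mf); apply/measurable_fun_pairP; split.
    exact: (measurableT_comp measurable_fst measurable_fst).
  apply: (@measurable_cons _ _ (X * measurableTypeR R * n.-tuple R)%type R
    (fun p => p.1.2) n snd) => //.
  exact: (measurableT_comp measurable_snd measurable_fst).
by move=> p; apply: tvol_ge0 => t; exact: f0.
Qed.

Lemma le_tvol n (f g : n.-tuple R -> \bar R) :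
  measurable_fun setT f -> measurable_fun setT g -> (forall t, 0 <= f t)%E ->
  (forall t, f t <= g t)%E -> (tvol f <= tvol g)%E.
Proof.
elim: n f g => [|n IH] f g mf mg f0 fg /=; first exact: fg.
have mc x : measurable_fun setT (fun t : n.-tuple R => cons_tuple x t).
  exact: (@measurable_cons _ _ _ R (cst x) n id).
have mc2 : measurable_fun setT (fun p : measurableTypeR R * n.-tuple R => cons_tuple p.1 p.2).
  exact: (@measurable_cons _ _ _ R fst n snd).
have g0 t : (0 <= g t)%E by exact: le_trans (f0 t) (fg t).
apply: ge0_le_integral => //.
- by move=> x _; exact: tvol_ge0.
- apply: (@measurable_tvol n _ _ (fun p : measurableTypeR R * n.-tuple R => f (cons_tuple p.1 p.2))) => //.
  exact: measurableT_comp.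
- apply: (@measurable_tvol n _ _ (fun p : measurableTypeR R * n.-tuple R => g (cons_tuple p.1 p.2))) => //.
  exact: measurableT_comp.
- move=> x _; apply: IH => //; [exact: (measurableT_comp mf (mc x))|exact: (measurableT_comp mg (mc x))].
Qed.

End IteratedVolume.

(** * Lebesgue volume of cuboids and translations *)

Section Shift.
Context {R : realType} {m : nat}.
Local Notation T := (m.+1.-tuple R).
Local Notation mu := (@lebesgue_measure R).

Lemma measurable_rest : measurable_fun setT (@rest R m).
Proof. exact: measurable_behead. Qed.

Lemma rest_cons (x : R) (t : m.-tuple R) : rest (cons_tuple x t) = t.
Proof. exact: val_inj. Qed.

Lemma cons_rest (t : T) : cons_tuple (tnth t ord0) (rest t) = t.
Proof. by rewrite [RHS]tuple_eta; apply: val_inj. Qed.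

Lemma tnth_rest (t : T) j : tnth (rest t) j = tnth t (lift ord0 j).
Proof. by rewrite -[in RHS](cons_rest t) tnthS. Qed.

Definition shift (tau : R) (t : T) : T := cons_tuple (tnth t ord0 - tau) (rest t).

Lemma measurable_shift tau : measurable_fun setT (shift tau).
Proof.
apply: (@measurable_cons _ _ _ _ (fun t : T => tnth t ord0 - tau) m (@rest R m)).
  by apply: measurable_funB => //; exact: measurable_tnth.
exact: measurable_rest.
Qed.

(** Sliding the part of K in A + tau e1 down by tau keeps its volume and lands in A. The slid points
    are still right of [o], since A is, and below points of K; the 1-POU property therefore keeps
    them in K. *)
Lemma uniform_on_shift (x0 : 'I_m.+1 -> \bar R) (o tau : R)
    (U : {measure set T -> \bar R}) (K A : set T) : x0 ord0 = o%:E -> 0 <= tau ->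
  POU1_set x0 K -> uniform_on U K -> measurable A ->
  A `<=` [set t | o < tnth t ord0] -> (U (shift tau @^-1` A) <= U A)%E.
Proof.
move=> x0o tau0 [mK KD K1] [K0 UE] mA Ao.
have mSA : measurable (shift tau @^-1` A).
  by rewrite -[X in measurable X]setTI; exact: measurable_shift.
rewrite !UE//; apply: lee_wpmul2r.
  by rewrite lee_fin invr_ge0 fine_ge0// ltW//; case/andP: K0.
have m2 : measurable_fun setT (fun p : measurableTypeR R * m.-tuple R => cons_tuple p.1 p.2).
  exact: (@measurable_cons _ _ _ R fst m snd).
have m1 x : measurable_fun setT (fun t : m.-tuple R => cons_tuple x t).
  exact: (@measurable_cons _ _ _ R (cst x) m id).
have mi (B : set T) : measurable B -> measurable_fun setT (fun t => (\1_B t)%:E : \bar R).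
  by move=> mB; exact/measurable_EFinP/measurable_indic.
have mG (B : set T) : measurable B ->
    measurable_fun setT (fun x : measurableTypeR R => tvol (fun t => (\1_B (cons_tuple x t))%:E : \bar R)).
  move=> mB; apply: (@measurable_tvol _ m _ _ (fun p : measurableTypeR R * m.-tuple R =>
    (\1_B (cons_tuple p.1 p.2))%:E)) => [|p]; last by rewrite lee_fin.
  exact: (measurableT_comp (mi _ mB) m2).
rewrite /lebvol /=.
pose G x := tvol (fun t => (\1_(A `&` K) (cons_tuple x t))%:E : \bar R).
have mAK : measurable (A `&` K) by exact: measurableI.
have mSAK : measurable (shift tau @^-1` A `&` K) by exact: measurableI.
(* Only the outermost of the iterated integrals is translated, so one-dimensional invariance
   suffices. *)
have -> : (\int[mu]_x tvol (fun t => (\1_(A `&` K) (cons_tuple x t))%:E) =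
    \int[mu]_x G ((- tau) + x * 1)%R)%E.
  rewrite (ge0_integral_affine _ ltr01) ?invr1 ?mul1e//; first exact: mG.
  by move=> x; apply: tvol_ge0 => t; rewrite lee_fin.
apply: ge0_le_integral => //.
- by move=> x _; apply: tvol_ge0 => t; rewrite lee_fin.
- exact: mG.
- apply: (measurableT_comp (mG _ mAK)) => /=.
  exact: measurable_affine.
move=> x _; apply: le_tvol.
- exact: (measurableT_comp (mi _ mSAK) (m1 x)).
- exact: (measurableT_comp (mi _ mAK) (m1 _)).
- by move=> t; rewrite lee_fin.
move=> t; rewrite lee_fin !indicE mulr1.
case: (boolP (_ \in _)) => //; rewrite inE => -[/= + Kt].
rewrite /shift /= rest_cons /= => At.
rewrite mem_set//; rewrite addrC; split => //.
apply: (K1 _ _ Kt); rewrite /= ?x0o ?lee_fin; first by move/Ao: At => /= /ltW.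
  by rewrite gerBl.
by move=> j; case: (unliftP ord0 j) => [k ->|-> /eqP//] _; rewrite !tnthS.
Qed.

End Shift.

Section Cube.
Context {R : realType}.
Local Notation mu := (@lebesgue_measure R).
Local Notation Rm := (measurableTypeR R).

Definition affine_tuple n (a w : 'I_n -> R) (t : n.-tuple R) : n.-tuple R :=
  [tuple a j + w j * tnth t j | j < n].

Lemma measurable_affine_tuple n (a w : 'I_n -> R) :
  measurable_fun setT (affine_tuple a w).
Proof.
apply/measurable_fun_tnthP => j.
rewrite (_ : _ \o _ = (fun t : n.-tuple R => a j + w j * tnth t j)).
  apply: measurable_funD => //; apply: measurable_funM => //.
  exact: measurable_tnth.
by apply/funext => t /=; rewrite tnth_mktuple.
Qed.

Lemma affine_tuple_cons n (a w : 'I_n.+1 -> R) x (t : n.-tuple R) :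
  affine_tuple a w (cons_tuple x t) = cons_tuple (a ord0 + w ord0 * x)
    (affine_tuple (fun j => a (lift ord0 j)) (fun j => w (lift ord0 j)) t).
Proof.
apply: eq_from_tnth => j; rewrite tnth_mktuple.
by case: (unliftP ord0 j) => [k ->|->] //; rewrite !tnthS tnth_mktuple.
Qed.

Definition cuboid n (a w : 'I_n -> R) : set (n.-tuple R) :=
  [set t | forall j, a j <= tnth t j <= a j + w j].

Lemma tvol0 n : tvol (fun _ : n.-tuple R => 0%:E) = 0%:E :> \bar R.
Proof.
elim: n => [|n IH] //=.
by under eq_integral do rewrite IH; rewrite integral0.
Qed.

(** The uniform law on the unit cube, specified through all its affine images at once. The induction
    on the dimension needs this form, and it exhibits the uniform law on any cuboid as an image of
    C. *)
Definition cube_law n (C : probability (n.-tuple R) R) :=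
  forall a w : 'I_n -> R, (forall j, 0 < w j) -> forall A, measurable A ->
  lebvol (A `&` cuboid a w) =
    ((\prod_j w j)%:E * C (affine_tuple a w @^-1` A))%E.

Lemma measurable_cons_pair n :
  measurable_fun setT (fun p : Rm * n.-tuple R => (cons_tuple (p.1 : R) p.2 : n.+1.-tuple R)).
Proof. exact: (@measurable_cons _ _ _ R fst n snd). Qed.

Lemma lebvol_cuboidS n (C : probability (n.-tuple R) R) : cube_law C ->
  forall a w : 'I_n.+1 -> R, (forall j, 0 < w j) -> forall A, measurable A ->
  lebvol (A `&` cuboid a w) =
    ((\prod_j w j)%:E * ((uniform_prob (@ltr01 R)) \x C)%E
       ((fun p => affine_tuple a w (cons_tuple (p.1 : R) p.2)) @^-1` A))%E.
Proof.
move=> CE a w w0 A mA.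
pose a' j := a (lift ord0 j); pose w' j := w (lift ord0 j).
pose B := [set p : Rm * n.-tuple R | A (cons_tuple p.1 (affine_tuple a' w' p.2))].
have mB : measurable B.
  rewrite -[X in measurable X]setTI.
  apply: (@measurable_cons _ _ (Rm * n.-tuple R)%type R fst n (fun p => affine_tuple a' w' p.2)) => //.
  exact: (measurableT_comp (measurable_affine_tuple a' w') measurable_snd).
pose I := `[a ord0, a ord0 + w ord0]%classic.
(* The probability of the slice of A at x, in coordinates rescaled to the unit cube, cut off outside
   the first edge I. *)
pose H x := (C (xsection B x) * (\1_I x)%:E)%E.
have mH : measurable_fun setT H.
  apply: emeasurable_funM; first exact: measurable_fun_xsection.
  by apply/measurable_EFinP; apply: measurable_indic; exact: (@measurable_itv R `[a ord0, a ord0 + w ord0]).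
have H0 x : (0 <= H x)%E by rewrite mule_ge0// lee_fin.
have W0 : (0 <= (\prod_j w' j)%:E)%E by rewrite lee_fin prodr_ge0// => j _; exact/ltW/w0.
have LE x : tvol (fun t => (\1_(A `&` cuboid a w) (cons_tuple x t))%:E : \bar R) =
    ((\prod_j w' j)%:E * H x)%E.
  pose Ax := [set t : n.-tuple R | A (cons_tuple x t)].
  have mAx : measurable Ax.
    rewrite -[X in measurable X]setTI.
    exact: (@measurable_cons _ _ _ R (cst x) n id).
  have xB : xsection B x = affine_tuple a' w' @^-1` Ax.
    by apply/seteqP; split => t /=; rewrite /xsection/= inE.
  rewrite /H xB muleA -CE//; last by move=> j; exact: w0.
  have cE (t : n.-tuple R) : \1_(A `&` cuboid a w) (cons_tuple x t) =
      \1_(Ax `&` cuboid a' w') t * \1_I x :> R.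
    rewrite !indicE -natrM mulnb; congr (nat_of_bool _)%:R.
    apply/idP/andP; rewrite !inE /=.
      move=> [At Kt]; split; first split => //.
        by move=> j; have := Kt (lift ord0 j); rewrite tnthS.
      by have := Kt ord0; rewrite /I/= in_itv/=.
    rewrite /I/= in_itv/= => -[[At Kt] Ix]; split => // j.
    by case: (unliftP ord0 j) => [k ->|->] //; rewrite tnthS; exact: Kt.
  under [in LHS]eq_fun do rewrite cE.
  have [xI|xI] := boolP (x \in I).
    rewrite !indicE xI mule1 /lebvol; congr tvol.
    by apply/funext => t; rewrite mulr1.
  rewrite !indicE (negbTE xI) mule0.
  by under [in LHS]eq_fun do rewrite mulr0; exact: tvol0.
rewrite /lebvol /= (eq_integral (fun x => ((\prod_j w' j)%:E * H x)%E)); last first.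
  by move=> x _; exact: LE.
rewrite ge0_integralZl//.
rewrite big_ord_recl/= [(w ord0 * _)%R]mulrC EFinM -muleA; congr (_ * _)%E.
rewrite /product_measure1.
pose B2 := (fun p : Rm * n.-tuple R => (cons_tuple (p.1 : R) p.2 : n.+1.-tuple R)) @^-1` (affine_tuple a w @^-1` A).
have mB2 : measurable B2.
  rewrite -[X in measurable X]setTI; apply: measurable_cons_pair => //.
  by rewrite -[X in measurable X]setTI; exact: measurable_affine_tuple.
rewrite integral_uniform//; last exact: measurable_fun_xsection.
rewrite subr0 invr1 mul1e.
have -> : (\int[mu]_x H x = (w ord0)%:E * \int[mu]_s H (a ord0 + s * w ord0)%R)%E.
  by rewrite ge0_integral_affine// muleA -EFinM divff ?gt_eqF// mul1e.
congr (_ * _)%E; rewrite [RHS]integral_mkcond; apply: eq_integral => s _.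
rewrite patchE /H indicE /I.
have -> : (a ord0 + s * w ord0 \in `[a ord0, a ord0 + w ord0]%classic) = (s \in `[0%R, 1%R]%classic).
  have w00 := w0 ord0.
  apply/idP/idP => h; rewrite inE/= ?in_itv/=; move: h; rewrite inE/= ?in_itv/=.
    by rewrite lerDl lerD2l pmulr_lge0// ger_pMl.
  by rewrite lerDl lerD2l pmulr_lge0// ger_pMl.
case: ifPn => _; rewrite ?mule1 ?mule0//=.
congr (C _); apply/seteqP; split => t; rewrite /xsection /= !inE /B /= affine_tuple_cons mulrC //.
Qed.

Lemma exists_cube_law n : exists C : probability (n.-tuple R) R, cube_law C.
Proof.
elim: n => [|n [C CE]].
  exists (\d_ [tuple])%R => a w _ A mA; rewrite big_ord0 mul1e /lebvol /=.
  rewrite diracE indicE in_setI (_ : _ \in cuboid a w) ?andbT; last first.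
    by rewrite inE => -[].
  congr ((nat_of_bool _)%:R%:E); apply/idP/idP; rewrite !inE/=.
    by rewrite (_ : affine_tuple a w _ = [tuple])//; exact: tuple0.
  by rewrite (_ : affine_tuple a w _ = [tuple])//; exact: tuple0.
pose U : probability Rm R := uniform_prob (@ltr01 R).
have UC1 : image_measure (U \x C)%E (@measurable_cons_pair n) setT = 1%E.
  by rewrite /= /pushforward preimage_setT probability_setT.
have [C' C'E] := probability_of_measure UC1.
exists C' => a w w0 A mA; rewrite C'E.
exact: lebvol_cuboidS.
Qed.

End Cube.

(** * Measurability on tuples and finite approximation of integrals *)

Section TupleMeasurability.
Context {R : realType}.

Lemma measurable_forall_tnth n (A : 'I_n -> set R) :
  (forall j, measurable (A j)) ->
  measurable [set t : n.-tuple R | forall j, A j (tnth t j)].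
Proof.
move=> mA.
rewrite (_ : [set _ | _] = \bigcap_(j in [set: 'I_n]) [set t : n.-tuple R | A j (tnth t j)]).
  apply: fin_bigcap_measurable => [|j _]; first exact: finite_finset.
  by rewrite -[X in measurable X]setTI; exact: measurable_tnth.
by apply/seteqP; split => t h => [j _|j]; exact: h.
Qed.

Lemma measurable_itv_ereal (a b : \bar R) : measurable [set x : R | (a <= x%:E <= b)%E].
Proof.
apply: (@measurable_bool _ _ (fun x : R => (a <= x%:E)%E && (x%:E <= b)%E)).
by apply: measurable_and; apply: measurable_fun_lee => //; exact: EFin_measurable.
Qed.

Lemma measurable_D0 m (x0 : 'I_m.+1 -> \bar R) : measurable (D0 x0).
Proof.
apply: (@measurable_forall_tnth _ (fun j => [set x : R | (x0 j <= x%:E)%E])) => j.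
apply: (@measurable_bool _ _ (fun x : R => (x0 j <= x%:E)%E)).
by apply: measurable_fun_lee => //; exact: EFin_measurable.
Qed.

(* Rounding up, not down, keeps the points of D0 inside D0. *)
Definition round_up k n (t : n.-tuple R) : n.-tuple R :=
  [tuple (Num.ceil (k.+1%:R * tnth t j))%:~R / k.+1%:R | j < n].

Lemma round_up_ge k n (t : n.-tuple R) j : tnth t j <= tnth (round_up k t) j.
Proof.
by rewrite tnth_mktuple ler_pdivlMr// mulrC; exact: ceil_ge.
Qed.

Lemma round_up_lt k n (t : n.-tuple R) j :
  tnth (round_up k t) j < tnth t j + k.+1%:R^-1.
Proof.
rewrite tnth_mktuple ltr_pdivrMr// mulrDl mulVf ?pnatr_eq0//.
have := ceilB1_lt (k.+1%:R * tnth t j).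
by rewrite intrB ltrBlDr mulrC.
Qed.

(** [round_up k] factors through the countable set of integer tuples, so any function of it is
    measurable. *)
Lemma measurable_comp_round_up k n (f : n.-tuple R -> R) :
  measurable_fun setT (f \o @round_up k _).
Proof.
move=> _ Y mY; rewrite setTI.
pose dec (v : n.-tuple int) : n.-tuple R := [tuple (tnth v j)%:~R / k.+1%:R | j < n].
pose F v := if `[<Y (f (dec v))>] then
  [set t : n.-tuple R | forall j, Num.ceil (k.+1%:R * tnth t j) = tnth v j] else set0.
have -> : (f \o @round_up k _) @^-1` Y = \bigcup_v F v.
  apply/seteqP; split => [t /= Yt|t [v _]].
    pose v := [tuple Num.ceil (k.+1%:R * tnth t j) | j < n].
    exists v => //; rewrite /F.
    have -> : dec v = round_up k t.
      by apply: eq_from_tnth => j; rewrite !tnth_mktuple.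
    by rewrite asboolT// => j; rewrite tnth_mktuple.
  rewrite /F; case: asboolP => // Yv tv /=.
  rewrite (_ : round_up k t = dec v)//.
  by apply: eq_from_tnth => j; rewrite !tnth_mktuple tv.
apply: countable_bigcupT_measurable => [|v]; first exact: countableP.
rewrite /F; case: asboolP => // _.
apply: (@measurable_forall_tnth _ (fun j => [set x | Num.ceil (k.+1%:R * x) = tnth v j])) => j.
rewrite (_ : [set _ | _] = [set x : R | (tnth v j - 1)%:~R < k.+1%:R * x <= (tnth v j)%:~R]).
  apply: (@measurable_bool _ _ (fun x : R => ((tnth v j - 1)%:~R < k.+1%:R * x) && (k.+1%:R * x <= (tnth v j)%:~R))).
  apply: measurable_and.
    by apply: measurable_fun_ltr => //; apply: measurable_funM.
  by apply: measurable_fun_ler => //; apply: measurable_funM.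
apply/seteqP; split => x /=; first by move=> <-; exact: ceil_itv.
by move=> h; exact: ceil_def.
Qed.

(** Continuity is relative to [D0 x0], so f is recovered there as a pointwise limit of functions of
    the rounded point. *)
Lemma bdd_cont_on_measurable m (x0 : 'I_m.+1 -> \bar R) f :
  bdd_cont_on (D0 x0) f -> measurable_fun (D0 x0) f.
Proof.
move=> [_ fc]; apply: (@measurable_fun_cvg _ _ _ _ (fun k => f \o @round_up k _)).
  by move=> k; apply: measurable_funTS; exact: measurable_comp_round_up.
move=> t Dt; apply/cvgrPdist_lt => e e0.
have [del del0 h] := fc t Dt e e0.
near=> k; rewrite distrC; apply: h => [j|j].
  by rewrite (le_trans (Dt j))// lee_fin round_up_ge.
rewrite ger0_norm ?subr_ge0 ?round_up_ge// ltrBlDl.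
rewrite (lt_trans (round_up_lt _ _ _))// ltrD2l.
by near: k; exact: (near_infty_natSinv_lt (PosNum del0)).
Unshelve. all: by end_near. Qed.

End TupleMeasurability.

Section MeanInHull.
Context {R : realType} d (X : measurableType d).

Lemma ge0_integral_full (Q : probability X R) (D : set X) (f : X -> \bar R) :
  measurable D -> Q D = 1%E -> measurable_fun setT f -> (forall x, 0 <= f x)%E ->
  (\int[Q]_(x in D) f x = \int[Q]_x f x)%E.
Proof.
move=> mD QD mf f0.
have QD0 : Q (~` D) = 0%E by rewrite probability_setC// QD subee.
rewrite [RHS](ge0_negligible_integral _ _ _ _ QD0)//; last exact: measurableC.
by rewrite setTD setCK.
Qed.

(** The space is cut into finitely many cells on which every [G i] varies by less than e; each cell
    is replaced by one of its points, with the Q-measure of the cell as weight. *)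
Lemma mean_in_hull (Q : probability X R) (D : set X) k (G : 'I_k -> X -> R) (B e : R) :
  measurable D -> Q D = 1%E -> (forall i, measurable_fun setT (G i)) ->
  (forall i x, 0 <= G i x <= B) -> 0 < e ->
  exists n (lam : 'I_n -> R) (z : 'I_n -> X),
    [/\ forall j, 0 <= lam j, \sum_j lam j = 1, forall j, D (z j) &
      forall i, `|fine (\int[Q]_x (G i x)%:E) - \sum_j lam j * G i (z j)| <= e].
Proof.
move=> mD QD mG G0B e0.
have [xD DxD] : exists x, D x.
  apply/set0P/eqP => D0; move: QD; rewrite D0 measure0 => /eqP.
  by rewrite eq_sym onee_eq0.
have IQc r : (\int[Q]_(x in D) (cst r%:E) x = r%:E)%E.
  by rewrite integral_cst//; have /= -> := QD; rewrite mule1.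
pose N := Num.truncn (B / e).
pose I := {ffun 'I_k -> 'I_N.+1}.
pose c i x := Num.truncn (G i x / e).
have Ge0 i x : 0 <= G i x / e by rewrite divr_ge0 ?(ltW e0)//; case/andP: (G0B i x).
have cN i x : (c i x < N.+1)%N.
  rewrite ltnS /c /N; apply: le_truncn; rewrite ler_pM2r ?invr_gt0//.
  by case/andP: (G0B i x).
pose code x : I := [ffun i => Ordinal (cN i x)].
pose cell (phi : I) := [set x | code x = phi].
have mcell phi : measurable (cell phi).
  rewrite (_ : cell phi = \bigcap_(i in [set: 'I_k]) [set x | c i x = phi i]).
    apply: fin_bigcap_measurable => [|i _]; first exact: finite_finset.
    rewrite (_ : [set _ | _] = [set x | ((phi i)%:R <= G i x / e) && (G i x / e < (phi i).+1%:R)]).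
      apply: measurable_bool; apply: measurable_and.
        by apply: measurable_fun_ler => //; exact: measurable_funM.
      by apply: measurable_fun_ltr => //; exact: measurable_funM.
    by apply/seteqP; split => x /=; [move=> <-; exact: truncn_itv|exact: truncn_def].
  apply/seteqP; split => x /=; first by move=> <- i _; rewrite ffunE.
  by move=> h; apply/ffunP => i; apply: val_inj; rewrite ffunE /=; exact: h.
(* A cell that misses D has weight 0; the default [xD] only keeps its representative inside D. *)
pose rep phi := xget xD (D `&` cell phi).
have repD phi : D (rep phi).
  by rewrite /rep; case: xgetP => // y -> [].
have repcell x : D x -> code (rep (code x)) = code x.
  move=> Dx; rewrite /rep; case: xgetP => [y _ []//|/(_ x)[]//].
have hE (h : I -> R) x : h (code x) = \sum_phi h phi * \1_(cell phi) x.
  rewrite (bigD1 (code x))//= indicE mem_set// mulr1 big1 ?addr0// => phi ne.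
  by rewrite indicE memNset ?mulr0// => /esym/eqP; rewrite (negbTE ne).
have mh (h : I -> R) : measurable_fun setT (h \o code).
  rewrite (_ : _ \o _ = fun x => \sum_phi h phi * \1_(cell phi) x).
    apply: measurable_sum => phi; exact: measurable_funM.
  by apply/funext => x; exact: hE.
have Ih (h : I -> R) : (forall phi, 0 <= h phi) ->
    (\int[Q]_(x in D) (h (code x))%:E = (\sum_phi h phi * fine (Q (D `&` cell phi)))%:E)%E.
  move=> h0; under eq_integral do rewrite hE -sumEFin.
  rewrite ge0_integral_sum//; last 2 first.
  - by move=> phi; apply/measurable_EFinP; exact: measurable_funM.
  - by move=> phi x _; rewrite lee_fin mulr_ge0.
  rewrite -sumEFin; apply: eq_bigr => phi _.
  under eq_integral do rewrite EFinM.
  rewrite ge0_integralZl//; last 2 first.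
  - by apply/measurable_EFinP; exact: measurable_indic.
  - by rewrite lee_fin.
  have QIf : Q (D `&` cell phi) \is a fin_num.
    by apply: fin_num_measure; exact: measurableI.
  by rewrite integral_indic// setIC EFinM fineK.
exists #|I|, (fun j => fine (Q (D `&` cell (enum_val j)))), (fun j => rep (enum_val j)).
have reidx (F : I -> R) : \sum_(j < #|I|) F (enum_val j) = \sum_phi F phi.
  by rewrite [RHS](reindex _ (onW_bij _ (@enum_val_bij I))).
split.
- by move=> j; rewrite fine_ge0.
- rewrite (reidx (fun phi => fine (Q (D `&` cell phi)))).
  have := IQc 1.
  rewrite (Ih (cst 1) (fun _ => ler01)) => -[<-].
  by apply: eq_bigr => phi _; rewrite mul1r.
- by move=> j; exact: repD.
move=> i; rewrite (reidx (fun phi => fine (Q (D `&` cell phi)) * G i (rep phi))).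
have G0 x : 0 <= G i x by case/andP: (G0B i x).
rewrite -(@ge0_integral_full _ D)//; last first.
  exact/measurable_EFinP.
have -> : \sum_phi fine (Q (D `&` cell phi)) * G i (rep phi) =
    fine (\int[Q]_(x in D) (G i (rep (code x)))%:E).
  rewrite (Ih (fun phi => G i (rep phi)))//=.
  by apply: eq_bigr => phi _; rewrite mulrC.
have close x : D x -> `|G i x - G i (rep (code x))| <= e.
  move=> Dx; have /(congr1 (fun phi : I => nat_of_ord (phi i))) := repcell x Dx.
  rewrite !ffunE/= /c => cE.
  have /andP[] := truncn_itv (Ge0 i x); have /andP[] := truncn_itv (Ge0 i (rep (code x))).
  rewrite cE -natr1 !ler_pdivlMr// !ltr_pdivrMr// mulrDl mul1r.
  set v := (_ * e)%R => a1 a2 a3 a4.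
  by rewrite ler_norml; apply/andP; split; lra.
have mGi : measurable_fun D (EFin \o G i) by apply/measurable_EFinP; exact: measurable_funTS.
have mGr : measurable_fun D (fun x => (G i (rep (code x)))%:E).
  by apply/measurable_EFinP; apply: measurable_funTS; exact: (mh (fun phi => G i (rep phi))).
have fin1 (g : X -> R) : measurable_fun D (EFin \o g) -> (forall x, 0 <= g x <= B) ->
    (\int[Q]_(x in D) (g x)%:E)%E \is a fin_num.
  move=> mg g0B; rewrite ge0_fin_numE; last first.
    by apply: integral_ge0 => x _; rewrite lee_fin; case/andP: (g0B x).
  apply: (@le_lt_trans _ _ (\int[Q]_(x in D) (cst B%:E) x)%E).
    by apply: ge0_le_integral => // x _; rewrite lee_fin; case/andP: (g0B x).
  by rewrite IQc ltry.
have le1 (g h : X -> R) : measurable_fun D (EFin \o g) -> measurable_fun D (EFin \o h) ->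
   (forall x, 0 <= g x <= B) -> (forall x, 0 <= h x <= B) ->
   (forall x, D x -> g x <= h x + e) ->
   fine (\int[Q]_(x in D) (g x)%:E) <= fine (\int[Q]_(x in D) (h x)%:E) + e.
  move=> mg mh' g0B h0B gh.
  rewrite -lee_fin EFinD !fineK ?fin1//.
  have -> : e%:E = (\int[Q]_(x in D) (cst e%:E) x)%E by rewrite IQc.
  rewrite -ge0_integralD//; last 2 first.
  - by move=> x _; rewrite lee_fin; case/andP: (h0B x).
  - by move=> x _; rewrite lee_fin ltW.
  apply: ge0_le_integral => //.
  - by move=> x _; rewrite lee_fin; case/andP: (g0B x).
  - by apply: emeasurable_funD.
have h1 : fine (\int[Q]_(x in D) (G i x)%:E) <= fine (\int[Q]_(x in D) (G i (rep (code x)))%:E) + e.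
  by apply: le1 => // x Dx; have := close x Dx; rewrite ler_norml => /andP[]; lra.
have h2 : fine (\int[Q]_(x in D) (G i (rep (code x)))%:E) <= fine (\int[Q]_(x in D) (G i x)%:E) + e.
  by apply: le1 => // x Dx; have := close x Dx; rewrite ler_norml => /andP[]; lra.
by rewrite ler_norml; apply/andP; split; lra.
Qed.

End MeanInHull.

Section BoundedIntegral.
Context {R : realType} d (X : measurableType d).

Lemma bounded_integral (P : {measure set X -> \bar R}) (g : X -> R) (B : R) :
  P setT = 1%E -> measurable_fun setT g -> (forall x, 0 <= g x <= B) ->
  (\int[P]_x (g x)%:E)%E \is a fin_num /\ 0 <= fine (\int[P]_x (g x)%:E)%E <= B.
Proof.
move=> P1 mg gB.
have h0 : (0 <= \int[P]_x (g x)%:E)%E.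
  by apply: integral_ge0 => x _; rewrite lee_fin; case/andP: (gB x).
have hB : (\int[P]_x (g x)%:E <= B%:E)%E.
  apply: (@le_trans _ _ (\int[P]_x (cst B%:E) x)%E).
    apply: ge0_le_integral => //.
    - by move=> x _; rewrite lee_fin; case/andP: (gB x).
    - exact/measurable_EFinP.
    - by move=> x _; rewrite lee_fin; case/andP: (gB x).
  by rewrite integral_cst// P1 mule1.
have hf : (\int[P]_x (g x)%:E)%E \is a fin_num.
  by rewrite ge0_fin_numE// (le_lt_trans hB)// ltry.
by split=> //; rewrite -!lee_fin fineK// h0.
Qed.

End BoundedIntegral.

(** * Stretched distributions are 1-POU *)

Section StretchLaw.
Context {R : realType} {m : nat}.
Local Notation T := (m.+1.-tuple R).
Local Notation Rm := (measurableTypeR R).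
Local Notation mu := (@lebesgue_measure R).

Definition unif01 : probability Rm R := uniform_prob (@ltr01 R).

Lemma integral_unif01 (f : R -> \bar R) : measurable_fun setT f ->
  (forall x, 0 <= f x)%E -> (\int[unif01]_s f s = \int[mu]_(s in `[0%R, 1%R]) f s)%E.
Proof. by move=> mf f0; rewrite integral_uniform// subr0 invr1 mul1e. Qed.

(** The open interval is the range of U in the statement of the theorem, and it keeps stretched
    points strictly right of [o]. *)
Lemma integral_unif01_oo (f : R -> \bar R) : measurable_fun setT f ->
  (forall x, 0 <= f x)%E -> (\int[unif01]_s f s = \int[mu]_(s in `]0%R, 1%R[) f s)%E.
Proof.
move=> mf f0; rewrite integral_unif01// integral_itv_bndoo//.
exact: measurable_funTS.
Qed.

Lemma measurable_stretch (o : R) :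
  measurable_fun setT (fun p : T * Rm => stretch o p.1 (p.2 : R)).
Proof.
have m1 : measurable_fun setT (fun p : T * Rm => tnth p.1 ord0 - o).
  apply: measurable_funB => //.
  exact: (measurableT_comp (measurable_tnth ord0) measurable_fst).
apply: (@measurable_cons _ _ (T * Rm)%type R
  (fun p => o + p.2 * (tnth p.1 ord0 - o)) m (fun p => rest p.1)).
  apply: measurable_funD => //; apply: measurable_funM => //.
exact: (measurableT_comp measurable_rest measurable_fst).
Qed.

Definition stretch_law (o : R) (Q : {measure set T -> \bar R}) :
  {measure set T -> \bar R} := image_measure (Q \x unif01)%E (measurable_stretch o).

Lemma ge0_integral_stretch_law (o : R) (Q : probability T R) (f : T -> \bar R) :
  measurable_fun setT f -> (forall t, 0 <= f t)%E ->
  (\int[stretch_law o Q]_t f t = \int[Q]_z \int[unif01]_s f (stretch o z s))%E.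
Proof.
move=> mf f0; rewrite ge0_integral_image// fubini_tonelli1//.
exact: (measurableT_comp mf (measurable_stretch o)).
Qed.

Lemma stretch_lawE (o : R) (Q : probability T R) A : measurable A ->
  (stretch_law o Q A = \int[Q]_z unif01 [set s | A (stretch o z s)])%E.
Proof.
move=> mA; rewrite /stretch_law image_measureE /=/product_measure1.
apply: eq_integral => z _; congr (unif01 _).
by apply/seteqP; split => s; rewrite /xsection/= inE.
Qed.

Lemma measurable_stretch1 (o : R) (z : T) :
  measurable_fun setT (fun s : R => stretch o z s).
Proof.
apply: (@measurable_cons _ _ R R (fun s => o + s * (tnth z ord0 - o)) m (cst (rest z))) => //.
exact: measurable_affine.
Qed.

Lemma unif01_indic (A : set R) : measurable A ->
  (unif01 A = \int[mu]_(s in `]0%R, 1%R[) (\1_A s)%:E)%E.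
Proof.
move=> mA; rewrite -integral_unif01_oo.
- by rewrite integral_indic// setIT.
- exact/measurable_EFinP/measurable_indic.
- by move=> x; rewrite lee_fin.
Qed.

Lemma stretch_lawT o (Q : probability T R) : stretch_law o Q setT = 1%E.
Proof. by rewrite /stretch_law image_measureE preimage_setT; exact: (probability_setT (Q \x unif01)%E). Qed.

End StretchLaw.

Section StretchApprox.
Context {R : realType} {m : nat}.
Local Notation T := (m.+1.-tuple R).
Local Notation Rm := (measurableTypeR R).
Variables (x0 : 'I_m.+1 -> \bar R) (o : R).
Hypothesis x0o : x0 ord0 = o%:E.

Lemma stretch_D0 (z : T) s : D0 x0 z -> 0 <= s -> o <= tnth z ord0 ->
  D0 x0 (stretch o z s).
Proof.
move=> Dz s0 oz j; case: (unliftP ord0 j) => [k ->|->].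
  by rewrite /stretch tnthS tnth_rest; exact: Dz.
by rewrite x0o lee_fin /= lerDl mulr_ge0// subr_ge0.
Qed.

(** The uniform laws on the thin cuboids and on the segment are images of one and the same law N.
    Corresponding points differ by at most 1/(k'+1) in each coordinate, so continuity and dominated
    convergence give the limit. *)
Lemma uniform_near_segment (z : T) k (fs : 'I_k -> T -> R) (B e : R) :
  D0 x0 z -> o < tnth z ord0 ->
  (forall i, measurable_fun setT (fs i)) ->
  (forall i t, 0 <= fs i t <= B) ->
  (forall i t, D0 x0 t -> forall e, 0 < e -> exists2 del, 0 < del &
    forall s, D0 x0 s -> (forall j, `|tnth s j - tnth t j| < del) ->
    `|fs i s - fs i t| < e) -> 0 < e ->
  exists K (U : {measure set T -> \bar R}),
    [/\ POU1_set x0 K, uniform_on U K, U setT = 1%E, U (~` D0 x0) = 0%E &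
      forall i, `|fine (\int[U]_t (fs i t)%:E) -
                  fine (\int[unif01]_s (fs i (stretch o z s))%:E)| < e].
Proof.
move=> Dz oz mfs fsB fsc e0.
have [C CE] := @exists_cube_law R m.
pose N : probability (Rm * m.-tuple R)%type R := (unif01 \x C)%E.
(* The cuboid thickens the segment below z towards larger x_2, ..., x_d only, so
   that it stays in D0 even when z is on the boundary. *)
pose a := tnth (cons_tuple o (rest z)).
pose w k' (j : 'I_m.+1) : R := if j == ord0 then tnth z ord0 - o else k'.+1%:R^-1.
have w0 k' j : 0 < w k' j.
  by rewrite /w; case: ifP => _; rewrite ?subr_gt0// invr_gt0.
pose F k' (p : Rm * m.-tuple R) : T := affine_tuple a (w k') (cons_tuple (p.1 : R) p.2).
have mF k' : measurable_fun setT (F k').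
  exact: (measurableT_comp (measurable_affine_tuple a (w k')) (@measurable_cons_pair R m)).
pose V k' : {measure set T -> \bar R} := image_measure N (mF k').
have VT k' : V k' setT = 1%E.
  by rewrite /V image_measureE preimage_setT; exact: (probability_setT N).
pose K k' := cuboid a (w k').
pose W k' := \prod_j w k' j.
have W0 k' : 0 < W k' by apply: prodr_gt0.
have VE k' A : measurable A -> lebvol (A `&` K k') = ((W k')%:E * V k' A)%E.
  by move=> mA; exact: lebvol_cuboidS.
have KE k' : lebvol (K k') = (W k')%:E.
  by have := VE k' setT measurableT; rewrite VT mule1 setTI.
have mK k' : measurable (K k').
  apply: (@measurable_forall_tnth _ _ (fun j => [set x | a j <= x <= a j + w k' j])) => j.
  exact: (@measurable_itv R `[a j, a j + w k' j]).
have a0 : a ord0 = o by [].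
have aS j : a (lift ord0 j) = tnth z (lift ord0 j) by rewrite /a tnthS tnth_rest.
have Da j : (x0 j <= (a j)%:E)%E.
  case: (unliftP ord0 j) => [j' ->|->]; last by rewrite x0o a0.
  by rewrite aS; exact: Dz.
have KD k' : K k' `<=` D0 x0.
  move=> t Kt j; rewrite (le_trans (Da j))// lee_fin.
  by case/andP: (Kt j).
have POUK k' : POU1_set x0 (K k').
  split => // t t' Kt; rewrite x0o lee_fin => ot' t't tj j.
  have [->|j0] := eqVneq j ord0.
    by rewrite a0 ot' /= (le_trans t't)//; case/andP: (Kt ord0).
  by rewrite tj//; exact: Kt.
have UK k' : uniform_on (V k') (K k').
  split; first by rewrite KE lte_fin W0 ltry.
  move=> A mA; rewrite VE// KE/= muleC muleA -EFinM mulVf ?gt_eqF// mul1e.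
  by [].
have VD k' : V k' (~` D0 x0) = 0%E.
  have mD : measurable (~` D0 x0) by apply: measurableC; exact: measurable_D0.
  rewrite (UK k').2// (_ : _ `&` _ = set0 `&` K k').
    by rewrite -(UK k').2// measure0.
  by rewrite set0I; apply/seteqP; split => // t [nD /KD].
(* Continuity of the [fs i] is relative to [D0 x0], and the compared points are known to lie there
   only for p in the unit cube. That cube carries all the mass of N, so the integrals are restricted
   to it. *)
pose Q1 : set (m.-tuple R) := cuboid (cst 0) (cst 1).
have mQ1 : measurable Q1.
  apply: (@measurable_forall_tnth _ _ (fun j => [set x : R | 0 <= x <= 0 + 1])) => j.
  exact: (@measurable_itv R `[0, 0 + 1]).
have CQ1 : C Q1 = 1%E.
  have h A : measurable A -> lebvol (A `&` Q1) = C A.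
    move=> mA; rewrite /Q1 CE// big1// mul1e; congr (C _).
    rewrite (_ : affine_tuple _ _ = id)//.
    apply/funext => t; apply: eq_from_tnth => j.
    by rewrite tnth_mktuple add0r mul1r.
  by rewrite -h// setIid -(setTI Q1) h// probability_setT.
pose E : set (Rm * m.-tuple R) := (`[0, 1]%classic : set Rm) `*` Q1.
have mI : measurable (`[0, 1]%classic : set Rm) by exact: (@measurable_itv R `[0, 1]).
have mE : measurable E by exact: measurableX.
have U1 : unif01 (`[0, 1]%classic : set R) = 1%E.
  rewrite unif01_indic// (eq_integral (cst 1%E)).
    by rewrite integral_cst//= lebesgue_measure_itv/= lte01 oppr0 adde0 mul1e.
  move=> s; rewrite inE/= in_itv/= => /andP[s0 s1].
  by rewrite indicE mem_set//= in_itv/= !ltW.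
have NE : N E = 1%E.
  have -> : N E = (unif01 (`[0%R, 1%R]%classic : set R) * C Q1)%E by exact: product_measure1E.
  by rewrite CQ1 mule1.
have FD k' p : E p -> D0 x0 (F k' p).
  move=> [/=]; rewrite in_itv/= => /andP[p0 p1] Qp j.
  rewrite (le_trans (Da j))// lee_fin tnth_mktuple lerDl mulr_ge0 ?(ltW (w0 _ _))//.
  case: (unliftP ord0 j) => [j' ->|->] //.
  by rewrite tnthS; case/andP: (Qp j').
have Sdist k' p : E p -> forall j, `|tnth (F k' p) j - tnth (stretch o z p.1) j| <= k'.+1%:R^-1.
  move=> [/=]; rewrite in_itv/= => /andP[p0 p1] Qp j.
  rewrite tnth_mktuple; case: (unliftP ord0 j) => [j' ->|->].
    rewrite !tnthS aS tnth_rest /w /= addrAC subrr add0r.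
    have /andP[q0 q1] := Qp j'; rewrite add0r in q1.
    by rewrite ger0_norm ?mulr_ge0 ?invr_ge0// ger_pMr// invr_gt0.
  by rewrite a0 /w/= mulrC subrr normr0 invr_ge0.
have SD (p : Rm * m.-tuple R) : E p -> D0 x0 (stretch o z p.1).
  by move=> [/=]; rewrite in_itv/= => /andP[p0 p1] Qp; apply: stretch_D0 => //; exact: ltW.
have mS : measurable_fun setT (fun p : Rm * m.-tuple R => stretch o z (p.1 : R)).
  exact: (measurableT_comp (measurable_stretch1 o z) measurable_fst).
have cvgi i : (fine (\int[V k']_t (fs i t)%:E) @[k' --> \oo] -->
    fine (\int[unif01]_s (fs i (stretch o z s))%:E)).
  have fs0 t : (0 <= (fs i t)%:E)%E by rewrite lee_fin; case/andP: (fsB i t).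
  have mfi : measurable_fun setT (fun t => (fs i t)%:E) by exact/measurable_EFinP.
  have [Sfin _] := @bounded_integral R _ Rm unif01 (fun s => fs i (stretch o z s)) B
    (probability_setT _) (measurableT_comp (mfs i) (measurable_stretch1 o z)) (fun s => fsB i _).
  apply: fine_cvg; rewrite fineK//.
  have -> : (\int[unif01]_s (fs i (stretch o z s))%:E =
      \int[N]_(p in E) (fs i (stretch o z p.1))%:E)%E.
    have mSf : measurable_fun setT (fun p : Rm * m.-tuple R => (fs i (stretch o z p.1))%:E).
      exact: (measurableT_comp mfi mS).
    rewrite (ge0_integral_full mE NE mSf (fun p => fs0 _)) (fubini_tonelli1 _ mSf (fun p => fs0 _)).
    apply: eq_integral => s _; rewrite /fubini_F /=.
    rewrite -[RHS]/(\int[C]_y (cst (fs i (stretch o z s))%:E) y)%E.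
    by rewrite integral_cst//=; have /= -> := probability_setT C; rewrite mule1.
  rewrite (_ : (fun k' => _) = (fun k' => \int[N]_(p in E) (fs i (F k' p))%:E)%E); last first.
    apply/funext => k'; rewrite /V ge0_integral_image//.
    exact/esym/(ge0_integral_full mE NE (measurableT_comp mfi (mF k')) (fun p => fs0 _)).
  apply: (@dominated_cvg _ _ _ _ _ mE _ _ (cst B%:E)) => //.
  - by move=> k'; apply: measurable_funTS; exact: (measurableT_comp mfi (mF k')).
  - move=> p Ep; apply: cvg_EFin; first exact: nearW.
    apply/cvgrPdist_lt => e1 e10 /=.
    have [del del0 h] := fsc i _ (SD p Ep) e1 e10.
    near=> k'; rewrite distrC; apply: h; first exact: FD.
    move=> j; rewrite (le_lt_trans (Sdist _ _ Ep j))//.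
    by near: k'; exact: (near_infty_natSinv_lt (PosNum del0)).
  - exact: finite_measure_integrable_cst.
  - move=> k' p Ep; rewrite gee0_abs// lee_fin.
    by case/andP: (fsB i (F k' p)).
have : \forall k' \near \oo, forall i, `|fine (\int[V k']_t (fs i t)%:E) -
                  fine (\int[unif01]_s (fs i (stretch o z s))%:E)| < e.
  apply: filter_forall => i.
  move/cvgrPdist_lt : (cvgi i) => /(_ e e0); apply: filterS => k'.
  by rewrite distrC.
case=> k' _ /(_ k' (leqnn _)) h.
by exists (K k'), (V k'); split.
Unshelve. all: by end_near. Qed.

End StretchApprox.

Section StretchPOU.
Context {R : realType} {m : nat}.
Local Notation T := (m.+1.-tuple R).
Local Notation Rm := (measurableTypeR R).
Variables (x0 : 'I_m.+1 -> \bar R) (o : R).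
Hypothesis x0o : x0 ord0 = o%:E.

(** The points whose segment down to [o] is non-degenerate. *)
Definition D0pos : set T := D0 x0 `&` [set t | o < tnth t ord0].

Lemma measurable_D0pos : measurable D0pos.
Proof.
apply: measurableI; first exact: measurable_D0.
apply: measurable_bool; apply: measurable_fun_ltr => //; exact: measurable_tnth.
Qed.

(** Adding B and extending by 0 off [D0 x0] turns a signed test function into a nonnegative one on
    the whole space; the constant B cancels when two probabilities are compared. *)
Lemma Rintegral_D0 (P : {measure set T -> \bar R}) (f : T -> R) (B : R) :
  P setT = 1%E -> P (~` D0 x0) = 0%E -> measurable_fun (D0 x0) f ->
  (forall t, D0 x0 t -> `|f t| <= B) ->
  Rintegral P (D0 x0) f =
    fine (\int[P]_t (((fun t => f t + B) \_ (D0 x0)) t)%:E) - B.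
Proof.
move=> P1 P0 mf fB.
have mD := measurable_D0 x0.
have PD : P (D0 x0) = 1%E.
  have [P' P'E] := probability_of_measure P1.
  have := probability_setC P' (measurableC mD).
  by rewrite setCK P'E P0 sube0.
have int (g : T -> R) C : measurable_fun (D0 x0) g -> (forall t, D0 x0 t -> `|g t| <= C) ->
    P.-integrable (D0 x0) (EFin \o g).
  move=> mg gC; apply: measurable_bounded_integrable => //.
    by rewrite PD ltry.
  exists C; split; first exact: num_real.
  by move=> x Cx t Dt /=; apply: (le_trans (gC _ Dt)); exact: ltW.
rewrite -[fine _]/(Rintegral P setT ((fun t => f t + B) \_ (D0 x0))) -Rintegral_mkcond.
rewrite RintegralD//; last 2 first.
- exact: (int _ B).
- by apply: (int (cst B) `|B|).
by rewrite Rintegral_cst// PD mulr1 addrK.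
Qed.

Lemma stretch_law_on (Q : probability T R) (D A : set T) :
  measurable D -> Q D = 1%E -> measurable A ->
  (stretch_law o Q A = \int[Q]_(z in D) unif01 [set s | A (stretch o z s)])%E.
Proof.
move=> mD QD mA; rewrite stretch_lawE//; apply/esym/ge0_integral_full => //.
rewrite (_ : (fun z => _) = unif01 \o xsection ((fun p : T * Rm => stretch o p.1 (p.2 : R)) @^-1` A)).
  apply: measurable_fun_xsection.
  by rewrite -[X in measurable X]setTI; exact: measurable_stretch.
apply/funext => z /=; congr (unif01 _).
by apply/seteqP; split => s; rewrite /xsection/= inE.
Qed.

Lemma stretch_law_D0 (Q : probability T R) : Q D0pos = 1%E ->
  stretch_law o Q (~` D0 x0) = 0%E.
Proof.
move=> QD; have mD := measurableC (measurable_D0 x0).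
rewrite (stretch_law_on measurable_D0pos QD)//.
apply: integral0_eq => z [Dz oz]; rewrite unif01_indic; last first.
  by rewrite -[X in measurable X]setTI; exact: measurable_stretch1.
apply: integral0_eq => s; rewrite /= in_itv/= => /andP[s0 s1].
by rewrite indicE memNset//=; apply; apply: stretch_D0 => //; exact: ltW.
Qed.

Lemma stretch_law_POU1 (Q : probability T R) : Q D0pos = 1%E ->
  POU1_dist x0 (stretch_law o Q).
Proof.
move=> QD; split; [exact: stretch_lawT|exact: stretch_law_D0|].
move=> k fs e bc e0.
have mf i := bdd_cont_on_measurable (bc i).
have [M hM] := choice (fun i => (bc i).1).
pose B := \sum_i `|M i|.
have hB i t : D0 x0 t -> `|fs i t| <= B.
  move=> Dt; rewrite (le_trans (hM i t Dt))// (le_trans (ler_norm _))//.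
  by rewrite /B (bigD1 i)//= lerDl sumr_ge0.
have mD := measurable_D0 x0.
pose g i := (fun t => fs i t + B) \_ (D0 x0).
have gE i t : D0 x0 t -> g i t = fs i t + B by move=> Dt; rewrite /g patchE mem_set.
have mg i : measurable_fun setT (g i).
  by apply: (proj1 (measurable_restrictT _ mD)); exact: measurable_funD.
have B0 : 0 <= B by rewrite sumr_ge0.
have gB i t : 0 <= g i t <= B + B.
  rewrite /g patchE; case: ifPn => [|_]; last by rewrite lexx addr_ge0.
  by rewrite inE => /(hB i); rewrite ler_norml => /andP[h1 h2]; apply/andP; split; lra.
have gc i t : D0 x0 t -> forall e, 0 < e -> exists2 del, 0 < del &
    forall s, D0 x0 s -> (forall j, `|tnth s j - tnth t j| < del) -> `|g i s - g i t| < e.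
  move=> Dt e1 e10; have [del del0 h] := (bc i).2 t Dt e1 e10.
  exists del => // s Ds st; rewrite !gE// opprD addrACA subrr addr0.
  exact: h.
pose G i z := fine (\int[unif01]_s (g i (stretch o z s))%:E).
have Gb i z := bounded_integral (probability_setT (@unif01 R))
  (measurableT_comp (mg i) (measurable_stretch1 o z)) (fun s => gB i (stretch o z s)).
have mG i : measurable_fun setT (G i).
  apply: (measurableT_comp (fine_measurable measurableT)).
  apply: (@measurable_fun_fubini_tonelli_F _ _ _ _ _ (@unif01 R)
    (fun p : T * Rm => (g i (stretch o p.1 (p.2 : R)))%:E)).
    apply/measurable_EFinP; exact: (measurableT_comp (mg i) (measurable_stretch o)).
  by move=> p; rewrite lee_fin; case/andP: (gB i (stretch o p.1 p.2)).
(* One share pays for replacing Q by finitely many points, one for thickening the segments. Both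
   errors end up bounded weakly by e / 4, and their sum is still strictly below e. *)
have e4 : 0 < e / 4 by lra.
have [n [lam [z [lam0 lam1 zD hG]]]] := mean_in_hull measurable_D0pos QD mG
  (fun i z => (Gb i z).2) e4.
have hU j : exists KU : set T * {measure set T -> \bar R},
    [/\ POU1_set x0 KU.1, uniform_on KU.2 KU.1, KU.2 setT = 1%E, KU.2 (~` D0 x0) = 0%E &
      forall i, `|fine (\int[KU.2]_t (g i t)%:E) - G i (z j)| < e / 4].
  have [Dz oz] := zD j.
  by have [K [U h]] := uniform_near_segment x0o Dz oz mg gB gc e4; exists (K, U).
have [KU hKU] := choice hU.
(* [msum] takes a sequence indexed by nat, hence the zero measure beyond n. *)
pose ms (l : nat) : {measure set T -> \bar R} :=
  match insub l with Some j => mscale (NngNum (lam0 j)) (KU j).2 | None => mzero end.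
pose Qh : {measure set T -> \bar R} := msum ms n.
have msE (j : 'I_n) : ms j = mscale (NngNum (lam0 j)) (KU j).2 :> {measure set T -> \bar R}.
  by rewrite /ms valK.
have QhE A : Qh A = (\sum_(j < n) (lam j)%:E * (KU j).2 A)%E.
  by rewrite /Qh /= /msum; apply: eq_bigr => j _; rewrite msE.
exists Qh; split.
  exists n, lam, (fun j => (KU j).1), (fun j => (KU j).2); split => //.
  by move=> j; have [] := hKU j.
have QhT : Qh setT = 1%E.
  rewrite QhE (eq_bigr (fun j => (lam j)%:E)) ?sumEFin ?lam1// => j _.
  by have [_ _ -> _ _] := hKU j; rewrite mule1.
have QhD : Qh (~` D0 x0) = 0%E.
  by rewrite QhE big1// => j _; have [_ _ _ -> _] := hKU j; rewrite mule0.
move=> i.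
have g0 t : (0 <= (g i t)%:E)%E by rewrite lee_fin; case/andP: (gB i t).
have mgi : measurable_fun setT (fun t => (g i t)%:E) by exact/measurable_EFinP.
rewrite (Rintegral_D0 (stretch_lawT o Q) (stretch_law_D0 QD) (mf i) (hB i)).
rewrite (Rintegral_D0 QhT QhD (mf i) (hB i)) -/(g i).
rewrite opprB addrA subrK.
have -> : fine (\int[Qh]_t (g i t)%:E) = \sum_j lam j * fine (\int[(KU j).2]_t (g i t)%:E).
  rewrite ge0_integral_measure_sum//.
  rewrite (eq_bigr (fun j => (lam j * fine (\int[(KU j).2]_t (g i t)%:E))%:E)).
    by rewrite sumEFin.
  move=> j _; rewrite msE ge0_integral_mscale// EFinM fineK//.
  have [_ _ U1 _ _] := hKU j.
  exact: (bounded_integral U1 (mg i) (gB i)).1.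
rewrite ge0_integral_stretch_law//.
rewrite (eq_integral (fun z => (G i z)%:E)); last first.
  by move=> y _; rewrite /G fineK//; exact: (Gb i y).1.
have h1 := hG i.
have h2 : `|\sum_j lam j * G i (z j) - \sum_j lam j * fine (\int[(KU j).2]_t (g i t)%:E)| <= e / 4.
  rewrite -sumrB (le_trans (ler_norm_sum _ _ _))//.
  rewrite -[e / 4]mul1r -[X in X * (e / 4)]lam1 mulr_suml; apply: ler_sum => j _.
  rewrite -mulrBr normrM (ger0_norm (lam0 j)) ler_wpM2l//.
  by have [_ _ _ _ h] := hKU j; rewrite distrC ltW.
move: h1 h2; rewrite !ler_norml ltr_norml => /andP[h1 h2] /andP[h3 h4].
by apply/andP; split; lra.
Qed.

End StretchPOU.

(** * Translation monotonicity of 1-POU distributions *)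

Section ContinuousDense.
Context {R : realType} {n : nat}.
Local Notation T := (n.-tuple R).

Definition tuple_continuous (g : T -> R) : Prop :=
  forall t e, 0 < e -> exists2 del, 0 < del &
    forall s, (forall j, `|tnth s j - tnth t j| < del) -> `|g s - g t| < e.

Definition test_function (g : T -> R) : Prop :=
  [/\ measurable_fun setT g, forall t, 0 <= g t <= 1 & tuple_continuous g].

Lemma tuple_continuous_lipschitz2 (F : R -> R -> R) (g h : T -> R) :
  (forall a b a' b', `|F a b - F a' b'| <= `|a - a'| + `|b - b'|) ->
  tuple_continuous g -> tuple_continuous h ->
  tuple_continuous (fun t => F (g t) (h t)).
Proof.
move=> FL gc hc t e e0; have e2 : 0 < e / 2 by lra.
have [d1 d10 H1] := gc t _ e2; have [d2 d20 H2] := hc t _ e2.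
exists (Num.min d1 d2); first by rewrite lt_min d10.
move=> s st; rewrite (le_lt_trans (FL _ _ _ _))//.
have st1 j : `|tnth s j - tnth t j| < d1 by have := st j; rewrite lt_min => /andP[].
have st2 j : `|tnth s j - tnth t j| < d2 by have := st j; rewrite lt_min => /andP[].
have := H1 s st1; have := H2 s st2; lra.
Qed.

Lemma min_lipschitz (a b a' b' : R) :
  `|Num.min a b - Num.min a' b'| <= `|a - a'| + `|b - b'|.
Proof.
have H (x y : R) : x <= y + `|x - y| by have := ler_norm (x - y); lra.
have [[[h1 h2] h3] h4] := (H a a', H a' a, H b b', H b' b).
rewrite (distrC a' a) in h2; rewrite (distrC b' b) in h4.
rewrite ler_norml; case: (leP a b) => ?; case: (leP a' b') => ?; apply/andP; split;
  have := normr_ge0 (a - a'); have := normr_ge0 (b - b'); lra.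
Qed.

Lemma max_lipschitz (a b a' b' : R) :
  `|Num.max a b - Num.max a' b'| <= `|a - a'| + `|b - b'|.
Proof.
have H (x y : R) : x <= y + `|x - y| by have := ler_norm (x - y); lra.
have [[[h1 h2] h3] h4] := (H a a', H a' a, H b b', H b' b).
rewrite (distrC a' a) in h2; rewrite (distrC b' b) in h4.
rewrite ler_norml; case: (leP a b) => ?; case: (leP a' b') => ?; apply/andP; split;
  have := normr_ge0 (a - a'); have := normr_ge0 (b - b'); lra.
Qed.

Lemma test_functionC g : test_function g -> test_function (fun t => 1 - g t).
Proof.
move=> [mg g01 gc]; split.
- exact: measurable_funB.
- by move=> t; have /andP[? ?] := g01 t; apply/andP; split; lra.
- move=> t e e0; have [d d0 H] := gc t e e0; exists d => // s /H.
  by rewrite [X in _ -> `|X| < e](_ : _ = - (g s - g t)) ?normrN//; ring.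
Qed.

Lemma test_function_max g h : test_function g -> test_function h ->
  test_function (fun t => Num.max (g t) (h t)).
Proof.
move=> [mg g01 gc] [mh h01 hc]; split.
- exact: measurable_maxr.
- move=> t; have /andP[? ?] := g01 t; have /andP[? ?] := h01 t.
  by case: (leP (g t) (h t)) => _; apply/andP.
- exact: (tuple_continuous_lipschitz2 max_lipschitz gc hc).
Qed.

Lemma test_function_min g h : test_function g -> test_function h ->
  test_function (fun t => Num.min (g t) (h t)).
Proof.
move=> [mg g01 gc] [mh h01 hc]; split.
- exact: measurable_minr.
- move=> t; have /andP[? ?] := g01 t; have /andP[? ?] := h01 t.
  by case: (leP (g t) (h t)) => _; apply/andP.
- exact: (tuple_continuous_lipschitz2 min_lipschitz gc hc).
Qed.

(** Increases with k to the indicator of the open half-space x < t_j and vanishes off it; a minimum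
    with it keeps test functions zero left of [o]. *)
Definition ramp (j : 'I_n) (x : R) (k : nat) (t : T) : R :=
  Num.min 1 (Num.max 0 (k%:R * (tnth t j - x))).

Lemma test_function_ramp j x k : test_function (ramp j x k).
Proof.
split.
- apply: measurable_minr => //; apply: measurable_maxr => //.
  apply: measurable_funM => //; apply: measurable_funB => //.
  exact: measurable_tnth.
- by move=> t; rewrite /ramp le_min ler01 le_max lexx /= ge_min lexx.
(* The slope is k; dividing by k + 1 also covers k = 0. *)
move=> t e e0; exists (e / k.+1%:R); first by rewrite divr_gt0.
move=> s /(_ j); set a := tnth s j; set b := tnth t j => ab.
rewrite (le_lt_trans (min_lipschitz _ _ _ _))// subrr normr0 add0r.
rewrite (le_lt_trans (max_lipschitz _ _ _ _))// subrr normr0 add0r.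
rewrite -mulrBr opprB addrA subrK normrM ger0_norm//.
rewrite ltr_pdivlMr// mulrC in ab.
by rewrite (le_lt_trans _ ab)// ler_wpM2r// ler_nat.
Qed.

Lemma ramp_le0 j x k t : tnth t j <= x -> ramp j x k t = 0.
Proof.
move=> tx; rewrite /ramp (max_idPl _) ?(min_idPr _)//.
by rewrite mulr_ge0_le0// subr_le0.
Qed.

Lemma ramp_cvg j x t :
  (`|\1_[set t : T | x < tnth t j] t - ramp j x k t| @[k --> \oo] --> (0 : R)).
Proof.
case: (ltP x (tnth t j)) => xt; last first.
  rewrite (_ : (fun _ => _) = cst 0); first exact: cvg_cst.
  apply/funext => k; rewrite ramp_le0// indicE memNset ?subrr ?normr0//=.
  by apply/negP; rewrite -leNgt.
apply/cvgrPdist_lt => e e0; near=> k.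
have -> : ramp j x k t = 1.
  rewrite /ramp (min_idPl _)// le_max; apply/orP; right.
  rewrite -ler_pdivrMr ?subr_gt0// div1r.
  near: k; exact: nbhs_infty_ger.
by rewrite indicE mem_set//= !subrr normr0 subrr normr0.
Unshelve. all: by end_near. Qed.

Variable mu : {finite_measure set T -> \bar R}.

Definition L1dist (A : set T) (g : T -> R) : \bar R :=
  (\int[mu]_t (`|\1_A t - g t|)%:E)%E.

Lemma measurable_L1dist (A : set T) (g : T -> R) : measurable A ->
  measurable_fun setT g -> measurable_fun setT (fun t => `|\1_A t - g t|%:E).
Proof.
move=> mA mg; apply/measurable_EFinP; apply: measurableT_comp => //.
by apply: measurable_funB => //; exact: measurable_indic.
Qed.

Definition approximable (A : set T) : Prop := measurable A /\
  forall e, 0 < e -> exists2 g, test_function g & (L1dist A g < e%:E)%E.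

Lemma approximable_ray j (x e : R) : 0 < e -> exists k,
  (L1dist [set t : T | (x < tnth t j)%R] (ramp j x k) < e%:E)%E.
Proof.
move=> e0; pose A : set T := [set t | x < tnth t j].
have mA : measurable A.
  by apply: measurable_bool; apply: measurable_fun_ltr => //; exact: measurable_tnth.
have mr k : measurable_fun setT (ramp j x k) by have [] := test_function_ramp j x k.
have : (L1dist A (ramp j x k) @[k --> \oo] --> \int[mu]_t (cst 0%:E) t)%E.
  apply: (@dominated_cvg _ _ _ _ _ measurableT _ _ (cst 1%:E)) => //.
  - by move=> k; exact: measurable_L1dist.
  - by move=> t _; apply: cvg_EFin; [exact: nearW|exact: ramp_cvg].
  - exact: finite_measure_integrable_cst.
  - move=> k t _; rewrite gee0_abs ?lee_fin//.
    have [_ /(_ t)/andP[r0 r1] _] := test_function_ramp j x k.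
    by rewrite indicE; case: (_ \in _) => /=; rewrite ler_norml; apply/andP; split; lra.
rewrite integral_cst// mul0e => /fine_cvgP[[k1 _ fin] /cvgrPdist_lt/(_ e e0)[k2 _ H]].
exists (maxn k1 k2).
have := H (maxn k1 k2) (leq_maxr _ _); rewrite sub0r normrN /=.
have /= f := fin (maxn k1 k2) (leq_maxl _ _).
move=> /(le_lt_trans (ler_norm _)); rewrite -lte_fin fineK//.
Qed.

(** Complements are approximated by 1 - g and finite unions by maxima, through the Lipschitz bound
    for the maximum. A countable union differs from a finite one by a set of small measure, since
    [mu] is finite. *)
Lemma approximable_sigma_algebra : sigma_algebra setT approximable.
Proof.
have H0 : approximable set0.
  split=> // e e0; exists (cst 0).
    split=> //; first by move=> t; rewrite /= lexx ler01.
    by move=> t e1 e10; exists 1 => // s _; rewrite /= subrr normr0.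
  rewrite /L1dist (eq_integral (cst 0%:E)) ?integral_cst ?mul0e ?lte_fin//.
  by move=> t _; rewrite indic0 /= subrr normr0.
have HC A : approximable A -> approximable (setT `\` A).
  move=> [mA hA]; rewrite setTD; split; first exact: measurableC.
  move=> e e0; have [g tg gA] := hA e e0.
  exists (fun t => 1 - g t); first exact: test_functionC.
  rewrite (le_lt_trans _ gA)// /L1dist.
  rewrite (eq_integral (fun t => (`|\1_A t - g t|)%:E))// => t _.
  congr EFin; rewrite -normrN; congr (`| _ |).
  by rewrite !indicE in_setC; case: (t \in A) => /=; lra.
have HU A B : approximable A -> approximable B -> approximable (A `|` B).
  move=> [mA hA] [mB hB]; split; first exact: measurableU.
  move=> e e0; have e2 : 0 < e / 2 by lra.
  have [g tg gA] := hA _ e2; have [h th hB'] := hB _ e2.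
  exists (fun t => Num.max (g t) (h t)); first exact: test_function_max.
  have [mg _ _] := tg; have [mh _ _] := th.
  apply: (@le_lt_trans _ _ (L1dist A g + L1dist B h)%E); last first.
    by rewrite (splitr e) EFinD; exact: lteD.
  rewrite /L1dist -ge0_integralD//; last 2 first.
  - exact: measurable_L1dist.
  - exact: measurable_L1dist.
  apply: ge0_le_integral => //.
  - apply: measurable_L1dist; first exact: measurableU.
    exact: measurable_maxr.
  - by apply: emeasurable_funD; exact: measurable_L1dist.
  move=> t _; rewrite -EFinD lee_fin.
  have -> : \1_(A `|` B) t = Num.max (\1_A t) (\1_B t) :> R.
    rewrite !indicE in_setU; case: (t \in A); case: (t \in B) => /=;
    by case: leP => //; lra.
  exact: max_lipschitz.
split=> // A hA.
pose B N := \big[setU/set0]_(i < N.+1) A i.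
have hB N : approximable (B N).
  rewrite /B; elim: N => [|N IH]; first by rewrite big_ord1.
  by rewrite big_ord_recr; exact: HU.
have BE : \bigcup_k B k = \bigcup_k A k by exact: bigcup_bigsetU_bigcup.
have mU : measurable (\bigcup_k A k) by apply: bigcup_measurable => k _; exact: (hA k).1.
split=> // e e0; have e2 : 0 < e / 2 by lra.
have : mu (B N) @[N --> \oo] --> mu (\bigcup_k B k).
  apply: nondecreasing_cvg_mu.
  - by move=> i; exact: (hB i).1.
  - by rewrite BE.
  - move=> a b ab; apply/subsetPset; rewrite /B => t.
    rewrite -!bigcup_mkord => -[i /= ia At]; exists i => //=.
    exact: leq_trans ia _.
rewrite BE => cvgB.
have Ufin : mu (\bigcup_k A k) \is a fin_num by exact: fin_num_measure.
have [N hN] : exists N, (mu (\bigcup_k A k `\` B N) < (e / 2)%:E)%E.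
  move: cvgB; rewrite -(fineK Ufin) => /fine_cvgP[_ /cvgrPdist_lt/(_ _ e2)[N _ H]].
  exists N; rewrite measureD//; last 2 first.
  - exact: (hB N).1.
  - by rewrite ltey_eq Ufin.
  rewrite (setIidr (_ : B N `<=` _)); last by rewrite -BE; exact: bigcup_sup.
  have BNfin : mu (B N) \is a fin_num by apply: fin_num_measure; exact: (hB N).1.
  have /= := H N (leqnn _); move/(le_lt_trans (ler_norm _)).
  by rewrite -lte_fin EFinB !fineK.
have [g tg gB] := (hB N).2 _ e2; have [mg _ _] := tg.
exists g => //.
have mD : measurable (\bigcup_k A k `\` B N) by apply: measurableD => //; exact: (hB N).1.
apply: (@le_lt_trans _ _ (mu (\bigcup_k A k `\` B N) + L1dist (B N) g)%E); last first.
  by rewrite (splitr e) EFinD; exact: lteD.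
have mi : measurable_fun setT (fun t => (\1_(\bigcup_k A k `\` B N) t)%:E : \bar R).
  exact/measurable_EFinP/measurable_indic.
rewrite -[X in mu X]setIT -integral_indic// /L1dist -ge0_integralD//; last exact: (measurable_L1dist (hB N).1).
apply: ge0_le_integral => //.
- exact: measurable_L1dist.
- by apply: emeasurable_funD => //; exact: (measurable_L1dist (hB N).1).
move=> t _; rewrite -EFinD lee_fin.
rewrite [leLHS](_ : _ = `|\1_(\bigcup_k A k `\` B N) t + (\1_(B N) t - g t)|).
  by rewrite (le_trans (ler_normD _ _))// lerD2r ger0_norm.
congr (`| _ |); rewrite addrA; congr (_ - _).
rewrite !indicE in_setD -natrD; congr (_%:R).
have : t \in B N -> t \in \bigcup_k A k.
  by rewrite !inE -BE => ?; exists N.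
by case: (t \in B N) => [->//|_]; rewrite ?andbT ?andbF ?addn0.
Qed.

(** The approximable sets form a sigma-algebra, and open coordinate half-spaces, approximated by
    ramps, generate the product one. *)
Lemma measurable_approximable (A : set T) : measurable A -> approximable A.
Proof.
have sa := approximable_sigma_algebra.
apply: smallest_sub => //.
move=> B; rewrite -bigcup_seq => -[j _ [C mC <-]].
rewrite setTI.
suff : measurable `<=` image_set_system setT (fun t : T => tnth t j) approximable.
  by move=> /(_ _ mC); rewrite /image_set_system /= setTI.
move=> D.
rewrite (_ : measurable D = (RGenOInfty.G (R:=R)).-sigma.-measurable D); last first.
  by rewrite -RGenOInfty.measurableE.
apply: smallest_sub; first exact: sigma_algebra_image.
move=> _ [x ->]; rewrite /image_set_system /= setTI.
have rayE : (fun t : T => tnth t j) @^-1` `]x, +oo[ = [set t | x < tnth t j].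
  by apply/seteqP; split => t /=; rewrite in_itv/= andbT.
rewrite rayE; split.
  by apply: measurable_bool; apply: measurable_fun_ltr => //; exact: measurable_tnth.
move=> e e0; have [k hk] := approximable_ray j x e0.
by exists (ramp j x k) => //; exact: test_function_ramp.
Qed.

End ContinuousDense.

Section WeakClosureShift.
Context {R : realType} {m : nat}.
Local Notation T := (m.+1.-tuple R).
Variables (x0 : 'I_m.+1 -> \bar R) (o : R).
Hypothesis x0o : x0 ord0 = o%:E.

Lemma ge0_integral_null d (X : measurableType d) (mu : {measure set X -> \bar R})
    (D : set X) (f : X -> \bar R) :
  measurable D -> mu (~` D) = 0%E -> measurable_fun setT f -> (forall x, 0 <= f x)%E ->
  (\int[mu]_(x in D) f x = \int[mu]_x f x)%E.
Proof.
move=> mD D0 mf f0.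
rewrite [RHS](ge0_negligible_integral _ _ _ _ D0)//; last exact: measurableC.
by rewrite setTD setCK.
Qed.

Lemma in_POU1_hull_shift (Q : {measure set T -> \bar R}) tau (A : set T) :
  in_POU1_hull x0 Q -> 0 <= tau -> measurable A ->
  A `<=` [set t | o < tnth t ord0] -> (Q (shift tau @^-1` A) <= Q A)%E.
Proof.
move=> [k [lam [Ks [Us [lam0 lam1 KU QE]]]]] tau0 mA Ao.
rewrite !QE//; last first.
  by rewrite -[X in measurable X]setTI; exact: measurable_shift.
apply: lee_sum => i _; apply: lee_wpmul2l; first by rewrite lee_fin.
have [K U] := KU i; exact: (uniform_on_shift x0o tau0 K U).
Qed.

Lemma in_POU1_hull_D0 (Q : {measure set T -> \bar R}) :
  in_POU1_hull x0 Q -> Q (~` D0 x0) = 0%E /\ Q setT = 1%E.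
Proof.
move=> [k [lam [Ks [Us [lam0 lam1 KU QE]]]]].
have mD := measurableC (measurable_D0 x0).
split; rewrite QE//.
  apply: big1 => i _; have [[mK KD _] [_ UE]] := KU i.
  rewrite (UE _ mD) (_ : _ `&` _ = set0 `&` Ks i).
    by rewrite -UE// measure0 mule0.
  by rewrite set0I; apply/seteqP; split => // t [nD /KD].
rewrite (eq_bigr (fun i => (lam i)%:E)) ?sumEFin ?lam1// => i _.
have [_ [/andP[K0 Koo] UE]] := KU i.
rewrite UE// setTI -[X in (_ * (X * _))%E]fineK ?ge0_fin_numE ?(ltW K0)//.
have v0 : fine (lebvol (Ks i)) != 0 by rewrite gt_eqF// fine_gt0// K0.
by rewrite -[X in (_ * X)%E]EFinM divff// -EFinM mulr1.
Qed.

Lemma bdd_cont_on_test_function (D : set T) g : test_function g -> bdd_cont_on D g.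
Proof.
move=> [mg g01 gc]; split.
  by exists 1 => t _; have /andP[? ?] := g01 t; rewrite ger0_norm.
move=> t _ e e0; have [del del0 H] := gc t e e0.
by exists del => // s _; exact: H.
Qed.

Lemma test_function_shift tau (g : T -> R) : test_function g ->
  test_function (g \o shift tau).
Proof.
move=> [mg g01 gc]; split.
- exact: (measurableT_comp mg (measurable_shift tau)).
- by move=> t; exact: g01.
move=> t e e0; have [del del0 H] := gc (shift tau t) e e0.
exists del => // s st; apply: H => j; rewrite /shift.
case: (unliftP ord0 j) => [j' ->|->]; first by rewrite !tnthS !tnth_rest.
by rewrite /= opprB addrA subrK.
Qed.

(** The hypothesis says that the image of Q under the shift, restricted to the right of [o], is
    dominated by Q. As f vanishes elsewhere, the restriction loses nothing. *)
Lemma ge0_le_integral_shift (Q : {measure set T -> \bar R}) tau (f : T -> \bar R) :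
  (forall A, measurable A -> A `<=` [set t | o < tnth t ord0] ->
     (Q (shift tau @^-1` A) <= Q A)%E) ->
  measurable_fun setT f -> (forall t, 0 <= f t)%E ->
  (forall t, tnth t ord0 <= o -> f t = 0%E) ->
  (\int[Q]_t f (shift tau t) <= \int[Q]_t f t)%E.
Proof.
move=> QS mf f0 fo; set E : set T := [set t | o < tnth t ord0] in QS.
have mE : measurable E.
  by apply: measurable_bool; apply: measurable_fun_ltr => //; exact: measurable_tnth.
have mS := @measurable_shift R m tau.
pose m1 : {measure set T -> \bar R} := mrestr (image_measure Q mS) mE.
have -> : (\int[Q]_t f (shift tau t) = \int[m1]_t f t)%E.
  rewrite ge0_integral_mrestr// -(ge0_integral_image Q mS)// [RHS]integral_mkcond.
  apply: eq_integral => t _; rewrite patchE; case: ifPn => //.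
  by rewrite notin_setE /E /= => /negP; rewrite -leNgt; exact: fo.
apply: ge0_le_measure_integral => // A mA.
have mAE : measurable (A `&` E) by exact: measurableI.
rewrite /m1 /= /mrestr; apply: (@le_trans _ _ (Q (A `&` E))).
  by apply: QS => // t [].
by apply: le_measure; rewrite ?inE//; exact: subIsetl.
Qed.

Lemma POU1_dist_test_shift (P : {measure set T -> \bar R}) tau (g : T -> R) :
  POU1_dist x0 P -> 0 <= tau -> test_function g ->
  (forall t, tnth t ord0 <= o -> g t = 0) ->
  (\int[P]_t (g (shift tau t))%:E <= \int[P]_t (g t)%:E)%E.
Proof.
move=> [P1 PD PC] tau0 tg g0; have tS := test_function_shift tau tg.
have mD := measurable_D0 x0.
have fin (Q : {measure set T -> \bar R}) (h : T -> R) : Q setT = 1%E -> test_function h ->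
    (\int[Q]_t (h t)%:E)%E \is a fin_num.
  by move=> Q1 [mh h01 _]; exact: (bounded_integral Q1 mh h01).1.
have RE (Q : {measure set T -> \bar R}) (h : T -> R) : Q (~` D0 x0) = 0%E -> test_function h ->
    Rintegral Q (D0 x0) h = fine (\int[Q]_t (h t)%:E).
  move=> QD [mh h01 _]; rewrite /Rintegral ge0_integral_null//.
    exact/measurable_EFinP.
  by move=> t; rewrite lee_fin; case/andP: (h01 t).
rewrite -(fineK (fin _ _ P1 tS)) -(fineK (fin _ _ P1 tg)) lee_fin.
apply/ler_addgt0Pr => e e0; have e2 : 0 < e / 2 by lra.
(* Both functions go into the same weak neighbourhood, so one element of the hull is close to P on
   each of them and its own inequality transfers. *)
have bc (i : 'I_2) : bdd_cont_on (D0 x0) (if i == ord0 then g \o shift tau else g).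
  by case: ifP => _; exact: bdd_cont_on_test_function.
have [Q [hQ H]] := PC 2%N _ _ bc e2.
have [QD Q1] := in_POU1_hull_D0 hQ.
have := H ord0; have := H ord_max; rewrite /= !RE//.
have : fine (\int[Q]_t ((g \o shift tau) t)%:E) <= fine (\int[Q]_t (g t)%:E).
  apply: fine_le; rewrite ?fin//.
  have [mg g01 _] := tg.
  apply: (@ge0_le_integral_shift Q tau (fun t => (g t)%:E)).
  - by move=> A mA Ao; exact: in_POU1_hull_shift.
  - exact/measurable_EFinP.
  - by move=> t; rewrite lee_fin; case/andP: (g01 t).
  - by move=> t /g0 ->.
rewrite !ltr_norml => h /andP[h1 h2] /andP[h3 h4]; lra.
Qed.

(** The weak closure only sees continuous functions, so the indicator of A is replaced by a test
    function, close in L1 both under P and after the shift. *)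
Lemma POU1_dist_shift (P : {measure set T -> \bar R}) tau (A : set T) :
  POU1_dist x0 P -> 0 <= tau -> measurable A ->
  A `<=` [set t | o < tnth t ord0] -> (P (shift tau @^-1` A) <= P A)%E.
Proof.
move=> hP tau0 mA Ao; have [P1 PD PC] := hP.
have mS := @measurable_shift R m tau.
(* Closeness in L1 of this sum bounds the error of h and that of h composed with the shift
   simultaneously. *)
pose mu0 : {measure set T -> \bar R} := measure_add P (image_measure P mS).
have mu0E (f : T -> \bar R) : measurable_fun setT f -> (forall t, 0 <= f t)%E ->
    (\int[mu0]_t f t = \int[P]_t f t + \int[P]_t f (shift tau t))%E.
  move=> mf f0; rewrite ge0_integral_measure_add//; congr (_ + _)%E.
  exact: (ge0_integral_image P mS).
have mu0T : (mu0 setT < +oo)%E.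
  have -> : mu0 setT = (\int[mu0]_t (cst 1%:E) t)%E by rewrite integral_cst// mul1e.
  rewrite mu0E// -[X in (_ + X)%E]/(\int[P]_t (cst 1%:E) t)%E integral_cst//.
  by rewrite P1 mule1 -EFinD ltry.
have [mu muE] := finite_of_measure mu0T.
(* The approximations of A and of the half-space cost e / 4 each, so h costs e / 2, which is paid
   once for each of the two integrals compared. *)
apply/lee_addgt0Pr => e e0; have e4 : 0 < e / 4 by lra.
have [g tg gA] := (measurable_approximable mu mA).2 _ e4.
have [k hk] := approximable_ray mu ord0 o e4.
have tr := test_function_ramp (ord0 : 'I_m.+1) o k.
(* The approximant g may be positive left of [o]; the ramp removes that part. Since A lies right of
   [o], its indicator is also such a minimum, so the two errors simply add. *)
pose h t := Num.min (g t) (ramp ord0 o k t).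
have th : test_function h by exact: test_function_min.
have [mh h01 _] := th; have [mg _ _] := tg; have [mr r01 _] := tr.
have h0 t : tnth t ord0 <= o -> h t = 0.
  move=> /ramp_le0 r0; rewrite /h r0; have [_ /(_ t)/andP[g0 _] _] := tg.
  exact/min_idPr.
set E : set T := [set t | o < tnth t ord0] in Ao hk.
have mE : measurable E.
  by apply: measurable_bool; apply: measurable_fun_ltr => //; exact: measurable_tnth.
have hA : (L1dist mu A h < (e / 2)%:E)%E.
  apply: (@le_lt_trans _ _ (L1dist mu A g + L1dist mu E (ramp ord0 o k))%E); last first.
    rewrite (_ : e / 2 = e / 4 + e / 4); last lra.
    by rewrite EFinD; exact: lteD.
  rewrite /L1dist -ge0_integralD//; last 2 first.
  - exact: measurable_L1dist.
  - exact: measurable_L1dist.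
  apply: ge0_le_integral => //.
  - exact: measurable_L1dist.
  - by apply: emeasurable_funD; exact: measurable_L1dist.
  move=> t _; rewrite -EFinD lee_fin.
  have eA : \1_A t = Num.min (\1_A t) (\1_E t) :> R.
    rewrite !indicE; have : t \in A -> t \in E by rewrite !inE; exact: Ao.
    case: (t \in A) => [->//|_]; first by rewrite minxx.
    by case: (t \in E); rewrite ?minxx// (min_idPl _).
  rewrite {1}eA.
  exact: min_lipschitz.
pose D t : R := `|\1_A t - h t|.
have mD : measurable_fun setT (fun t => (D t)%:E) by exact: measurable_L1dist.
have D0' t : (0 <= (D t)%:E)%E by rewrite lee_fin /D.
have [D1 D2] : ((\int[P]_t (D t)%:E <= (e / 2)%:E) /\ (\int[P]_t (D (shift tau t))%:E <= (e / 2)%:E))%E.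
  move: hA; rewrite /L1dist muE mu0E// => /ltW hA.
  by split; apply: le_trans hA; rewrite ?leeDl ?leeDr//; exact: integral_ge0.
have mi : measurable_fun setT (fun t => (\1_A t)%:E : \bar R).
  exact/measurable_EFinP/measurable_indic.
have mhE : measurable_fun setT (fun t => (h t)%:E) by exact/measurable_EFinP.
have hE0 t : (0 <= (h t)%:E)%E by rewrite lee_fin; case/andP: (h01 t).
have hle : (\int[P]_t (h t)%:E <= P A + (e / 2)%:E)%E.
  apply: (@le_trans _ _ (\int[P]_t ((\1_A t)%:E + (D t)%:E))%E).
    apply: ge0_le_integral => //; first exact: emeasurable_funD.
    move=> t _; rewrite -EFinD lee_fin /D.
    by have := ler_norm (- (\1_A t - h t)); rewrite normrN; lra.
  rewrite ge0_integralD//.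
  by rewrite integral_indic// setIT leeD2l.
have mSA : measurable (shift tau @^-1` A).
  by rewrite -[X in measurable X]setTI; exact: measurable_shift.
apply: (@le_trans _ _ (\int[P]_t ((h (shift tau t))%:E + (D (shift tau t))%:E))%E).
  rewrite -[X in P X]setIT -integral_indic//.
  apply: ge0_le_integral => //.
  - exact/measurable_EFinP/measurable_indic.
  - by apply: emeasurable_funD; [exact: (measurableT_comp mhE mS)|exact: (measurableT_comp mD mS)].
  move=> t _; rewrite -EFinD lee_fin /D.
  by have := ler_norm (\1_A (shift tau t) - h (shift tau t)); rewrite -[\1_(_ @^-1` _) t]/(\1_A (shift tau t)); lra.
rewrite ge0_integralD//; last 2 first.
- exact: (measurableT_comp mhE mS).
- exact: (measurableT_comp mD mS).
have -> : (P A + e%:E = (P A + (e / 2)%:E) + (e / 2)%:E)%E by rewrite -addeA -EFinD -splitr.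
apply: leeD; last exact: D2.
exact: (le_trans (POU1_dist_test_shift hP tau0 th h0)).
Qed.

End WeakClosureShift.

(** * Monotone densities along the first coordinate *)

Section Densities.
Context {R : realType} d (Y : measurableType d).

Lemma density_le_null (rho : {measure set Y -> \bar R}) (f g : Y -> R) :
  measurable_fun setT f -> measurable_fun setT g ->
  (forall y, 0 <= f y) -> (forall y, 0 <= g y) ->
  (\int[rho]_y (g y)%:E < +oo)%E ->
  (forall B, measurable B -> (\int[rho]_(y in B) (f y)%:E <= \int[rho]_(y in B) (g y)%:E)%E) ->
  rho [set y | g y < f y] = 0%E.
Proof.
move=> mf mg f0 g0 goo fg; set E := [set y | g y < f y].
have mE : measurable E by apply: measurable_bool; exact: measurable_fun_ltr.
have mfg : measurable_fun setT (fun y => (f y - g y)%:E).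
  by apply/measurable_EFinP; exact: measurable_funB.
have mgE : measurable_fun setT (EFin \o g) by exact/measurable_EFinP.
have gEoo : (\int[rho]_(y in E) (g y)%:E < +oo)%E.
  apply: le_lt_trans goo; apply: ge0_subset_integral => //.
  by move=> y _; rewrite lee_fin.
have I0 : (\int[rho]_(y in E) (f y - g y)%:E = 0)%E.
  have h : (\int[rho]_(y in E) (f y)%:E =
      \int[rho]_(y in E) (g y)%:E + \int[rho]_(y in E) (f y - g y)%:E)%E.
    rewrite -ge0_integralD//.
    - by apply: eq_integral => y _; rewrite -EFinD addrC subrK.
    - by move=> y _; rewrite lee_fin.
    - exact: measurable_funTS.
    - by move=> y /ltW; rewrite lee_fin subr_ge0.
    - exact: measurable_funTS.
  have := fg E mE; rewrite h => hle.
  have gfin : (\int[rho]_(y in E) (g y)%:E)%E \is a fin_num.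
    by rewrite ge0_fin_numE//; apply: integral_ge0 => y _; rewrite lee_fin.
  apply/eqP; rewrite eq_le; apply/andP; split.
    by move: hle; rewrite -[leRHS]adde0 leeD2lE.
  by apply: integral_ge0 => y /ltW; rewrite lee_fin subr_ge0.
have := (ae_eq_integral_abs rho mE (measurable_funTS mfg)).1.
rewrite (eq_integral (fun y => (f y - g y)%:E)); last first.
  by move=> y; rewrite inE => /ltW yE; rewrite gee0_abs// lee_fin subr_ge0.
move=> /(_ I0) ae0; apply/negligibleP => //.
apply: negligibleS ae0 => y Ey /= /(_ Ey) -[] /eqP.
by rewrite subr_eq0 gt_eqF.
Qed.

Lemma measure_bigcup_null (rho : {measure set Y -> \bar R}) (F : nat -> set Y) :
  (forall l, measurable (F l)) -> (forall l, rho (F l) = 0%E) -> rho (\bigcup_l F l) = 0%E.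
Proof.
move=> mF F0; apply/negligibleP; first exact: bigcup_measurable.
apply: negligible_bigcup => l; apply/negligibleP; [exact: mF|exact: F0].
Qed.

(* Radon-Nikodym densities are only monotone up to a null set; since there are
   countably many of them, they can be modified on a common null set. *)
Lemma monotone_densities (rho : probability Y R)
    (nu : nat -> rat -> {measure set Y -> \bar R}) (ok : pred rat) :
  (forall n q, (nu n q setT < +oo)%E) ->
  (forall n q B, measurable B -> rho B = 0%E -> nu n q B = 0%E) ->
  (forall n n' q q' B, measurable B -> (n <= n')%N -> ok q' -> (ratr q' : R) <= ratr q ->
     (nu n q B <= nu n' q' B)%E) ->
  exists k : nat -> rat -> Y -> R,
    [/\ forall n q, measurable_fun setT (k n q), forall n q y, 0 <= k n q y,
        forall n q B, measurable B -> (\int[rho]_(y in B) (k n q y)%:E = nu n q B)%E &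
        forall n n' q q' y, (n <= n')%N -> ok q' -> (ratr q' : R) <= ratr q ->
          k n q y <= k n' q' y].
Proof.
move=> nuoo nu0 numono.
have H0 (p : nat * rat) : exists f : Y -> R, [/\ measurable_fun setT f, forall y, 0 <= f y &
    forall B, measurable B -> (\int[rho]_(y in B) (f y)%:E = nu p.1 p.2 B)%E].
  have [nuF nuFE] := finite_of_measure (nuoo p.1 p.2).
  have dom : nuF `<< rho.
    by move=> N hN A mA AN; rewrite nuFE; apply: nu0 => //; exact: hN.
  have [f [f0 ffin fint fE]] := radon_nikodym_sigma_finite dom.
  exists (fine \o f); split.
  - apply: (measurableT_comp (fine_measurable measurableT)).
    exact: measurable_int fint.
  - by move=> y; exact: fine_ge0.
  - move=> B mB; rewrite -nuFE fE//; apply: eq_integral => y _ /=.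
    by rewrite fineK.
have [k0 hk0] := choice H0.
pose cond (z : nat * rat * (nat * rat)) :=
  [&& (z.1.1 <= z.2.1)%N, ok z.2.2 & (ratr z.2.2 : R) <= ratr z.1.2].
(* One set for each of the countably many required inequalities: the points where it fails. *)
pose Bad (l : nat) : set Y := match unpickle l with
  | Some z => if cond z then [set y | k0 z.2 y < k0 z.1 y] else set0
  | None => set0 end.
have mBad l : measurable (Bad l).
  rewrite /Bad; case: unpickle => // z; case: ifP => // _.
  have [m1 _ _] := hk0 z.1; have [m2 _ _] := hk0 z.2.
  by apply: measurable_bool; exact: measurable_fun_ltr.
have Bad0 l : rho (Bad l) = 0%E.
  rewrite /Bad; case: unpickle => // z; case: ifP => // /and3P[c1 c2 c3].
  have [m1 p1 e1] := hk0 z.1; have [m2 p2 e2] := hk0 z.2.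
  apply: density_le_null => //.
  - by rewrite e2.
  - by move=> B mB; rewrite e1// e2//; exact: numono.
pose N := \bigcup_l Bad l.
have mN : measurable N by exact: bigcup_measurable.
have N0 : rho N = 0%E by exact: measure_bigcup_null.
(* All densities become 0 on the exceptional set N, where the inequalities then hold trivially, and
   the integrals do not change. *)
exists (fun n q y => k0 (n, q) y * \1_(~` N) y); split.
- move=> n q; have [m1 _ _] := hk0 (n, q); apply: measurable_funM => //.
  by apply: measurable_indic; exact: measurableC.
- by move=> n q y; have [_ p1 _] := hk0 (n, q); rewrite mulr_ge0.
- move=> n q B mB; have [m1 p1 e1] := hk0 (n, q).
  rewrite -(e1 _ mB) [RHS](ge0_negligible_integral mN mB _ _ N0)//; last 2 first.
  - by apply: measurable_funTS; exact/measurable_EFinP.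
  - by move=> y _; rewrite lee_fin.
  rewrite (ge0_negligible_integral mN mB _ _ N0)//; last 2 first.
  - apply: measurable_funTS; apply/measurable_EFinP; apply: measurable_funM => //.
    by apply: measurable_indic; exact: measurableC.
  - by move=> y _; rewrite lee_fin mulr_ge0.
  apply: eq_integral => y; rewrite inE => -[_ yN].
  by rewrite indicE mem_set// mulr1.
- move=> n n' q q' y nn' okq qq'.
  have [yN|yN] := pselect (N y).
    by rewrite !indicE memNset ?mulr0//=; apply.
  rewrite !indicE mem_set// !mulr1 leNgt; apply/negP => bad; apply: yN.
  exists (pickle ((n, q), (n', q'))) => //.
  by rewrite /Bad pickleK /cond /= nn' okq qq'.
Qed.

Lemma measure_hypograph (rho : probability Y R) (k : Y -> R) (B : set Y) :
  measurable_fun setT k -> (forall y, 0 <= k y) -> measurable B ->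
  ((rho \x (@lebesgue_measure R))%E [set p : Y * measurableTypeR R | B p.1 /\ (0 <= p.2 < k p.1)%R]
    = \int[rho]_(y in B) (k y)%:E)%E.
Proof.
move=> mk k0 mB; rewrite /product_measure1 [RHS]integral_mkcond.
apply: eq_integral => y _ /=; rewrite patchE.
have [yB|yB] := pselect (B y).
  rewrite mem_set// (_ : xsection _ _ = `[0, k y[%classic).
    rewrite lebesgue_measure_itv/= lte_fin oppr0 addr0.
    by case: ltP => // k0'; congr EFin; apply/eqP; rewrite eq_le k0.
  by apply/seteqP; split => v; rewrite /xsection/= inE/= in_itv/=; [case|split].
rewrite memNset// (_ : xsection _ _ = set0) ?measure0//.
by apply/seteqP; split => v //; rewrite /xsection/= inE/= => -[].
Qed.

Lemma measurable_hypograph (k : Y -> R) (B : set Y) :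
  measurable_fun setT k -> measurable B ->
  measurable [set p : Y * measurableTypeR R | B p.1 /\ (0 <= p.2 < k p.1)%R].
Proof.
move=> mk mB.
rewrite (_ : [set _ | _] = (B `*` setT) `&` [set p : Y * measurableTypeR R | (0 <= p.2) && (p.2 < k p.1)]).
  apply: measurableI; first exact: measurableX.
  apply: (@measurable_bool _ _ (fun p : Y * measurableTypeR R => (0 <= p.2) && (p.2 < k p.1))).
  apply: measurable_and; first exact: measurable_fun_ler.
  by apply: measurable_fun_ltr => //; exact: (measurableT_comp mk).
by apply/seteqP; split => p /=; [move=> [? ?]; split|move=> [[? _] ?]; split].
Qed.

End Densities.

Section SlabIncrements.
Context {R : realType} d (Y : measurableType d).
Local Notation XY := (R * Y)%type.
Local Notation Rm := (measurableTypeR R).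
Local Notation mu := (@lebesgue_measure R).
Variables (P : probability XY R) (o : R).
Hypothesis Pshift : forall tau (A : set XY), 0 <= tau -> measurable A ->
  A `<=` [set p | o < p.1] -> (P [set p | A ((p.1 - tau)%R, p.2)] <= P A)%E.

Definition dyad n : R := (2 ^+ n)^-1.

Lemma dyad_gt0 n : 0 < dyad n.
Proof. by rewrite invr_gt0 exprn_gt0. Qed.

Lemma dyadS n : dyad n = dyad n.+1 + dyad n.+1.
Proof.
rewrite /dyad exprS invfM -mulrDl -[RHS]mul1r.
by rewrite -[in RHS]mulr2n -[X in _ = 1 * (X * _)]mulr_natr mulVf// !mul1r.
Qed.

Lemma dyad_cvg0 (e : R) : 0 < e -> \forall n \near \oo, dyad n < e.
Proof.
move=> e0; near=> n.
rewrite (@le_lt_trans _ _ n.+1%:R^-1)//.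
  rewrite lef_pV2 ?posrE ?exprn_gt0//.
  by rewrite -natrX ler_nat ltn_expl.
by near: n; exact: (near_infty_natSinv_lt (PosNum e0)).
Unshelve. all: by end_near. Qed.

Definition slab (x w : R) (B : set Y) : set XY :=
  [set p | (x < p.1 <= x + w) /\ B p.2].

Lemma measurable_slab x w B : measurable B -> measurable (slab x w B).
Proof.
move=> mB; rewrite (_ : slab x w B = `]x, x + w]%classic `*` B).
  by apply: measurableX => //; exact: measurable_itv.
by apply/seteqP; split => p /=; rewrite in_itv.
Qed.

Definition inc n x (B : set Y) : \bar R := ((2 ^+ n)%:E * P (slab x (dyad n) B))%E.

Lemma inc_ge0 n x B : (0 <= inc n x B)%E.
Proof. by rewrite /inc mule_ge0// lee_fin exprn_ge0. Qed.

Lemma slab_shift x x' w B : o <= x -> x <= x' -> measurable B ->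
  (P (slab x' w B) <= P (slab x w B))%E.
Proof.
move=> ox xx' mB.
have -> : slab x' w B = [set p | slab x w B ((p.1 - (x' - x))%R, p.2)].
  by apply/seteqP; split => p [] /=; move=> /andP[h1 h2] Bp; split => //;
    apply/andP; split; rewrite /=; lra.
apply: Pshift; first by rewrite subr_ge0.
- exact: measurable_slab.
- by move=> p [/= /andP[h _] _]; exact: le_lt_trans h.
Qed.

Lemma inc_antitone n x x' B : o <= x -> x <= x' -> measurable B ->
  (inc n x' B <= inc n x B)%E.
Proof.
move=> ox xx' mB; apply: lee_wpmul2l; first by rewrite lee_fin exprn_ge0.
exact: slab_shift.
Qed.

(** The window of stage n is two windows of stage n + 1; the right one is a translate of the left
    one and weighs no more, so the left one has at least the average density. *)
Lemma inc_leS n x B : o <= x -> measurable B -> (inc n x B <= inc n.+1 x B)%E.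
Proof.
move=> ox mB; rewrite /inc exprSr EFinM -muleA; apply: lee_wpmul2l.
  by rewrite lee_fin exprn_ge0.
have h0 := dyad_gt0 n.+1.
have -> : slab x (dyad n) B = slab x (dyad n.+1) B `|` slab (x + dyad n.+1) (dyad n.+1) B.
  apply/seteqP; split => p.
    move=> [/andP[h1 h2] Bp]; rewrite dyadS in h2.
    have [h|h] := leP p.1 (x + dyad n.+1).
      by left; split => //; apply/andP; split.
    by right; split => //; apply/andP; split => //; lra.
  by move=> [|] [/andP[h1 h2] Bp]; split => //; rewrite dyadS; apply/andP; split; lra.
apply: (le_trans (measureU2 _ _ _)); [exact: measurable_slab|exact: measurable_slab|].
rewrite -[leLHS]/(P (slab x (dyad n.+1) B) + P (slab (x + dyad n.+1) (dyad n.+1) B))%E.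
rewrite (_ : 2%:E = 1%:E + 1%:E :> \bar R)%E; last by rewrite -EFinD.
rewrite ge0_muleDl ?lee_fin// !mul1e.
by apply: leeD2l; apply: slab_shift => //; lra.
Qed.

Lemma inc_le n n' x B : o <= x -> measurable B -> (n <= n')%N ->
  (inc n x B <= inc n' x B)%E.
Proof.
move=> ox mB; elim: n' => [|n' IH]; first by rewrite leqn0 => /eqP ->.
rewrite leq_eqVlt => /predU1P[->//|/IH h].
by rewrite (le_trans h)// inc_leS.
Qed.

Lemma inc_fin n x B : measurable B -> inc n x B \is a fin_num.
Proof.
by move=> mB; rewrite fin_numM// fin_num_measure//; exact: measurable_slab.
Qed.

(** Windows are open on the left and closed on the right, and q j stays strictly above x. Each point
    is therefore eventually in the window at q j exactly when it is in the one at x. This recovers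
    real x from rational ones. *)
Lemma inc_right_continuous n x B (q : nat -> R) : measurable B ->
  (forall j, x < q j < x + j.+1%:R^-1) -> inc n (q j) B @[j --> \oo] --> inc n x B.
Proof.
move=> mB hq; rewrite /inc; apply: cvgeZl => //.
have PE y w : P (slab y w B) = (\int[P]_p (\1_(slab y w B) p)%:E)%E.
  by rewrite integral_indic ?setIT//; exact: measurable_slab.
rewrite PE; under eq_fun do rewrite PE.
apply: (@dominated_cvg _ _ _ _ _ measurableT _ _ (cst 1%:E)) => //.
- by move=> j; apply/measurable_EFinP; apply: measurable_indic; exact: measurable_slab.
- move=> p _; apply: cvg_EFin; first exact: nearW.
  apply: cvg_near_cst.
  suff : \forall j \near \oo, (q j < p.1 <= q j + dyad n) = (x < p.1 <= x + dyad n).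
    apply: filterS => j e; congr (_%:R); congr nat_of_bool.
    by apply/idP/idP; rewrite !inE /slab /= e.
  have inv0 (r : R) : 0 < r -> \forall j \near \oo, j.+1%:R^-1 <= r.
    by move=> r0; have := near_infty_natSinv_lt (PosNum r0); apply: filterS => i /= /ltW.
  have [h1|h1] := leP p.1 x.
    apply: nearW => j; have /andP[q1 q2] := hq j.
    by rewrite ltNge (le_trans h1)//; exact: ltW.
  have d1 : 0 < p.1 - x by rewrite subr_gt0.
  have [h2|h2] := leP p.1 (x + dyad n).
    apply: filterS (inv0 _ d1) => j; have /andP[q1] := hq j; move: (j.+1%:R^-1) (q j) q1 => v qj q1 q2 hj.
    have -> : qj < p.1 by lra.
    by have -> : p.1 <= qj + dyad n by lra.
  have d2 : 0 < p.1 - dyad n - x by lra.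
  apply: filterS (inv0 _ d2) => j; have /andP[q1] := hq j; move: (j.+1%:R^-1) (q j) q1 => v qj q1 q2 hj.
  by apply/negbTE; rewrite negb_and -ltNge; apply/orP; right; lra.
- exact: finite_measure_integrable_cst.
- by move=> j p _; rewrite gee0_abs ?lee_fin// indicE lern1 leq_b1.
Qed.

(** The density S(x, B) of the overview, defined at every x as a limit of dyadic difference
    quotients from the right. *)
Definition Sinc x B : \bar R := ereal_sup (range (fun n => inc n x B)).

Lemma inc_cvg x B : o <= x -> measurable B -> inc n x B @[n --> \oo] --> Sinc x B.
Proof.
by move=> ox mB; apply: ereal_nondecreasing_cvgn => n n'; exact: inc_le.
Qed.

Definition triple p q n B : set (Rm * XY) :=
  [set z | (p < z.1 <= q) /\ slab z.1 (dyad n) B z.2].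

Lemma measurable_triple p q n B : measurable B -> measurable (triple p q n B).
Proof.
move=> mB.
pose b (z : Rm * XY) := [&& p < (z.1 : R), (z.1 : R) <= q, (z.1 : R) < z.2.1 & z.2.1 <= (z.1 : R) + dyad n].
have m21 : measurable_fun setT (fun z : Rm * XY => z.2.1).
  exact: (measurableT_comp measurable_fst measurable_snd).
have m1 : measurable_fun setT (fun z : Rm * XY => (z.1 : R)) by exact: measurable_fst.
rewrite (_ : triple _ _ _ _ = [set z | b z] `&` (snd \o snd) @^-1` B).
  apply: measurableI.
    apply: measurable_bool; apply: measurable_and; first exact: measurable_fun_ltr.
    apply: measurable_and; first exact: measurable_fun_ler.
    apply: measurable_and; first exact: measurable_fun_ltr.
    by apply: measurable_fun_ler => //; apply: measurable_funD.
  rewrite -[X in measurable X]setTI.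
  exact: (measurableT_comp measurable_snd measurable_snd).
apply/seteqP; split => z; rewrite /triple /slab /b /=.
  by move=> [/andP[-> ->] [/andP[-> ->] ?]].
by move=> [/and4P[-> -> -> ->] ?].
Qed.

(** The moving average, over first coordinates in [z.1 - dyad n, z.1[, of the indicator of ]p, q] x
    B: what the integral of [inc n] over ]p, q] becomes after exchanging the integrations. *)
Definition smear p q n B (z : XY) : \bar R :=
  ((2 ^+ n)%:E * mu [set x | triple p q n B (x, z)])%E.

Lemma integral_inc p q n B : measurable B ->
  (\int[mu]_(x in `]p, q]) inc n x B = \int[P]_z smear p q n B z)%E.
Proof.
move=> mB; have mT := measurable_triple p q n mB.
have mi : measurable_fun setT (fun z : Rm * XY => (\1_(triple p q n B) z)%:E : \bar R).
  exact/measurable_EFinP/measurable_indic.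
have i0 (z : Rm * XY) : (0 <= (\1_(triple p q n B) z)%:E :> \bar R)%E by rewrite lee_fin.
have n0 : (0 <= (2 ^+ n : R)%:E)%E by rewrite lee_fin exprn_ge0.
have e1 : (\int[mu]_x ((2 ^+ n)%:E * \int[P]_z (\1_(triple p q n B) (x, z))%:E) =
    \int[mu]_(x in `]p, q]) inc n x B)%E.
  rewrite [RHS]integral_mkcond; apply: eq_integral => x _; rewrite patchE.
  case: ifPn => xI.
    congr (_ * _)%E; rewrite -[X in P X]setIT -integral_indic//; last exact: measurable_slab.
    apply: eq_integral => z _; congr (_%:R%:E); congr nat_of_bool.
    move: xI; rewrite inE/= in_itv/= => xI.
    by apply/idP/idP; rewrite !inE /triple /=; [case|split].
  rewrite integral0_eq ?mule0// => z _; rewrite indicE memNset//= => -[xI' _].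
  by move: xI; rewrite notin_setE/= in_itv.
rewrite -e1 ge0_integralZl//; last 2 first.
- exact: (measurable_fun_fubini_tonelli_F _ mi i0).
- by move=> x _; apply: integral_ge0 => z _; rewrite lee_fin.
rewrite (fubini_tonelli (m1 := mu) (m2 := P) _ mi i0).
rewrite -ge0_integralZl//; last 2 first.
- exact: (measurable_fun_fubini_tonelli_G _ mi i0).
- by move=> z _; apply: integral_ge0 => x _; rewrite lee_fin.
apply: eq_integral => z _; congr (_ * _)%E.
have mz : measurable ([set x | triple p q n B (x, z)] : set Rm).
  rewrite (_ : [set _ | _] = ysection (triple p q n B) z); first exact: measurable_ysection.
  by apply/seteqP; split => x; rewrite /ysection/= inE.
by rewrite -[X in mu X]setIT -integral_indic.
Qed.

End SlabIncrements.

Section StripUniqueness.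
Context {R : realType} d (Y : measurableType d).
Local Notation XY := (R * Y)%type.
Local Notation Rm := (measurableTypeR R).

(** Uniqueness on an intersection-stable class is applied twice: to half-open intervals with B
    fixed, then to rectangles. *)
Lemma measure_unique_strips (m1 m2 : {measure set XY -> \bar R}) :
  (m1 setT < +oo)%E ->
  (forall p q B, measurable B ->
    m1 (`]p, q]%classic `*` B) = m2 (`]p, q]%classic `*` B)) ->
  forall A, measurable A -> m1 A = m2 A.
Proof.
move=> m1oo m12.
have le_fin (A : set XY) : measurable A -> (m1 A < +oo)%E.
  by move=> mA; apply: le_lt_trans m1oo; apply: le_measure; rewrite ?inE.
have step B : measurable B -> forall A : set R, measurable A -> m1 (A `*` B) = m2 (A `*` B).
  move=> mB A mA; have mTB : measurable (setT `*` B : set XY) by exact: measurableX.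
  have mfst : measurable_fun setT (fun z : XY => (z.1 : Rm)) by exact: measurable_fst.
  pose n1 : {measure set Rm -> \bar R} := image_measure (mrestr m1 mTB) mfst.
  pose n2 : {measure set Rm -> \bar R} := image_measure (mrestr m2 mTB) mfst.
  have XE (C : set R) : fst @^-1` C `&` (setT `*` B) = C `*` B :> set XY.
    by apply/seteqP; split => z /= => [[? []]|[]].
  have n1E C : n1 C = m1 (C `*` B) by rewrite -XE.
  have n2E C : n2 C = m2 (C `*` B) by rewrite -XE.
  rewrite -n1E -n2E.
  apply: (@measure_unique _ R Rm (@ocitv R) (fun k => `](- k%:R)%R, k%:R]%classic)) => //.
  - exact: ocitvI.
  - by move=> k; exists (- k%:R, k%:R).
  - exact: bigcup_itvT.
  - by move=> C [[p q] _ <-]; rewrite n1E n2E; exact: m12.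
  - by move=> k; rewrite n1E; apply: le_fin; apply: measurableX => //; exact: measurable_itv.
apply: (@measure_unique _ R XY [set A `*` B | A in measurable & B in measurable] (fun=> setT)) => //.
- exact: measurable_prod_measurableType.
- move=> _ _ [A1 mA1] [B1 mB1 <-] [A2 mA2] [B2 mB2 <-].
  exists (A1 `&` A2); first exact: measurableI.
  exists (B1 `&` B2); first exact: measurableI.
  by rewrite setXI.
- by move=> _; exists setT => //; exists setT => //; rewrite setXTT.
- by rewrite bigcup_const//; exists 0%N.
- by move=> _ [A mA] [B mB <-]; exact: step.
Qed.

End StripUniqueness.

Section Representation.
Context {R : realType} d (Y : measurableType d).
Local Notation XY := (R * Y)%type.
Local Notation Rm := (measurableTypeR R).
Local Notation mu := (@lebesgue_measure R).
Variables (P : probability XY R) (o : R).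
Hypothesis Pshift : forall tau (A : set XY), 0 <= tau -> measurable A ->
  A `<=` [set p | o < p.1] -> (P [set p | A ((p.1 - tau)%R, p.2)] <= P A)%E.

Lemma measurable_triple_section p q n B (z : XY) : measurable B ->
  measurable ([set x | triple p q n B (x, z)] : set Rm).
Proof.
move=> mB; rewrite (_ : [set _ | _] = ysection (triple p q n B) z).
  by apply: measurable_ysection; exact: measurable_triple.
by apply/seteqP; split => x; rewrite /ysection/= inE.
Qed.

Lemma measurable_smear p q n B : measurable B ->
  measurable_fun setT (smear p q n B : XY -> \bar R).
Proof.
move=> mB; apply: emeasurable_funM => //.
rewrite (_ : (fun z => _) = mu \o ysection (triple p q n B)).
  by apply: measurable_fun_ysection; exact: measurable_triple.
apply/funext => z /=; congr (mu _).
by apply/seteqP; split => x; rewrite /ysection/= inE.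
Qed.

Lemma smear_ge0 p q n B (z : XY) : (0 <= smear p q n B z)%E.
Proof. by rewrite mule_ge0// lee_fin exprn_ge0. Qed.

Lemma dyad_window n (y : R) : ((2 ^+ n)%:E * mu `[(y - dyad n)%R, y[%classic = 1)%E.
Proof.
have h0 : 0 < dyad n :> R by exact: dyad_gt0.
rewrite lebesgue_measure_itv/= lte_fin ifT; last lra.
rewrite -EFinB -EFinM; congr EFin; rewrite opprB addrCA subrr addr0.
by rewrite /dyad mulfV// gt_eqF// exprn_gt0.
Qed.

Lemma smear_le1 p q n B (z : XY) : measurable B -> (smear p q n B z <= 1)%E.
Proof.
move=> mB; rewrite -(dyad_window n z.1); apply: lee_wpmul2l.
  by rewrite lee_fin exprn_ge0.
apply: le_measure; rewrite ?inE.
- exact: measurable_triple_section.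
- exact: (@measurable_itv R `[(z.1 - dyad n)%R, z.1[).
- move=> x [/= _ [/= /andP[h1 h2] _]]; rewrite in_itv/= h1 andbT; lra.
Qed.

(** The average is eventually constant: since the window lies strictly left of [z.1], it misses ]p,
    q] if z.1 <= p, and for small windows it lies inside if p < z.1 <= q and misses if q < z.1. *)
Lemma smear_cvg p q B (z : XY) : measurable B ->
  smear p q n B z @[n --> \oo] --> (\1_(`]p, q]%classic `*` B) z)%:E.
Proof.
move=> mB.
suff : \forall n \near \oo, smear p q n B z = (\1_(`]p, q]%classic `*` B) z)%:E.
  by move=> h; apply: cvg_near_cst.
have z0 n : [set x | triple p q n B (x, z)] `<=` set0 -> smear p q n B z = 0%E.
  by rewrite subset0 /smear => ->; rewrite measure0 mule0.
have [Bz|Bz] := pselect (B z.2); last first.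
  apply: nearW => n; rewrite z0; last by move=> x [_ []].
  by rewrite indicE memNset// => -[].
have [zp|zp] := leP z.1 p.
  apply: nearW => n; rewrite z0; last first.
    by move=> x [/= /andP[h1 _] [/= /andP[h2 _] _]]; lra.
  by rewrite indicE memNset// => -[/=]; rewrite in_itv/= => /andP[]; rewrite ltNge zp.
have [zq|zq] := leP z.1 q.
  have d0 : 0 < z.1 - p by rewrite subr_gt0.
  apply: filterS (dyad_cvg0 d0) => n hn.
  rewrite indicE mem_set/=; last by split=> //; rewrite /= in_itv/= zp.
  rewrite -(dyad_window n z.1) /smear; congr (_ * mu _)%E.
  apply/seteqP; split => x; rewrite /triple /slab /= in_itv/=.
    by move=> [_ [/andP[h1 h2] _]]; rewrite h1 andbT; lra.
  move=> /andP[h1 h2]; split; last split => //; apply/andP; split; lra.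
have d0 : 0 < z.1 - q by rewrite subr_gt0.
apply: filterS (dyad_cvg0 d0) => n hn; rewrite z0; last first.
  by move=> x [/= /andP[_ h1] [/= /andP[_ h2] _]]; lra.
by rewrite indicE memNset// => -[/=]; rewrite in_itv/= => /andP[_]; rewrite leNgt zq.
Qed.

Lemma integral_smear_cvg p q B : measurable B ->
  (\int[P]_z smear p q n B z @[n --> \oo] --> P (`]p, q]%classic `*` B))%E.
Proof.
move=> mB; have mpq : measurable (`]p, q]%classic `*` B : set XY).
  by apply: measurableX => //; exact: measurable_itv.
rewrite -[X in P X]setIT -integral_indic//.
apply: (@dominated_cvg _ _ _ _ _ measurableT _ _ (cst 1%:E)) => //.
- by move=> n; exact: measurable_smear.
- by move=> z _; exact: smear_cvg.
- exact: finite_measure_integrable_cst.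
- by move=> n z _; rewrite gee0_abs ?smear_ge0// smear_le1.
Qed.

Lemma measurable_inc (p q : R) n B : measurable B ->
  measurable_fun (`]p, q]%classic : set Rm) (fun x : Rm => inc P n x B).
Proof.
move=> mB; apply: (@eq_measurable_fun _ _ _ _ _
  (fun x : Rm => ((2 ^+ n)%:E * P (xsection (triple p q n B) x))%E)).
  move=> x; rewrite inE/= in_itv/= => xI; congr (_ * P _)%E.
  by apply/seteqP; split => z; rewrite /xsection/= inE /triple /=; [case|split].
apply: measurable_funTS; apply: emeasurable_funM => //.
by apply: measurable_fun_xsection; exact: measurable_triple.
Qed.

(** The limit of the integrals of [inc n] is computed twice: by monotone convergence, and by
    dominated convergence after Tonelli. Absolute continuity of P along the first coordinate is an
    outcome. *)
Lemma integral_Sinc p q B : o <= p -> measurable B ->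
  (\int[mu]_(x in `]p, q]) Sinc P x B = P (`]p, q]%classic `*` B))%E.
Proof.
move=> op mB.
rewrite (eq_integral (fun x : Rm => limn (fun n => inc P n x B))); last first.
  move=> x; rewrite inE/= in_itv/= => /andP[px _].
  apply/esym/cvg_lim => //; apply: (inc_cvg Pshift) => //.
  by apply: (le_trans op); exact: ltW.
rewrite monotone_convergence//.
- under eq_fun do rewrite integral_inc//.
  by apply/cvg_lim => //; exact: integral_smear_cvg.
- by move=> n; exact: measurable_inc.
- by move=> n x _; exact: inc_ge0.
- move=> x; rewrite /= in_itv/= => /andP[px _] n n' nn'.
  by apply: (inc_le Pshift) => //; apply: (le_trans op); exact: ltW.
Qed.

(** The increments are nonincreasing in x and, as [smear] is at most 1, integrate to at most 1 over
    an interval of length j + 1. This makes the survival functions vanish at infinity. *)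
Lemma Sinc_tail j : (Sinc P (o + j.+1%:R) setT <= (j.+1%:R^-1)%:E)%E.
Proof.
apply: ge_ereal_sup => _ [n _ <-].
have j0 : 0 < j.+1%:R :> R by [].
rewrite -(@lee_pmul2l _ (j.+1%:R)%:E)// -EFinM divff ?gt_eqF//.
apply: (@le_trans _ _ (\int[mu]_(x in `]o, (o + j.+1%:R)%R]) inc P n x setT)%E); last first.
  rewrite integral_inc//.
  apply: (@le_trans _ _ (\int[P]_z (cst 1%:E) z)%E).
    apply: ge0_le_integral => //.
    - by move=> z _; exact: smear_ge0.
    - exact: measurable_smear.
    - by move=> z _; exact: smear_le1.
  by rewrite integral_cst//= mul1e; have /= -> := probability_setT P.
have -> : ((j.+1%:R)%:E * inc P n (o + j.+1%:R) setT =
    \int[mu]_(x in `]o, (o + j.+1%:R)%R]) cst (inc P n (o + j.+1%:R)%R setT) x)%E.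
  rewrite integral_cst; last exact: (@measurable_itv R `]o, (o + j.+1%:R)%R]).
  rewrite /= lebesgue_measure_itv/= lte_fin ltrDl j0 -EFinB addrAC subrr add0r.
  by rewrite muleC.
apply: ge0_le_integral => //.
- by move=> x _; exact: inc_ge0.
- exact: measurable_inc.
- move=> x; rewrite /= in_itv/= => /andP[ox xj].
  by apply: (inc_antitone Pshift) => //; exact: ltW.
Qed.

(** With n and q fixed, B |-> inc n q B is a finite measure dominated by the marginal [rho] of P. It
    grows with n and, to the right of [o], as q decreases; these inequalities pass to the
    densities. *)
Lemma exists_density_family : exists (rho : probability Y R) (k : nat -> rat -> Y -> R),
  [/\ forall n q, measurable_fun setT (k n q), forall n q y, 0 <= k n q y,
      forall n q B, measurable B ->
        (\int[rho]_(y in B) (k n q y)%:E = inc P n (ratr q) B)%E &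
      forall n n' q q' y, (n <= n')%N -> o < ratr q' -> (ratr q' : R) <= ratr q ->
        k n q y <= k n' q' y].
Proof.
have rho1 : image_measure P measurable_snd setT = 1%E.
  by rewrite image_measureE preimage_setT; exact: probability_setT.
have [rho rhoE] := probability_of_measure rho1; exists rho.
have n0 n : 0 <= 2 ^+ n :> R by rewrite exprn_ge0.
have ms n (q : rat) := measurable_slab (ratr q : R) (dyad n) (@measurableT _ Y).
pose nu n q : {measure set Y -> \bar R} :=
  mscale (NngNum (n0 n)) (image_measure (mrestr P (ms n q)) measurable_snd).
have nuE n q B : nu n q B = inc P n (ratr q) B.
  congr (_ * P _)%E; apply/seteqP; split => z; first by move=> [/= ? [? _]].
  by move=> [/= ? ?].
have := @monotone_densities R _ Y rho nu (fun q => o < ratr q) _ _ _.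
case.
- move=> n q; rewrite nuE ltey_eq; apply/orP; left; exact: inc_fin.
- move=> n q B mB; rewrite rhoE image_measureE nuE /inc => B0.
  rewrite (_ : P _ = 0%E) ?mule0//.
  apply/eqP; rewrite -measure_le0 -B0; apply: le_measure; rewrite ?inE.
  + exact: measurable_slab.
  + by rewrite -[X in measurable X]setTI; exact: measurable_snd.
  + by move=> z [].
- move=> n n' q q' B mB nn' oq' qq'; rewrite !nuE.
  apply: (@le_trans _ _ (inc P n (ratr q') B)).
    by apply: (inc_antitone Pshift) => //; exact: ltW.
  by apply: (inc_le Pshift) => //; exact: ltW.
move=> k [k1 k2 k3 k4]; exists k; split => //.
by move=> n q B mB; rewrite k3// nuE.
Qed.

End Representation.

(** * Recovering the mixing measure *)

Section MixingMeasure.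
Context {R : realType} d (Y : measurableType d).
Local Notation XY := (R * Y)%type.
Local Notation Rm := (measurableTypeR R).
Local Notation mu := (@lebesgue_measure R).
Variables (P : probability XY R) (o u : R).
Hypothesis Pshift : forall tau (A : set XY), 0 <= tau -> measurable A ->
  A `<=` [set p | o < p.1] -> (P [set p | A ((p.1 - tau)%R, p.2)] <= P A)%E.
Hypothesis Pu : forall e, 0 < e ->
  \forall n \near \oo, (inc P n o setT <= (u + e)%:E)%E.

Variables (rho : probability Y R) (k : nat -> rat -> Y -> R).
Hypothesis mk : forall n q, measurable_fun setT (k n q).
Hypothesis k0 : forall n q y, 0 <= k n q y.
Hypothesis kE : forall n q B, measurable B ->
  (\int[rho]_(y in B) (k n q y)%:E = inc P n (ratr q) B)%E.
Hypothesis kmono : forall n n' q q' y, (n <= n')%N -> o < ratr q' ->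
  (ratr q' : R) <= ratr q -> k n q y <= k n' q' y.

Let N : {measure set (Y * Rm) -> \bar R} := (rho \x mu)%E.

Let W n q B : set (Y * Rm) := [set p | B p.1 /\ (0 <= p.2 < k n q p.1)%R].

Let mW n q B : measurable B -> measurable (W n q B).
Proof. by move=> mB; exact: measurable_hypograph. Qed.

Let NW n q B : measurable B -> N (W n q B) = inc P n (ratr q) B.
Proof. by move=> mB; rewrite -kE//; exact: measure_hypograph. Qed.

(** Enumerates the regions [W n q B] with q > x along the natural numbers, so that countable unions
    apply. *)
Let F x B l := match unpickle l with
  | Some (n, q) => if x < (ratr q : R) then W n q B else set0
  | None => set0 end.

Let mF x B l : measurable B -> measurable (F x B l).
Proof.
by move=> mB; rewrite /F; case: unpickle => // -[n q]; case: ifP => // _; exact: mW.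
Qed.

(** The region above B under the graph of y |-> sup of [k n q y] over n and rational q > x, the
    survival function at x given y. Working with the region avoids asking whether this supremum is
    finite. *)
Let E x B := \bigcup_l F x B l.

Let mE x B : measurable B -> measurable (E x B).
Proof. by move=> mB; apply: bigcup_measurable => l _; exact: mF. Qed.

Let EP x B p : E x B p <-> exists n q, [/\ x < (ratr q : R), B p.1 & 0 <= p.2 < k n q p.1].
Proof.
split.
  move=> [l _]; rewrite /F; case: unpickle => // -[n q]; case: ifP => // xq [Bp kp].
  by exists n, q.
move=> [n [q [xq Bp kp]]]; exists (pickle (n, q)) => //.
by rewrite /F pickleK xq.
Qed.

Let rat_above (x e : R) : 0 < e -> exists q : rat, x < (ratr q : R) < x + e.
Proof.
move=> e0; have /rat_in_itvoo[q] : x < x + e by rewrite ltrDl.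
by rewrite in_itv/= => h; exists q.
Qed.

(** The regions are directed: a larger n and a smaller q enlarge [W n q B], so every finite union
    sits in a single one and weighs at most S(x, B); continuity from below concludes. Conversely
    each [inc n x B] is a limit of measures of regions at rational points right of x. *)
Let NE x B : o <= x -> measurable B -> N (E x B) = Sinc P x B.
Proof.
move=> ox mB; apply/eqP; rewrite eq_le; apply/andP; split; last first.
  apply: ge_ereal_sup => _ [n _ <-].
  have inv0 (j : nat) : 0 < j.+1%:R^-1 :> R by [].
  have [q hq] := choice (fun j : nat => @rat_above x j.+1%:R^-1 (inv0 j)).
  have cvgq := @inc_right_continuous _ _ _ P n x B _ mB hq.
  rewrite -(cvg_lim _ cvgq)//; apply: lime_le; first by apply/cvg_ex; eexists; exact: cvgq.
  apply: nearW => j; rewrite -NW//; apply: le_measure; rewrite ?inE.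
  - exact: mW.
  - exact: mE.
  - move=> p [Bp kp]; apply/EP; exists n, (q j); split => //.
    by have /andP[] := hq j.
pose G L := \big[setU/set0]_(l < L) F x B l.
have mG L : measurable (G L) by apply: bigsetU_measurable => l _; exact: mF.
have WG L : exists n q, x < (ratr q : R) /\ G L `<=` W n q B.
  elim: L => [|L [n [q [xq IH]]]].
    have [q /andP[xq _]] := rat_above x ltr01.
    by exists 0%N, q; rewrite /G big_ord0; split.
  have WW n1 q1 n2 q2 : (n1 <= n2)%N -> x < (ratr q2 : R) -> (ratr q2 : R) <= ratr q1 ->
      W n1 q1 B `<=` W n2 q2 B.
    move=> n12 xq2 q21 p [Bp /andP[p0 kp]]; split => //; rewrite p0 /=.
    by apply: (lt_le_trans kp); apply: kmono => //; exact: le_lt_trans xq2.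
  have -> : G L.+1 = G L `|` F x B L by rewrite /G big_ord_recr.
  rewrite /F.
  case: unpickle => [[n' q']|]; last by exists n, q; rewrite setU0.
  case: ifP => [xq'|_]; last by exists n, q; rewrite setU0.
  have [qq'|q'q] := leP (ratr q : R) (ratr q').
    exists (maxn n n'), q; split => // p [/IH|].
      by apply: WW => //; exact: leq_maxl.
    by apply: WW => //; exact: leq_maxr.
  exists (maxn n n'), q'; split => // p [/IH|].
    by apply: WW => //; [exact: leq_maxl|exact: ltW].
  by apply: WW => //; exact: leq_maxr.
have GS L : (N (G L) <= Sinc P x B)%E.
  have [n [q [xq GW]]] := WG L.
  apply: (@le_trans _ _ (N (W n q B))).
    by apply: le_measure; rewrite ?inE//; exact: mW.
  rewrite NW//; apply: (@le_trans _ _ (inc P n x B)).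
    by apply: (inc_antitone Pshift) => //; exact: ltW.
  by apply: ereal_sup_ubound; exists n.
have cvgG : N (G L.+1) @[L --> \oo] --> N (E x B).
  rewrite /E -bigcup_bigsetU_bigcup; apply: nondecreasing_cvg_mu.
  - by move=> i; exact: mG.
  - by apply: bigcup_measurable => i _; exact: mG.
  - move=> a b ab; apply/subsetPset => t.
    rewrite /G -!bigcup_mkord => -[i /= ia At]; exists i => //=.
    exact: leq_trans ia _.
rewrite -(cvg_lim _ cvgG)//; apply: lime_le; first by apply/cvg_ex; eexists; exact: cvgG.
by apply: nearW => L; exact: GS.
Qed.

(** The points lying under the survival function at arbitrarily large x, where the quantile would be
    infinite. *)
Let bad := \bigcap_j E (o + j.+1%:R) setT.

Let mbad : measurable bad.
Proof. by apply: bigcap_measurableType => j _; exact: mE. Qed.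

Let Nbad : N bad = 0%E.
Proof.
apply/eqP; rewrite eq_le measure_ge0 andbT.
apply/lee_addgt0Pr => e e0; rewrite add0e.
have := near_infty_natSinv_lt (PosNum e0) => -[j _ /(_ j (leqnn _)) /= je].
apply: (@le_trans _ _ (N (E (o + j.+1%:R) setT))).
  apply: le_measure; rewrite ?inE//; first exact: mE.
  by move=> p /(_ j); apply.
rewrite NE//; last by rewrite lerDl.
by apply: (le_trans (Sinc_tail Pshift j)); rewrite lee_fin ltW.
Qed.

Let D := E o setT `\` bad.

Let mD : measurable D.
Proof. by apply: measurableD => //; exact: mE. Qed.

Let S (p : Y * Rm) : set R :=
  [set r | exists n q, [/\ r = ratr q, o < ratr q & 0 <= p.2 < k n q p.1]].

(* Quantile transform: given y, the k n q y approximate from below the survival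
   function at q, and Z inverts its value p.2. *)
Let Z (p : Y * Rm) : R := if p \in D then sup (S p) else o.

(** On D the set [S p] is nonempty and bounded. Since [E x] is a union over q strictly above x, it
    contains p exactly when some element of [S p] exceeds x, that is, when the supremum does. *)
Let Z_gt p x : D p -> o <= x -> (x < Z p <-> E x setT p).
Proof.
move=> Dp ox; rewrite /Z mem_set//; have [Ep nbad] := Dp.
have S0 : S p !=set0.
  by have /EP[n [q [oq _ kp]]] := Ep; exists (ratr q), n, q.
have Sub : has_ubound (S p).
  have [j nE] : exists j, ~ E (o + j.+1%:R) setT p.
    by apply: contrapT => /forallNP h; apply: nbad => j _; exact: contrapT (h j).
  exists (o + j.+1%:R) => _ [n [q [-> oq kp]]]; rewrite leNgt; apply/negP => jq.
  by apply: nE; apply/EP; exists n, q.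
split.
  move=> /(sup_gt S0)[_ [n [q [-> oq kp]]] xq].
  by apply/EP; exists n, q.
move=> /EP[n [q [xq _ kp]]]; apply: (lt_le_trans xq).
apply: ub_le_sup => //; exists n, q; split => //.
exact: le_lt_trans xq.
Qed.

Let Z_ge p : o <= Z p.
Proof.
have [Dp|Dp] := pselect (D p); last by rewrite /Z memNset.
by apply: ltW; apply/(Z_gt Dp (lexx o)); case: Dp.
Qed.

Let mZ : measurable_fun setT (Z : Y * Rm -> R).
Proof.
apply: (measurability _ (RGenOInfty.measurableE R)) => _ [_ [x ->] <-].
rewrite setTI.
have [ox|xo] := leP o x; last first.
  rewrite (_ : _ @^-1` _ = setT)//; apply/seteqP; split => // p _ /=.
  by rewrite in_itv/= andbT; exact: lt_le_trans (Z_ge p).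
rewrite (_ : _ @^-1` _ = D `&` E x setT); first by apply: measurableI => //; exact: mE.
apply/seteqP; split => p /=; rewrite in_itv/= andbT.
  move=> xZ; have [Dp|Dp] := pselect (D p).
    by split=> //; apply/(Z_gt Dp ox).
  by move: xZ; rewrite /Z memNset// ltNge ox.
by move=> [Dp Ep]; apply/(Z_gt Dp ox).
Qed.

Let mZY : measurable_fun setT (fun p : Y * Rm => (Z p, p.1)).
Proof. by apply/measurable_fun_pairP; split => //; exact: measurable_fst. Qed.

Lemma mixing_measure_from_densities : exists M : {measure set XY -> \bar R},
  [/\ M [set z | z.1 <= o] = 0%E, (M setT <= u%:E)%E &
      forall x B, o <= x -> measurable B ->
        M [set z | x < z.1 /\ B z.2] = Sinc P x B].
Proof.
exists (image_measure (mrestr N mD) mZY); split.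
- rewrite image_measureE /= /mrestr (_ : _ `&` _ = set0) ?measure0//.
  apply/seteqP; split => // p [/= Zo Dp].
  have : o < Z p by apply/(Z_gt Dp (lexx o)); case: Dp.
  by rewrite ltNge Zo.
- rewrite image_measureE /= /mrestr preimage_setT setTI.
  apply: (@le_trans _ _ (N (E o setT))).
    by apply: le_measure; rewrite ?inE//; [exact: mE|exact: subDsetl].
  rewrite NE//; apply: ge_ereal_sup => _ [n _ <-].
  apply/lee_addgt0Pr => e e0; rewrite -EFinD.
  (* The bound at [o] is known only from some stage on; monotonicity in n carries it back to every
     n. *)
  have [n' _ hn'] := Pu e0.
  apply: (@le_trans _ _ (inc P (maxn n n') o setT)); last first.
    by apply: hn' => /=; exact: leq_maxr.
  by apply: (inc_le Pshift) => //; exact: leq_maxl.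
move=> x B ox mB; rewrite -NE// image_measureE /= /mrestr.
have -> : (fun p => (Z p, p.1)) @^-1` [set z | x < z.1 /\ B z.2] `&` D = E x B `&` D.
  apply/seteqP; split => p [].
    move=> [/= xZ Bp] Dp; split => //.
    have /(Z_gt Dp ox)/EP[n [q [xq _ kp]]] := xZ.
    by apply/EP; exists n, q.
  move=> /EP[n [q [xq Bp kp]]] Dp; split => //; split => //=.
  by apply/(Z_gt Dp ox)/EP; exists n, q.
apply/eqP; rewrite eq_le; apply/andP; split.
  apply: le_measure; rewrite ?inE//; [|exact: mE].
  by apply: measurableI => //; exact: mE.
have sub : E x B `<=` (E x B `&` D) `|` bad.
  move=> p Ep; have [bp|nbp] := pselect (bad p); [by right|left; split => //; split => //].
  have /EP[n [q [xq Bp kp]]] := Ep; apply/EP; exists n, q; split => //.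
  exact: le_lt_trans xq.
have mED : measurable (E x B `&` D) by apply: measurableI => //; exact: mE.
apply: (@le_trans _ _ (N ((E x B `&` D) `|` bad))).
  by apply: le_measure; rewrite ?inE//; [exact: mE|exact: measurableU].
by apply: (le_trans (measureU2 _ mED mbad)); rewrite [X in (_ + X)%E]Nbad adde0.
Qed.

End MixingMeasure.

Lemma measurable_invr {R : realType} : measurable_fun setT (fun x : R => x^-1).
Proof.
rewrite (_ : (fun x => _) = fun x : R => if 0 < x then x `^ (-1) else - ((- x) `^ (-1))).
  apply: measurable_fun_ifT; first exact: measurable_fun_ltr.
    exact: measurable_powR.
  by apply: measurable_funN; apply: (measurableT_comp (measurable_powR (-1))).
apply/funext => x; case: ltP => x0; first by rewrite powR_inv1// ltW.
by rewrite powR_inv1 ?oppr_ge0// invrN opprK.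
Qed.

Section MixtureRepresentation.
Context {R : realType} d (Y : measurableType d).
Local Notation XY := (R * Y)%type.
Local Notation Rm := (measurableTypeR R).
Local Notation mu := (@lebesgue_measure R).

Lemma measurable_stretch_pair (o : R) :
  measurable_fun setT (fun p : XY * Rm => (o + p.2 * (p.1.1 - o), p.1.2) : XY).
Proof.
have m11 : measurable_fun setT (fun p : XY * Rm => p.1.1).
  exact: (measurableT_comp measurable_fst measurable_fst).
have m2 : measurable_fun setT (fun p : XY * Rm => (p.2 : R)) by exact: measurable_snd.
apply/measurable_fun_pairP; split; last first.
  exact: (measurableT_comp measurable_snd measurable_fst).
apply: measurable_funD => //; apply: measurable_funM => //.
exact: measurable_funB.
Qed.

Definition stretch_pair_law (o : R) (Q : {measure set XY -> \bar R}) :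
  {measure set XY -> \bar R} :=
  image_measure (Q \x (@unif01 R))%E (measurable_stretch_pair o).

Lemma stretch_pair_lawE o (Q : {measure set XY -> \bar R}) A :
  (stretch_pair_law o Q A = \int[Q]_z unif01 [set s | A ((o + s * (z.1 - o))%R, z.2)])%E.
Proof.
rewrite /stretch_pair_law image_measureE /=/product_measure1.
apply: eq_integral => z _; congr (unif01 _).
by apply/seteqP; split => s; rewrite /xsection/= inE.
Qed.

Lemma measurable_unif01_section o (A : set XY) : measurable A ->
  measurable_fun setT (fun z : XY => unif01 [set s | A ((o + s * (z.1 - o))%R, z.2)]).
Proof.
move=> mA.
rewrite (_ : (fun z => _) = unif01 \o
    xsection ((fun p : XY * Rm => (o + p.2 * (p.1.1 - o), p.1.2) : XY) @^-1` A)).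
  apply: measurable_fun_xsection.
  by rewrite -[X in measurable X]setTI; exact: measurable_stretch_pair.
apply/funext => z /=; congr (unif01 _).
by apply/seteqP; split => s; rewrite /xsection/= inE.
Qed.

Lemma unif01_affine (o w : R) (A : set R) : 0 < w -> measurable A ->
  (unif01 [set s | A (o + s * w)%R] * w%:E = mu (A `&` `]o, (o + w)%R[%classic))%E.
Proof.
move=> w0 mA.
have mp : measurable ((fun s => (o + s * w)%R) @^-1` A).
  by rewrite -[X in measurable X]setTI; exact: measurable_affine.
rewrite unif01_indic// integral_indic//.
rewrite (_ : _ `&` _ = (fun s => (o + s * w)%R) @^-1` (A `&` `]o, (o + w)%R[%classic)).
  rewrite (_ : _ (_ @^-1` _) = (w^-1)%:E * mu (A `&` `]o, (o + w)%R[%classic))%E; last first.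
    apply: lebesgue_measure_affine => //.
    by apply: measurableI => //; exact: (@measurable_itv R `]o, (o + w)%R[).
  by rewrite muleC muleA -EFinM divff ?gt_eqF// mul1e.
apply/seteqP; split => s /= [As]; rewrite !in_itv/= => /andP[s0 s1]; split => //.
  by rewrite ltrDl pmulr_lgt0// s0 ltrD2l -[ltRHS]mul1r ltr_pM2r.
move: s0 s1; rewrite ltrDl pmulr_lgt0// => ->.
by rewrite ltrD2l -[ltRHS]mul1r ltr_pM2r.
Qed.

Variables (P : probability XY R) (o u : R).
Hypothesis Pshift : forall tau (A : set XY), 0 <= tau -> measurable A ->
  A `<=` [set p | o < p.1] -> (P [set p | A ((p.1 - tau)%R, p.2)] <= P A)%E.
Hypothesis Po : P [set p | p.1 <= o] = 0%E.
Hypothesis Pu : forall e, 0 < e ->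
  \forall n \near \oo, (inc P n o setT <= (u + e)%:E)%E.

(** The length of the segment below z, truncated because [density_measure] asks for a weight
    nonnegative everywhere; the mixing measure charges only z.1 > o. *)
Let w (z : XY) : R := Num.max 0 (z.1 - o).

Let measurable_above (p q : R) (B : set Y) : measurable B ->
  measurable [set x : Rm * XY | p < x.1 <= q /\ (x.1 < x.2.1 /\ B x.2.2)].
Proof.
move=> mB; have m21 : measurable_fun setT (fun z : Rm * XY => z.2.1).
  exact: (measurableT_comp measurable_fst measurable_snd).
have m1 : measurable_fun setT (fun z : Rm * XY => (z.1 : R)) by exact: measurable_fst.
pose b (z : Rm * XY) := [&& p < (z.1 : R), (z.1 : R) <= q & (z.1 : R) < z.2.1].
rewrite (_ : [set _ | _] = [set z | b z] `&` (snd \o snd) @^-1` B).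
  apply: measurableI.
    apply: measurable_bool; apply: measurable_and; first exact: measurable_fun_ltr.
    by apply: measurable_and; [exact: measurable_fun_ler|exact: measurable_fun_ltr].
  rewrite -[X in measurable X]setTI.
  exact: (measurableT_comp measurable_snd measurable_snd).
apply/seteqP; split => z; rewrite /b /=.
  by move=> [/andP[-> ->] [-> ?]].
by move=> [/and3P[-> -> ->] ?].
Qed.

(** The weight w cancels the height 1/w of the uniform density, leaving plain Lebesgue measure in x,
    ready for Tonelli. *)
Let strip_section p q B (z : XY) : o <= p -> measurable B ->
  (unif01 [set s | (`]p, q]%classic `*` B) ((o + s * (z.1 - o))%R, z.2)] * (w z)%:E =
   mu [set x | ((p < x <= q) /\ (x < z.1 /\ B z.2))%R])%E.
Proof.
move=> op mB; have [Bz|Bz] := pselect (B z.2); last first.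
  rewrite (_ : [set s | _] = set0); last by apply/seteqP; split => s // -[].
  by rewrite (_ : [set x | _] = set0) ?measure0 ?mul0e//; apply/seteqP; split => s // -[_ []].
rewrite (_ : [set s | (_ `*` _) _] = [set s | `]p, q]%classic (o + s * (z.1 - o))]); last first.
  by apply/seteqP; split => s /=; [case|split].
rewrite /w; have [zo|zo] := leP (z.1 - o) 0.
  rewrite mule0 (_ : [set x | _] = set0) ?measure0//.
  by apply/seteqP; split => x //= [/andP[px _] [xz _]]; lra.
rewrite unif01_affine//.
congr (mu _); apply/seteqP; split => x /=; rewrite !in_itv/=.
  by move=> [-> /andP[_ xz]]; split => //; split => //; lra.
by move=> [/andP[px xq] [xz _]]; rewrite px xq; split => //; apply/andP; split; lra.
Qed.

Lemma mixture_of_uniforms : exists Q : {measure set XY -> \bar R},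
  [/\ Q setT = 1%E, Q [set z | z.1 <= o] = 0%E,
      (\int[Q]_z (if (o < z.1)%R then (z.1 - o)^-1 else 0%R)%:E <= u%:E)%E &
      forall A, measurable A ->
        P A = (\int[Q]_z unif01 [set s | A ((o + s * (z.1 - o))%R, z.2)])%E].
Proof.
have [rho [k [k1 k2 k3 k4]]] := exists_density_family Pshift.
have [M0 [M00 M0u M0S]] := mixing_measure_from_densities Pshift Pu k1 k2 k3 k4.
have [M ME] := finite_of_measure (le_lt_trans M0u (ltry u)).
have m1 : measurable_fun setT (fun z : XY => z.1 - o).
  by apply: measurable_funB => //; exact: measurable_fst.
have mw : measurable_fun setT w by exact: measurable_maxr.
have w0 z : 0 <= w z by rewrite le_max lexx.
have [Q QE] := density_measure M mw w0.
have mle : measurable [set z : XY | z.1 <= o].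
  by apply: measurable_bool; apply: measurable_fun_ler => //; exact: measurable_fst.
have nuE A : measurable A -> stretch_pair_law o Q A =
    (\int[M]_z (unif01 [set s | A ((o + s * (z.1 - o))%R, z.2)] * (w z)%:E))%E.
  by move=> mA; rewrite stretch_pair_lawE QE//; exact: measurable_unif01_section.
have nu0 : stretch_pair_law o Q [set z | z.1 <= o] = 0%E.
  rewrite nuE//; apply: integral0_eq => z _ /=.
  rewrite /w; have [zo|zo] := leP (z.1 - o) 0; first by rewrite mule0.
  rewrite (@unif01_affine o _ `]-oo, o]%classic)//.
  rewrite (_ : _ `&` _ = set0) ?measure0//.
  by apply/seteqP; split => x //=; rewrite !in_itv/= => -[h1 /andP[h2 _]]; have := lt_le_trans h2 h1; rewrite ltxx.
(* By Tonelli the right side is the integral over ]p, q] of M {z.1 > x, z.2 in B}, which is S(x, B),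
   and S(., B) is a density of P. *)
have strip p q B : o <= p -> measurable B ->
    P (`]p, q]%classic `*` B) = stretch_pair_law o Q (`]p, q]%classic `*` B).
  move=> op mB; rewrite nuE; last by apply: measurableX => //; exact: measurable_itv.
  under eq_integral do rewrite strip_section//.
  rewrite -(integral_Sinc Pshift)//.
  have mA := measurable_above p q mB; set A := [set x : Rm * XY | _] in mA.
  have mi : measurable_fun setT (fun z : Rm * XY => (\1_A z)%:E : \bar R).
    exact/measurable_EFinP/measurable_indic.
  have i0 (z : Rm * XY) : (0 <= (\1_A z)%:E :> \bar R)%E by rewrite lee_fin.
  transitivity (\int[M]_z \int[mu]_x (\1_A (x, z))%:E)%E; last first.
    apply: eq_integral => z _.
    have mAz : measurable ([set x | A (x, z)] : set Rm).
      rewrite (_ : [set _ | _] = ysection A z); first exact: measurable_ysection.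
      by apply/seteqP; split => x; rewrite /ysection/= inE.
    rewrite -[RHS]/(mu [set x | A (x, z)]) -[X in mu X]setIT -integral_indic//.
  rewrite -(fubini_tonelli (m1 := mu) (m2 := M) _ mi i0).
  rewrite integral_mkcond; apply: eq_integral => x _; rewrite patchE.
  case: ifPn => xI.
    move: xI; rewrite inE/= in_itv/= => xI; have /andP[px _] := xI.
    rewrite -M0S//; last by apply: (le_trans op); exact: ltW.
    rewrite -ME -[X in M X]setIT -integral_indic//; last first.
      rewrite (_ : [set _ | _] = `]x, +oo[%classic `*` B).
        by apply: measurableX => //; exact: measurable_itv.
      by apply/seteqP; split => z /=; rewrite in_itv/= andbT.
    apply: eq_integral => z _; congr (_%:R%:E); congr nat_of_bool.
    by apply/idP/idP; rewrite !inE /A /=; [split|case].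
  rewrite integral0_eq// => z _; rewrite indicE memNset//= => -[xI' _].
  by move: xI; rewrite notin_setE/= in_itv.
have PQ A : measurable A -> P A = stretch_pair_law o Q A.
  move: A; apply: measure_unique_strips.
    by have /= -> := probability_setT P; rewrite ltry.
  move=> p q B mB.
  (* The comparison of strips needs o <= p; both measures vanish left of [o], so p may be raised to
     [Num.max p o]. *)
  have cut (m : {measure set XY -> \bar R}) : m [set z | z.1 <= o] = 0%E ->
      m (`]p, q]%classic `*` B) = m (`]Num.max p o, q]%classic `*` B).
    move=> m0.
    have mX (p' : R) : measurable (`]p', q]%classic `*` B : set XY).
      by apply: measurableX => //; exact: measurable_itv.
    apply/eqP; rewrite eq_le; apply/andP; split.
      apply: (@le_trans _ _ (m ((`]Num.max p o, q]%classic `*` B) `|` [set z | z.1 <= o]))).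
        apply: le_measure; rewrite ?inE//; first exact: measurableU.
        move=> z [/= zpq Bz]; have [zo|zo] := leP z.1 o; [by right|left; split => //=].
        by move: zpq; rewrite !in_itv/= gt_max zo andbT.
      apply: (le_trans (measureU2 _ (mX _) mle)).
      by rewrite [X in (_ + X)%E]m0 adde0.
    apply: le_measure; rewrite ?inE// => z [/= zpq Bz]; split => //=.
    by move: zpq; rewrite !in_itv/= gt_max => /andP[/andP[-> _] ->].
  apply: (etrans (cut P Po)); apply: (etrans _ (esym (cut _ nu0))).
  by apply: strip => //; rewrite le_max lexx orbT.
exists Q; split.
(* Stretching preserves total mass, so that of Q is read off from P. *)
- have : P setT = 1%E by exact: probability_setT.
  rewrite PQ// stretch_pair_lawE => <-.
  rewrite -[LHS]mul1e -integral_cst//; apply: eq_integral => z _ /=.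
  by apply/esym; exact: (probability_setT (@unif01 R)).
- rewrite -[X in Q X]setIT -integral_indic// QE//; last first.
    exact/measurable_EFinP/measurable_indic.
  apply: integral0_eq => z _; rewrite -EFinM indicE /w.
  have [zo|zo] := leP z.1 o; last by rewrite memNset ?mul0r//= leNgt zo.
  by rewrite max_l ?mulr0// subr_le0.
- rewrite QE; last 2 first.
  + apply/measurable_EFinP.
    apply: measurable_fun_ifT => //.
      by apply: measurable_fun_ltr => //; exact: measurable_fst.
    exact: (measurableT_comp measurable_invr).
  + by move=> z; rewrite lee_fin; case: ifPn => // zo; rewrite invr_ge0 subr_ge0 ltW.
  (* The inverse gap times the weight is at most 1, so the moment is bounded by the total mass of
     M. *)
  apply: (@le_trans _ _ (\int[M]_z (cst 1%:E) z)%E).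
    apply: ge0_le_integral => //.
    + move=> z _; rewrite -EFinM lee_fin mulr_ge0//.
      by case: ifPn => // zo; rewrite invr_ge0 subr_ge0 ltW.
    + apply/measurable_EFinP; apply: measurable_funM => //.
      apply: measurable_fun_ifT => //.
        by apply: measurable_fun_ltr => //; exact: measurable_fst.
      exact: (measurableT_comp measurable_invr).
    + move=> z _; rewrite -EFinM lee_fin /w; case: ifPn => [zo|_]; last by rewrite mul0r.
      have d0 : 0 < z.1 - o by rewrite subr_gt0.
      by rewrite max_r ?(ltW d0)// mulVf ?gt_eqF.
  by rewrite integral_cst//= mul1e ME.
- by move=> A mA; rewrite PQ// stretch_pair_lawE.
Qed.

End MixtureRepresentation.

(** * Constraints and objectives of stretched distributions *)

Section UniformOnInterval.
Context {R : realType}.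
Local Notation Rm := (measurableTypeR R).
Local Notation mu := (@lebesgue_measure R).

Lemma unif01_eq (A B : set R) : measurable A -> measurable B ->
  (forall s, 0 < s < 1 -> (A s <-> B s)) -> unif01 A = unif01 B.
Proof.
move=> mA mB AB; rewrite !unif01_indic//; apply: eq_integral => s.
rewrite inE/= in_itv/= => /AB e; congr (_%:R%:E); congr nat_of_bool.
by apply/idP/idP; rewrite !inE => /e.
Qed.

Lemma unif01_affineV (o w : R) (A : set R) : 0 < w -> measurable A ->
  (unif01 [set s | A (o + s * w)%R] = (w^-1)%:E * mu (A `&` `]o, (o + w)%R[%classic))%E.
Proof.
move=> w0 mA; rewrite -unif01_affine// muleC -muleA -EFinM divff ?mule1//.
by rewrite gt_eqF.
Qed.

Lemma measurable_itv_affine (o w : R) (L H : \bar R) :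
  measurable [set s : R | (L <= (o + s * w)%:E <= H)%E].
Proof.
rewrite -[X in measurable X]setTI.
exact: (measurable_affine o w measurableT (measurable_itv_ereal L H)).
Qed.

(** The one computation behind both the box integrand and the objective integrand of the moment
    problem. *)
Lemma unif01_between (o w : R) (L H : \bar R) : 0 < w -> (o%:E <= L)%E -> (L <= H)%E ->
  (unif01 [set s | (L <= (o + s * w)%:E <= H)%E] =
   (Order.min H (o + w)%:E - Order.min L (o + w)%:E) * (w^-1)%:E)%E.
Proof.
move=> w0 oL LH.
rewrite (@unif01_affineV o w [set x | (L <= x%:E <= H)%E])//; last exact: measurable_itv_ereal.
rewrite muleC; congr (_ * _)%E.
(* If L is at least o + w, possibly +oo, both minima equal o + w and the interval misses ]o, o +
   w[. *)
have [zL|Lz] := leP (o + w)%:E L.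
  have zH := le_trans zL LH.
  rewrite (min_r zH) subee// (_ : _ `&` _ = set0) ?measure0//.
  apply/seteqP; split => // x [/= /andP[Lx _]]; rewrite in_itv/= => /andP[_ xz].
  by have := le_trans zL Lx; rewrite lee_fin leNgt xz.
case: L Lz oL LH => // l; rewrite lte_fin lee_fin => lz ol lH.
have [k [kE lk kz]] : exists k : R, [/\ Order.min H (o + w)%:E = k%:E, l <= k & k <= o + w].
  have [Hz|zH] := leP H (o + w)%:E; last by exists (o + w); split => //; exact: ltW.
  case: H lH Hz => // h; rewrite !lee_fin => lh hz; by exists h.
(* The set lies between ]l, k[ and [l, k], which have equal length; whether it contains the
   endpoints need not be decided. *)
rewrite kE -EFinB; apply/eqP; rewrite eq_le; apply/andP; split.
  rewrite (_ : (k - l)%:E = mu `[l, k]%classic); last first.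
    rewrite lebesgue_measure_itv/= lte_fin -EFinB; case: ltP => // kl.
    by rewrite (_ : k = l) ?subrr//; apply/eqP; rewrite eq_le kl.
  apply: le_measure; rewrite ?inE.
  - by apply: measurableI; [exact: measurable_itv_ereal|exact: (@measurable_itv R `]o, (o + w)%R[)].
  - exact: (@measurable_itv R `[l, k]).
  - move=> x [/= /andP[lx xH]]; rewrite !in_itv/= => /andP[_ xz].
    by rewrite -lee_fin lx -lee_fin -kE le_min xH lee_fin ltW.
rewrite (_ : (k - l)%:E = mu `]l, k[%classic); last first.
  rewrite lebesgue_measure_itv/= lte_fin -EFinB; case: ltP => // kl.
  by rewrite (_ : k = l) ?subrr//; apply/eqP; rewrite eq_le kl.
apply: le_measure; rewrite ?inE.
- exact: (@measurable_itv R `]l, k[).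
- by apply: measurableI; [exact: measurable_itv_ereal|exact: (@measurable_itv R `]o, (o + w)%R[)].
- move=> x; rewrite /= !in_itv/= => /andP[lx xk]; split.
    rewrite lee_fin (ltW lx)/=; have : (x%:E <= k%:E)%E by rewrite lee_fin ltW.
    by rewrite -kE le_min => /andP[].
  by rewrite (le_lt_trans ol lx) (lt_le_trans xk kz).
Qed.

End UniformOnInterval.

Section MomentToDistribution.
Context {R : realType} {m : nat}.
Local Notation T := (m.+1.-tuple R).
Local Notation Rm := (measurableTypeR R).
Local Notation mu := (@lebesgue_measure R).
Variables (x0 : 'I_m.+1 -> \bar R) (o : R).
Hypothesis x0o : x0 ord0 = o%:E.

Lemma ge0_integral_D0pos (Q : probability T R) (f : T -> \bar R) :
  Q (D0pos x0 o) = 1%E -> measurable_fun (D0 x0) f ->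
  (forall z, D0 x0 z -> (0 <= f z)%E) ->
  (\int[Q]_(z in D0 x0) f z = \int[Q]_(z in D0pos x0 o) f z)%E.
Proof.
move=> QD mf f0; have mD := measurable_D0 x0; have mDp := measurable_D0pos x0 o.
have Q0 : Q (~` D0pos x0 o) = 0%E by rewrite probability_setC// QD subee.
rewrite (ge0_negligible_integral (measurableC mDp) mD mf f0 Q0); congr integral.
by rewrite setDE setCK; apply/seteqP; split => z [] // Dz oz; split.
Qed.

Lemma measurable_inv_gap D : measurable_fun D (@inv_gap R m o).
Proof.
apply: measurable_funTS; apply: measurable_fun_ifT.
- by apply: measurable_fun_eqr => //; exact: measurable_tnth.
- exact: measurable_cst.
- apply/measurable_EFinP; apply: (measurableT_comp measurable_invr).
  by apply: measurable_funB => //; exact: measurable_tnth.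
Qed.

Lemma inv_gap_ge0 z : D0 x0 z -> (0 <= inv_gap o z)%E.
Proof.
move=> Dz; rewrite /inv_gap; case: ifPn => // _.
by rewrite lee_fin invr_ge0 subr_ge0 -lee_fin -x0o; exact: Dz.
Qed.

(** The convention 1/0 = +oo in [inv_gap] makes its integral infinite as soon as the face z_1 = o
    has mass. This is also why the value 0^-1 = 0 in the other integrands is harmless. *)
Lemma moment_D0pos (Q : probability T R) : Q (~` D0 x0) = 0%E ->
  (\int[Q]_(z in D0 x0) inv_gap o z < +oo)%E -> Q (D0pos x0 o) = 1%E.
Proof.
move=> QD Qoo; have mD := measurable_D0 x0; have mDp := measurable_D0pos x0 o.
pose N := D0 x0 `&` [set z : T | tnth z ord0 == o].
have mN : measurable N.
  apply: measurableI => //; apply: measurable_bool; apply: measurable_fun_eqr => //.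
  exact: measurable_tnth.
have QN : Q N = 0%E.
  apply/eqP; rewrite eq_le measure_ge0 andbT leNgt; apply/negP => N0.
  suff : (+oo <= \int[Q]_(z in D0 x0) inv_gap o z)%E by rewrite leNgt Qoo.
  apply: (@le_trans _ _ (\int[Q]_(z in N) inv_gap o z)%E).
    rewrite (eq_integral (cst +oo%E)); last first.
      by move=> z; rewrite inE => -[_ /= zo]; rewrite /inv_gap zo.
    by rewrite integral_cst// gt0_mulye.
  apply: ge0_subset_integral => //.
  - exact: measurable_inv_gap.
  - exact: inv_gap_ge0.
  - exact: subIsetl.
rewrite -[D0pos x0 o]setCK probability_setC; last exact: measurableC.
rewrite (_ : Q (~` D0pos x0 o) = 0%E) ?sube0//.
apply/eqP; rewrite eq_le measure_ge0 andbT -(adde0 0%E) -[X in (X + _)%E]QD -[X in (_ + X)%E]QN.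
apply: le_trans (measureU2 _ (measurableC mD) mN).
apply: le_measure; rewrite ?inE; first exact: measurableC.
  by apply: measurableU => //; exact: measurableC.
move=> z /= nz; have [Dz|Dz] := pselect (D0 x0 z); [right|by left].
split => //=; rewrite eq_le; apply/andP; split.
  by rewrite leNgt; apply/negP => oz; apply: nz.
by rewrite -lee_fin -x0o; exact: Dz.
Qed.

Lemma stretch_law_slice (Q : probability T R) (A : set T) (f : T -> \bar R) :
  Q (D0pos x0 o) = 1%E -> measurable A ->
  measurable_fun (D0 x0) f -> (forall z, D0 x0 z -> (0 <= f z)%E) ->
  (forall z, D0pos x0 o z -> unif01 [set s | A (stretch o z s)] = f z) ->
  (stretch_law o Q A = \int[Q]_(z in D0 x0) f z)%E.
Proof.
move=> QD mA mf f0 fE; rewrite (stretch_law_on o (measurable_D0pos x0 o) QD)//.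
rewrite ge0_integral_D0pos//; apply: eq_integral => z; rewrite inE; exact: fE.
Qed.

Lemma tnth_stretchS (z : T) s j : tnth (stretch o z s) (lift ord0 j) = tnth z (lift ord0 j).
Proof. by rewrite /stretch tnthS tnth_rest. Qed.

Lemma rest_stretch (z : T) s : rest (stretch o z s) = rest z.
Proof. exact: rest_cons. Qed.

Lemma stretch_D0pos (z : T) s : D0pos x0 o z -> 0 < s < 1 -> D0 x0 (stretch o z s).
Proof.
by move=> [Dz oz] /andP[s0 _]; apply: stretch_D0 => //; exact: ltW.
Qed.

Lemma measurable_slice (A : set T) z : measurable A ->
  measurable [set s : R | A (stretch o z s)].
Proof.
by move=> mA; rewrite -[X in measurable X]setTI; exact: measurable_stretch1.
Qed.

Lemma measurable_box lo hi : measurable (box x0 lo hi).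
Proof.
apply: measurableI; first exact: measurable_D0.
apply: (@measurable_forall_tnth _ _ (fun j => [set x : R | (lo j <= x%:E <= hi j)%E])) => j.
exact: measurable_itv_ereal.
Qed.

Let minD_ge0 (a b : \bar R) (x : R) : (a <= b)%E -> (o%:E <= a)%E ->
  (0 <= Order.min b x%:E - Order.min a x%:E)%E.
Proof.
move=> ab oa; rewrite sube_ge0; last first.
  by apply/orP; left; case: (leP a x%:E) => //; case: a oa {ab}.
by rewrite le_min !ge_min ab lexx orbT.
Qed.

Lemma stretch_law_box (Q : probability T R) lo hi : Q (D0pos x0 o) = 1%E ->
  (forall j, (x0 j <= lo j)%E /\ (lo j <= hi j)%E) ->
  (stretch_law o Q (box x0 lo hi) = \int[Q]_(z in D0 x0) box_fun o lo hi z)%E.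
Proof.
move=> QD lohi; have mB := measurable_box lo hi.
set I := [set y : T | forall j : 'I_m,
  (lo (lift ord0 j) <= (tnth y (lift ord0 j))%:E <= hi (lift ord0 j))%E].
have mI : measurable I.
  rewrite (_ : I = @rest R m @^-1` [set y : m.-tuple R | forall j : 'I_m,
      [set x : R | (lo (lift ord0 j) <= x%:E <= hi (lift ord0 j))%E] (tnth y j)]).
    rewrite -[X in measurable X]setTI; apply: measurable_rest => //.
    apply: (@measurable_forall_tnth _ _ (fun j : 'I_m =>
      [set x : R | (lo (lift ord0 j) <= x%:E <= hi (lift ord0 j))%E])) => j.
    exact: measurable_itv_ereal.
  by apply/seteqP; split => z Iz j; move: (Iz j); rewrite /= tnth_rest.
have m0 : measurable_fun setT (fun z : T => (tnth z ord0)%:E : \bar R).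
  by apply/measurable_EFinP; exact: measurable_tnth.
apply: stretch_law_slice => //.
- apply: measurable_funTS; apply: emeasurable_funM; last first.
    exact/measurable_EFinP/measurable_indic.
  apply: emeasurable_funM; last first.
    apply/measurable_EFinP; apply: (measurableT_comp measurable_invr).
    by apply: measurable_funB => //; exact: measurable_tnth.
  by apply: emeasurable_funB; exact: measurable_mine.
- move=> z Dz; apply: mule_ge0; last by rewrite lee_fin.
  apply: mule_ge0; last first.
    by rewrite lee_fin invr_ge0 subr_ge0 -lee_fin -x0o; exact: Dz.
  rewrite ![Order.min (tnth z ord0)%:E _]minC; apply: minD_ge0.
    by case: (lohi ord0).
  by rewrite -x0o; case: (lohi ord0).
move=> z Dz; have [_ oz] := Dz; rewrite /box_fun -/I.
have w0 : 0 < tnth z ord0 - o by rewrite subr_gt0.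
have [Iz|Iz] := pselect (I z); last first.
  rewrite [X in (_ * X%:E)%E]indicE memNset// mule0 (_ : [set s | _] = set0) ?measure0//.
  apply/seteqP; split => // s [_ Bs]; apply: Iz => j.
  by have := Bs (lift ord0 j); rewrite tnth_stretchS.
rewrite [X in (_ * X%:E)%E]indicE mem_set// mule1.
rewrite (@unif01_eq _ _ [set s | (lo ord0 <= (o + s * (tnth z ord0 - o))%:E <= hi ord0)%E]).
- rewrite unif01_between//.
  + by rewrite (addrC o) subrK ![Order.min _ (tnth z ord0)%:E]minC.
  + by rewrite -x0o; case: (lohi ord0).
  + by case: (lohi ord0).
- exact: measurable_slice.
- exact: measurable_itv_affine.
- move=> s s01; split; first by move=> [_ /(_ ord0)].
  move=> s0; split; first exact: stretch_D0pos.
  move=> j; case: (unliftP ord0 j) => [k ->|->//].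
  by rewrite tnth_stretchS; exact: Iz.
Qed.

Section Objective.
Variables (g1 g2 : m.-tuple R -> \bar R).
Hypotheses (mg1 : measurable_fun (gdom x0) g1) (mg2 : measurable_fun (gdom x0) g2).
Hypothesis g12 : forall y, gdom x0 y -> (o%:E <= g1 y)%E /\ (g1 y <= g2 y)%E.

Lemma rest_gdom (z : T) : D0 x0 z -> gdom x0 (rest z).
Proof. by move=> Dz j; rewrite tnth_rest; exact: Dz. Qed.

Lemma measurable_comp_rest (g : m.-tuple R -> \bar R) :
  measurable_fun (gdom x0) g -> measurable_fun (D0 x0) (g \o @rest R m).
Proof.
move=> mg; apply: (measurable_comp _ _ mg).
- apply: (@measurable_forall_tnth _ _ (fun j => [set x : R | (x0 (lift ord0 j) <= x%:E)%E])) => j.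
  apply: (@measurable_bool _ _ (fun x : R => (x0 (lift ord0 j) <= x%:E)%E)).
  by apply: measurable_fun_lee => //; exact: EFin_measurable.
- by move=> _ [z Dz <-]; exact: rest_gdom.
- by apply: measurable_funTS; exact: measurable_rest.
Qed.

Let m0 : measurable_fun (D0 x0) (fun z : T => (tnth z ord0)%:E : \bar R).
Proof. by apply: measurable_funTS; apply/measurable_EFinP; exact: measurable_tnth. Qed.

Lemma measurable_Sset : measurable (Sset x0 g1 g2).
Proof.
pose b (t : T) := (g1 (rest t) <= (tnth t ord0)%:E)%E && ((tnth t ord0)%:E <= g2 (rest t))%E.
have mb : measurable_fun (D0 x0) b.
  by apply: measurable_and; apply: measurable_fun_lee => //; exact: measurable_comp_rest.
exact: (mb (measurable_D0 x0) [set true]).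
Qed.

Lemma stretch_law_Sset (Q : probability T R) : Q (D0pos x0 o) = 1%E ->
  (stretch_law o Q (Sset x0 g1 g2) = \int[Q]_(z in D0 x0) obj_fun o g1 g2 z)%E.
Proof.
move=> QD; have mS := measurable_Sset.
apply: stretch_law_slice => //.
- apply: emeasurable_funM; last first.
    apply: measurable_funTS; apply/measurable_EFinP; apply: (measurableT_comp measurable_invr).
    by apply: measurable_funB => //; exact: measurable_tnth.
  by apply: emeasurable_funB; apply: measurable_mine => //; exact: measurable_comp_rest.
- move=> z Dz; have [og gg] := g12 (rest_gdom Dz); apply: mule_ge0; first exact: minD_ge0.
  by rewrite lee_fin invr_ge0 subr_ge0 -lee_fin -x0o; exact: Dz.
move=> z Dz; have [D oz] := Dz; have [og gg] := g12 (rest_gdom D).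
have w0 : 0 < tnth z ord0 - o by rewrite subr_gt0.
rewrite (@unif01_eq _ _ [set s | (g1 (rest z) <= (o + s * (tnth z ord0 - o))%:E <= g2 (rest z))%E]).
- by rewrite unif01_between// (addrC o) subrK.
- exact: measurable_slice.
- exact: measurable_itv_affine.
- move=> s s01; rewrite /Sset /= rest_stretch; split; first by case.
  by move=> h; split => //; exact: stretch_D0pos.
Qed.

End Objective.

End MomentToDistribution.

Section InitialDensity.
Context {R : realType} {m : nat}.
Local Notation T := (m.+1.-tuple R).
Local Notation Rm := (measurableTypeR R).
Local Notation mu := (@lebesgue_measure R).
Variables (x0 : 'I_m.+1 -> \bar R) (o : R).
Hypothesis x0o : x0 ord0 = o%:E.
Variables (Q : probability T R) (v : R).
Hypothesis QD : Q (D0pos x0 o) = 1%E.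
Hypothesis Qv : (\int[Q]_(z in D0 x0) inv_gap o z <= v%:E)%E.

(** The density at x of the uniform law on ]o, z_1[. Its Q-mean G is a density of the first
    coordinate of the stretched law; it is nonincreasing, and its value at [o] is the inverse-gap
    moment. *)
Let K (x : R) (z : T) : R :=
  \1_(D0pos x0 o) z * (x < tnth z ord0)%R%:R * (tnth z ord0 - o)^-1.

Let G (x : R) : \bar R := (\int[Q]_z (K x z)%:E)%E.

Let K_in x z : D0pos x0 o z -> K x z = (x < tnth z ord0)%R%:R * (tnth z ord0 - o)^-1.
Proof. by move=> Dz; rewrite /K indicE mem_set// mul1r. Qed.

Let K_out x z : ~ D0pos x0 o z -> K x z = 0.
Proof. by move=> Dz; rewrite /K indicE memNset// !mul0r. Qed.

Let K_ge0 x z : 0 <= K x z.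
Proof.
have [Dz|Dz] := pselect (D0pos x0 o z); last by rewrite K_out.
have [_ oz] := Dz; rewrite K_in// mulr_ge0// invr_ge0 subr_ge0 ltW//.
Qed.

Let K_le x y z : x <= y -> K y z <= K x z.
Proof.
move=> xy; have [Dz|Dz] := pselect (D0pos x0 o z); last by rewrite !K_out.
have [_ oz] := Dz; rewrite !K_in//; apply: ler_wpM2r.
  by rewrite invr_ge0 subr_ge0 ltW.
case: (ltP y) => [yz|]; last by rewrite ler0n.
by rewrite (le_lt_trans xy yz).
Qed.

Let mK : measurable_fun setT (fun p : Rm * T => K (p.1 : R) p.2).
Proof.
have m2 : measurable_fun setT (fun p : Rm * T => tnth p.2 ord0).
  exact: (measurableT_comp (measurable_tnth ord0) measurable_snd).
have m1 : measurable_fun setT (fun z : Rm * T => (z.1 : R)) by exact: measurable_fst.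
apply: measurable_funM; last first.
  by apply: (measurableT_comp measurable_invr); exact: measurable_funB.
apply: measurable_funM.
  apply: (measurableT_comp _ measurable_snd); apply: measurable_indic.
  exact: measurable_D0pos.
rewrite (_ : (fun p => _) = fun p : Rm * T => if (p.1 : R) < tnth p.2 ord0 then 1 else 0).
  by apply: measurable_fun_ifT => //; exact: measurable_fun_ltr.
by apply/funext => p; case: ltP.
Qed.

Let mKE : measurable_fun setT (fun p : Rm * T => (K (p.1 : R) p.2)%:E).
Proof. exact/measurable_EFinP. Qed.

Let mK2 x : measurable_fun setT (fun z : T => (K x z)%:E).
Proof.
have mp : measurable_fun setT (fun z : T => ((x : Rm), z)) by exact: measurable_pair1.
exact: (measurableT_comp mKE mp).
Qed.

Let mG : measurable_fun setT (G : Rm -> \bar R).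
Proof.
apply: (measurable_fun_fubini_tonelli_F (m2 := Q) (fun p : Rm * T => (K (p.1 : R) p.2)%:E) mKE).
by move=> p; rewrite lee_fin.
Qed.

Let G_ge0 x : (0 <= G x)%E.
Proof. by apply: integral_ge0 => z _; rewrite lee_fin. Qed.

Let G_le x y : x <= y -> (G y <= G x)%E.
Proof.
move=> xy; apply: ge0_le_integral => //.
- by move=> z _; rewrite lee_fin.
- by move=> z _; rewrite lee_fin K_le.
Qed.

Let Go : G o = (\int[Q]_(z in D0 x0) inv_gap o z)%E.
Proof.
rewrite (ge0_integral_D0pos QD)//; last 2 first.
- exact: measurable_inv_gap.
- exact: inv_gap_ge0.
rewrite [RHS]integral_mkcond; apply: eq_integral => z _; rewrite patchE.
case: ifPn => [|/negP Dz]; last by rewrite K_out// => h; apply: Dz; rewrite inE.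
rewrite inE => Dz; have [_ oz] := Dz; rewrite K_in// oz mul1r /inv_gap.
by rewrite gt_eqF.
Qed.

Let G_fin x : o <= x -> G x \is a fin_num.
Proof.
move=> ox; rewrite ge0_fin_numE// (le_lt_trans (G_le ox))// Go.
by rewrite (le_lt_trans Qv)// ltry.
Qed.

(** K is nonincreasing in x, so [K o] dominates, and it is integrable by the moment constraint. For
    z_1 > o the point o + 1/(n+1) is eventually below z_1. *)
Let G_cvg : G (o + n.+1%:R^-1) @[n --> \oo] --> G o.
Proof.
apply: (@dominated_cvg _ _ _ _ _ measurableT _ _ (fun z => (K o z)%:E)) => //.
- move=> z _; apply: cvg_EFin; first exact: nearW.
  apply: cvg_near_cst.
  have [Dz|Dz] := pselect (D0pos x0 o z); last by apply: nearW => n /=; rewrite !K_out.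
  have [_ oz] := Dz; have d0 : 0 < tnth z ord0 - o by rewrite subr_gt0.
  have := near_infty_natSinv_lt (PosNum d0); apply: filterS => n /= hn.
  by rewrite !K_in// oz (_ : _ < _ = true)// addrC -ltrBrDr.
- apply/integrableP; split => //.
  rewrite (eq_integral (fun z => (K o z)%:E)); last by move=> z _; rewrite gee0_abs// lee_fin.
  by have := G_fin (lexx o); rewrite ge0_fin_numE.
- move=> n z _; rewrite gee0_abs ?lee_fin//; apply: K_le.
  by rewrite lerDl.
Qed.

Let slice_density (A : set R) : measurable A -> A `<=` [set x | o <= x] ->
  (stretch_law o Q [set t | D0 x0 t /\ A (tnth t ord0)] = \int[mu]_(x in A) G x)%E.
Proof.
move=> mA Ao; have mD := measurable_D0 x0.
have mo : measurable [set o] by exact: measurable_set1.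
have mAo : measurable (A `\ o) by exact: measurableD.
have mP : measurable [set t : T | D0 x0 t /\ A (tnth t ord0)].
  apply: measurableI => //; rewrite -[X in measurable X]setTI.
  exact: (measurable_tnth ord0 measurableT mA).
rewrite (stretch_law_on o (measurable_D0pos x0 o) QD)//.
(* K counts the endpoint x = o, which the open interval ]o, z_1[ excludes; dropping this null point
   makes the identity below pointwise. *)
have -> : (\int[mu]_(x in A) G x = \int[mu]_(x in A `\ o) G x)%E.
  apply: (@ge0_negligible_integral _ Rm _ mu A [set o]) => //.
    exact: measurable_funTS.
  exact: lebesgue_measure_set1.
rewrite [RHS]integral_mkcond.
have mf : measurable_fun setT (fun p : Rm * T => (\1_(A `\ o) (p.1 : R) * K (p.1 : R) p.2)%:E).
  apply/measurable_EFinP; apply: measurable_funM => //.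
  by apply: (measurableT_comp _ measurable_fst); exact: measurable_indic.
have f0 (p : Rm * T) : (0 <= (\1_(A `\ o) (p.1 : R) * K (p.1 : R) p.2)%:E)%E.
  by rewrite lee_fin mulr_ge0.
transitivity (\int[mu]_x \int[Q]_z (\1_(A `\ o) x * K x z)%:E)%E; last first.
  apply: eq_integral => x _; rewrite patchE; case: ifPn => xA.
    by apply: eq_integral => z _; rewrite indicE xA mul1r.
  by rewrite integral0_eq// => z _; rewrite indicE (negbTE xA) mul0r.
rewrite (fubini_tonelli (m1 := mu) (m2 := Q) _ mf f0).
rewrite integral_mkcond; apply: eq_integral => z _; rewrite patchE.
case: ifPn => [|/negP Dz]; last first.
  rewrite integral0_eq// => x _; rewrite K_out ?mulr0//.
  by move=> h; apply: Dz; rewrite inE.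
rewrite inE => Dz; have [D oz] := Dz.
have w0 : 0 < tnth z ord0 - o by rewrite subr_gt0.
have w'0 : 0 <= (tnth z ord0 - o)^-1 by rewrite invr_ge0 ltW.
have mAz : measurable (A `&` `]o, tnth z ord0[%classic).
  by apply: measurableI => //; exact: measurable_itv.
rewrite (@unif01_eq _ _ [set s | A (o + s * (tnth z ord0 - o))]).
- rewrite unif01_affineV// (addrC o) subrK.
  rewrite -[X in (_ * mu X)%E]setIT -integral_indic// -ge0_integralZl//.
  + apply: eq_integral => x _; rewrite -EFinM; congr EFin.
    rewrite K_in// mulrA mulrC; congr (_ * _); rewrite !indicE -natrM mulnb.
    congr (_%:R); congr nat_of_bool; apply/idP/andP.
      rewrite inE => -[Ax]; rewrite /= in_itv/= => /andP[ox xz].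
      by split => //; rewrite inE; split => // /= xo; rewrite xo ltxx in ox.
    rewrite !inE => -[[Ax xo] xz]; split => //=; rewrite in_itv/= xz andbT.
    rewrite lt_neqAle; apply/andP; split; first by apply/eqP => ox; exact: xo.
    exact: Ao.
  + exact/measurable_EFinP/measurable_indic.
- exact: measurable_slice.
- by rewrite -[X in measurable X]setTI; exact: measurable_affine.
- move=> s s01; split; first by case.
  by move=> As; split => //; exact: (stretch_D0pos x0o).
Qed.

Lemma stretch_law_initial_density (c : R) (P : {measure set T -> \bar R}) : 0 < c ->
  (forall A, measurable A -> P A = (c%:E * stretch_law o Q A)%E) ->
  dens_x10_le x0 o (c * v) P.
Proof.
move=> c0 PE; exists (fun x => c * fine (G x)); split.
- by move=> x _; apply: mulr_ge0; [exact: ltW|exact: fine_ge0].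
- apply: measurable_funTS; apply: measurable_funM => //.
  exact: (measurableT_comp (fine_measurable measurableT)).
- move=> A mA Ao; rewrite PE; last first.
    apply: measurableI; first exact: measurable_D0.
    by rewrite -[X in measurable X]setTI; exact: (measurable_tnth ord0 measurableT mA).
  rewrite slice_density// -ge0_integralZl//; last 2 first.
  + exact: measurable_funTS.
  + by rewrite lee_fin ltW.
  apply: eq_integral => x; rewrite inE => /Ao ox.
  by rewrite EFinM fineK// G_fin.
- move=> e e0; have ec : 0 < e / c by rewrite divr_gt0.
  have Gc : fine (G (o + n.+1%:R^-1)) @[n --> \oo] --> fine (G o).
    by apply: fine_cvg; rewrite fineK ?G_fin//; exact: G_cvg.
  have /cvgrPdist_lt/(_ _ ec)[n _ /(_ n (leqnn _)) /= hn] := Gc.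
  (* Monotonicity squeezes G x between G (o + 1/(n+1)) and G o, so convergence along one sequence
     gives right-continuity. *)
  exists n.+1%:R^-1 => // x /andP[ox xn].
  rewrite -mulrBr normrM gtr0_norm// mulrC -ltr_pdivlMr//.
  have h1 : fine (G x) <= fine (G o) by apply: fine_le; rewrite ?G_fin// G_le.
  have h2 : fine (G (o + n.+1%:R^-1)) <= fine (G x).
    by apply: fine_le; rewrite ?G_fin ?lerDl// G_le// ltW.
  move: hn; rewrite !ltr_norml => /andP[h3 h4]; apply/andP; split; lra.
- by apply: ler_wpM2l; [exact: ltW|rewrite -lee_fin fineK ?G_fin// Go].
Qed.

Lemma stretch_law_no_atom : stretch_law o Q [set t | tnth t ord0 = o] = 0%E.
Proof.
have mo : measurable [set o] by exact: measurable_set1.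
have mP : measurable [set t : T | tnth t ord0 = o].
  by rewrite -[X in measurable X]setTI; exact: (measurable_tnth ord0 measurableT mo).
rewrite (stretch_law_on o (measurable_D0pos x0 o) QD)//.
apply: integral0_eq => z [_ oz]; rewrite unif01_indic; last exact: measurable_slice.
apply: integral0_eq => s; rewrite /= in_itv/= => /andP[s0 s1].
have h : 0 < s * (tnth z ord0 - o) by rewrite mulr_gt0// subr_gt0.
rewrite indicE memNset// => so; have {}so : o + s * (tnth z ord0 - o) = o := so.
by move: h so; set p := s * _ => h so; lra.
Qed.

End InitialDensity.

(** * Equivalence of the two problems *)

Section DistributionToMoment.
Context {R : realType} {m : nat}.
Local Notation T := (m.+1.-tuple R).
Local Notation Y := (m.-tuple R).
Local Notation XY := (R * m.-tuple R)%type.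
Local Notation Rm := (measurableTypeR R).
Local Notation mu := (@lebesgue_measure R).
Variables (x0 : 'I_m.+1 -> \bar R) (o : R).
Hypothesis x0o : x0 ord0 = o%:E.

Let split0 (t : T) : XY := (tnth t ord0, rest t).
Let join0 (p : XY) : T := cons_tuple p.1 p.2.

Let msplit : measurable_fun setT split0.
Proof.
apply/measurable_fun_pairP; split; first exact: measurable_tnth.
exact: measurable_rest.
Qed.

Let mjoin : measurable_fun setT join0.
Proof. exact: (@measurable_cons _ _ _ R fst m snd). Qed.

Let splitK t : join0 (split0 t) = t.
Proof. exact: cons_rest. Qed.

Lemma POU1_dist_mixture (P : {measure set T -> \bar R}) (v : R) :
  POU1_dist x0 P -> P [set t | tnth t ord0 = o] = 0%E ->
  (forall e, 0 < e -> \forall n \near \oo,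
    ((2 ^+ n)%:E * P [set t | (o < tnth t ord0 <= o + dyad n)%R] <= (v + e)%:E)%E) ->
  exists Q : probability T R, [/\ Q (D0pos x0 o) = 1%E,
    (\int[Q]_(z in D0 x0) inv_gap o z <= v%:E)%E &
    forall A, measurable A -> P A = stretch_law o Q A].
Proof.
move=> hP Pat Pv; have [P1 PD _] := hP; have mD := measurable_D0 x0.
have P21 : image_measure P msplit setT = 1%E by rewrite image_measureE preimage_setT.
have [P2 P2E] := probability_of_measure P21.
have P2E' A : P2 A = P (split0 @^-1` A) by rewrite P2E.
have shift2 tau (A : set XY) : 0 <= tau -> measurable A ->
    A `<=` [set p | o < p.1] -> (P2 [set p | A ((p.1 - tau)%R, p.2)] <= P2 A)%E.
  move=> tau0 mA Ao; rewrite !P2E'.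
  rewrite (_ : _ @^-1` [set p | _] = shift tau @^-1` (split0 @^-1` A)); last first.
    by apply/seteqP; split => t; rewrite /= /split0 rest_cons.
  apply: (POU1_dist_shift x0o) => //.
    by rewrite -[X in measurable X]setTI; exact: msplit.
  by move=> t /Ao.
have mo : measurable [set t : T | tnth t ord0 = o].
  rewrite -[X in measurable X]setTI.
  exact: (measurable_tnth ord0 measurableT (measurable_set1 o)).
(* A point with t_1 <= o lies outside [D0 x0] or on the face t_1 = o, two null sets. *)
have P2o : P2 [set p | p.1 <= o] = 0%E.
  rewrite P2E'; apply/eqP; rewrite eq_le measure_ge0 andbT.
  rewrite -(adde0 0%E) -[X in (X + _)%E]PD -[X in (_ + X)%E]Pat.
  apply: le_trans (measureU2 _ (measurableC mD) mo).
  apply: le_measure; rewrite ?inE.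
  - apply: measurable_bool; apply: measurable_fun_ler => //; exact: measurable_tnth.
  - by apply: measurableU => //; exact: measurableC.
  move=> t /= to; have [Dt|Dt] := pselect (D0 x0 t); [right|by left].
  by apply/eqP; rewrite eq_le to /= -lee_fin -x0o; exact: Dt.
have P2v e : 0 < e -> \forall n \near \oo, (inc P2 n o setT <= (v + e)%:E)%E.
  move=> e0; apply: filterS (Pv _ e0) => n; rewrite /inc P2E'.
  rewrite (_ : _ @^-1` _ = [set t | (o < tnth t ord0 <= o + dyad n)%R])//.
  by apply/seteqP; split => t; [case|split].
have [Q2 [Q21 Q2o Q2v Q2E]] := mixture_of_uniforms shift2 P2o P2v.
have Q1 : image_measure Q2 mjoin setT = 1%E by rewrite image_measureE preimage_setT.
have [Q QE] := probability_of_measure Q1.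
have QE' A : Q A = Q2 (join0 @^-1` A) by rewrite QE.
have QI (f : T -> \bar R) : measurable_fun setT f -> (forall t, 0 <= f t)%E ->
    (\int[Q]_t f t = \int[Q2]_p f (join0 p))%E.
  move=> mf f0; rewrite -(ge0_integral_image Q2 mjoin)//.
  by apply: eq_measure_integral => A _ _; exact: QE'.
have PQ A : measurable A -> P A = stretch_law o Q A.
  move=> mA; rewrite stretch_lawE// QI.
  - transitivity (P2 (join0 @^-1` A)).
      rewrite P2E'; congr (P _); apply/seteqP; split => t; rewrite /= ?splitK//.
    rewrite Q2E; last by rewrite -[X in measurable X]setTI; exact: mjoin.
    apply: eq_integral => p _; congr (unif01 _); apply/seteqP; split => s;
      by rewrite /= /stretch /join0 /= rest_cons.
  - rewrite (_ : (fun z => _) = unif01 \o xsection ((fun p : T * Rm => stretch o p.1 (p.2 : R)) @^-1` A)).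
      apply: measurable_fun_xsection.
      by rewrite -[X in measurable X]setTI; exact: measurable_stretch.
    apply/funext => z /=; congr (unif01 _).
    by apply/seteqP; split => s; rewrite /xsection/= inE.
  - by move=> z; exact: measure_ge0.
have mle : measurable [set t : T | tnth t ord0 <= o].
  by apply: measurable_bool; apply: measurable_fun_ler => //; exact: measurable_tnth.
have Qo : Q [set t | tnth t ord0 <= o] = 0%E by rewrite QE' -Q2o.
have mlt : measurable (~` D0 x0 `&` [set t : T | o < tnth t ord0]).
  apply: measurableI; first exact: measurableC.
  by apply: measurable_bool; apply: measurable_fun_ltr => //; exact: measurable_tnth.
(* Such a point violates a constraint on x_2, ..., x_d, which stretching leaves unchanged. Its whole
   segment is then outside [D0 x0], where P has no mass. *)
have QnD : Q (~` D0 x0 `&` [set t : T | o < tnth t ord0]) = 0%E.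
  apply/eqP; rewrite eq_le measure_ge0 andbT -PD PQ; last exact: measurableC.
  rewrite stretch_lawE; last exact: measurableC.
  rewrite -[X in Q X]setIT -integral_indic//; apply: ge0_le_integral => //.
  - exact/measurable_EFinP/measurable_indic.
  - rewrite (_ : (fun z => _) = unif01 \o xsection ((fun p : T * Rm => stretch o p.1 (p.2 : R)) @^-1` (~` D0 x0))).
      apply: measurable_fun_xsection.
      by rewrite -[X in measurable X]setTI; apply: measurable_stretch => //; exact: measurableC.
    apply/funext => z /=; congr (unif01 _).
    by apply/seteqP; split => s; rewrite /xsection/= inE.
  move=> z _.
  have [Hz|Hz] := pselect ((~` D0 x0 `&` [set t : T | o < tnth t ord0]) z); last first.
    by rewrite indicE memNset// measure_ge0.
  have [nD oz] := Hz; rewrite indicE mem_set// (_ : [set s | _] = setT).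
    by have /= -> := probability_setT (@unif01 R).
  apply/seteqP; split => // s _ Ds; apply: nD => j.
  case: (unliftP ord0 j) => [k ->|->]; last by rewrite x0o lee_fin ltW.
  by have := Ds (lift ord0 k); rewrite tnth_stretchS.
have QD : Q (D0pos x0 o) = 1%E.
  rewrite -[D0pos x0 o]setCK probability_setC; last first.
    by apply: measurableC; exact: measurable_D0pos.
  rewrite (_ : Q (~` D0pos x0 o) = 0%E) ?sube0//.
  apply/eqP; rewrite eq_le measure_ge0 andbT -(adde0 0%E) -[X in (X + _)%E]Qo -[X in (_ + X)%E]QnD.
  apply: le_trans (measureU2 _ mle mlt).
  apply: le_measure; rewrite ?inE.
  - by apply: measurableC; exact: measurable_D0pos.
  - exact: measurableU.
  move=> t nt; have [to|ot] := leP (tnth t ord0) o; [by left|right; split => // Dt].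
  by apply: nt; split.
exists Q; split => //.
pose f (z : T) : \bar R := (if (o < tnth z ord0)%R then (tnth z ord0 - o)^-1 else 0%R)%:E.
have mf : measurable_fun setT f.
  apply/measurable_EFinP; apply: measurable_fun_ifT => //.
    by apply: measurable_fun_ltr => //; exact: measurable_tnth.
  apply: (measurableT_comp measurable_invr); apply: measurable_funB => //.
  exact: measurable_tnth.
have f0 z : (0 <= f z)%E.
  by rewrite /f lee_fin; case: ifPn => // oz; rewrite invr_ge0 subr_ge0 ltW.
rewrite (ge0_integral_D0pos QD)//; last 2 first.
- exact: measurable_inv_gap.
- exact: (inv_gap_ge0 x0o).
rewrite (eq_integral f); last first.
  by move=> z; rewrite inE => -[_ /= oz]; rewrite /f /inv_gap oz gt_eqF.
rewrite (ge0_integral_full (measurable_D0pos x0 o) QD mf f0) QI//.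
Qed.

(** Continuity at [o] bounds the density by v + e on all short windows, which turns the pointwise
    constraint into the bound on increments used to control the mass of the mixing measure. *)
Lemma initial_density_increment (P : {measure set T -> \bar R}) (v : R) :
  dens_x10_le x0 o v P -> P (~` D0 x0) = 0%E -> forall e, 0 < e -> \forall n \near \oo,
    ((2 ^+ n)%:E * P [set t | (o < tnth t ord0 <= o + dyad n)%R] <= (v + e)%:E)%E.
Proof.
move=> [fd [fd0 mfd fdE fdc fdo]] PD e e0.
have [del del0 hdel] := fdc _ e0.
apply: filterS (dyad_cvg0 del0) => n hn.
have d0 : 0 < dyad n :> R by exact: dyad_gt0.
have mA : measurable (`]o, o + dyad n]%classic : set R) by exact: measurable_itv.
have Ao : `]o, o + dyad n]%classic `<=` [set x | o <= x].
  by move=> x /=; rewrite in_itv/= => /andP[/ltW].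
have mS : measurable [set t : T | o < tnth t ord0 <= o + dyad n].
  rewrite -[X in measurable X]setTI.
  have -> : [set t : T | o < tnth t ord0 <= o + dyad n] = (fun t => tnth t ord0) @^-1` `]o, o + dyad n]%classic.
    by apply/seteqP; split => t; rewrite /= in_itv.
  exact: (measurable_tnth ord0 measurableT mA).
apply: (@le_trans _ _ ((2 ^+ n)%:E * ((v + e) * dyad n)%:E)%E); last first.
  by rewrite -EFinM lee_fin /dyad mulrC -mulrA mulVf ?mulr1// gt_eqF// exprn_gt0.
apply: lee_wpmul2l; first by rewrite lee_fin exprn_ge0.
apply: (@le_trans _ _ (P [set t | D0 x0 t /\ `]o, o + dyad n]%classic (tnth t ord0)])).
  have mI : measurable [set t | D0 x0 t /\ `]o, o + dyad n]%classic (tnth t ord0)].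
    apply: measurableI; first exact: measurable_D0.
    by rewrite -[X in measurable X]setTI; exact: (measurable_tnth ord0 measurableT mA).
  rewrite -[leRHS]adde0 -[X in (_ + X)%E]PD.
  apply: le_trans (measureU2 _ mI (measurableC (measurable_D0 x0))).
  apply: le_measure; rewrite ?inE//.
    by apply: measurableU => //; apply: measurableC; exact: measurable_D0.
  move=> t /= ht; have [Dt|Dt] := pselect (D0 x0 t); [left|by right].
  by split => //; rewrite in_itv.
rewrite fdE//.
apply: (@le_trans _ _ (\int[mu]_(x in `]o, (o + dyad n)%R]) (cst (v + e)%:E) x)%E).
  apply: ge0_le_integral => //.
  - by move=> x /= hx; rewrite lee_fin fd0//; exact: Ao.
  - apply/measurable_EFinP; apply: measurable_funS mfd => //.
    by rewrite (_ : [set x | o <= x] = `[o, +oo[%classic)//; apply/seteqP; split => x; rewrite /= in_itv/= andbT.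
  - move=> x; rewrite /= in_itv/= => /andP[ox xn]; rewrite lee_fin.
    have /hdel : o <= x < o + del by rewrite ltW//=; lra.
    by rewrite ltr_norml => /andP[_ h]; lra.
rewrite integral_cst//= lebesgue_measure_itv/= lte_fin ltrDl d0.
by rewrite -EFinB -EFinM lee_fin addrAC subrr add0r.
Qed.

End DistributionToMoment.

Section Equivalence.
Context {R : realType} {m : nat}.
Local Notation T := (m.+1.-tuple R).
Variables (x0 : 'I_m.+1 -> \bar R) (o c u : R) (n : nat).
Variables (a b : 'I_n -> R) (lo hi : 'I_n -> 'I_m.+1 -> \bar R).
Variables (g1 g2 : m.-tuple R -> \bar R).
Hypothesis x0o : x0 ord0 = o%:E.
Hypothesis c0 : 0 < c.
Hypothesis lohi : forall i j, (x0 j <= lo i j)%E /\ (lo i j <= hi i j)%E.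
Hypotheses (mg1 : measurable_fun (gdom x0) g1) (mg2 : measurable_fun (gdom x0) g2).
Hypothesis g12 : forall y, gdom x0 y -> (o%:E <= g1 y)%E /\ (g1 y <= g2 y)%E.

Let cu : c * (u / c) = u.
Proof. by rewrite mulrCA divff ?mulr1// gt_eqF. Qed.

Let c0E : (0 <= c%:E)%E. Proof. by rewrite lee_fin ltW. Qed.

Lemma moment_feasible_D0pos (Q : probability T R) :
  moment_feasible x0 o c u a b lo hi Q -> Q (D0pos x0 o) = 1%E.
Proof.
by move=> [_ QD Qu _]; apply: moment_D0pos => //; rewrite (le_lt_trans Qu)// ltry.
Qed.

Lemma DRO_feasible_stretch_law (Q : probability T R) (P : {measure set T -> \bar R}) :
  moment_feasible x0 o c u a b lo hi Q ->
  (forall A, measurable A -> P A = (c%:E * stretch_law o Q A)%E) ->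
  DRO_feasible x0 o c u a b lo hi P /\ P (Sset x0 g1 g2) = moment_obj x0 o c g1 g2 Q.
Proof.
move=> Qf PE; have QD := moment_feasible_D0pos Qf; have [_ _ Qu Qab] := Qf.
split; last first.
  by rewrite PE; [rewrite (stretch_law_Sset x0o)|exact: measurable_Sset].
split.
- by rewrite PE ?(stretch_law_D0 x0o)// ?mule0//; apply: measurableC; exact: measurable_D0.
- by rewrite PE// stretch_lawT mule1.
- by exists (stretch_law o Q); split => //; exact: stretch_law_POU1.
- rewrite PE ?(stretch_law_no_atom QD) ?mule0//.
  rewrite -[X in measurable X]setTI.
  exact: (measurable_tnth ord0 measurableT (measurable_set1 o)).
split; first by rewrite -cu; exact: (stretch_law_initial_density x0o QD Qu).
move=> i; have /andP[h1 h2] := Qab i; rewrite PE; last exact: measurable_box.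
rewrite (stretch_law_box x0o)// [a i * c]mulrC [b i * c]mulrC !EFinM.
by rewrite !lee_wpmul2l.
Qed.

Lemma moment_feasible_of_DRO (P : {measure set T -> \bar R}) :
  DRO_feasible x0 o c u a b lo hi P ->
  exists Q : probability T R, moment_feasible x0 o c u a b lo hi Q /\
    P (Sset x0 g1 g2) = moment_obj x0 o c g1 g2 Q.
Proof.
move=> [PD P1 [Pn [PE hPn]] Pat [Pdens Pab]]; have mD := measurable_D0 x0.
have PnE A : measurable A -> Pn A = ((c^-1)%:E * P A)%E.
  by move=> mA; rewrite PE// muleA -EFinM mulVf ?mul1e// gt_eqF.
have mo : measurable [set t : T | tnth t ord0 = o].
  rewrite -[X in measurable X]setTI.
  exact: (measurable_tnth ord0 measurableT (measurable_set1 o)).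
have Pnat : Pn [set t | tnth t ord0 = o] = 0%E by rewrite PnE// Pat mule0.
have Pnu e : 0 < e -> \forall k \near \oo,
    ((2 ^+ k)%:E * Pn [set t | (o < tnth t ord0 <= o + dyad k)%R] <= (u / c + e)%:E)%E.
  (* The increments of P are c times those of [Pn], so an error c e for P is an error e after
     normalisation. *)
  move=> e0; have ce0 : 0 < c * e by rewrite mulr_gt0.
  apply: filterS (initial_density_increment Pdens PD ce0) => k.
  rewrite PE; last first.
    rewrite -[X in measurable X]setTI.
    have -> : [set t : T | (o < tnth t ord0 <= o + dyad k)%R] = (fun t => tnth t ord0) @^-1` `]o, o + dyad k]%classic.
      by apply/seteqP; split => t; rewrite /= in_itv.
    exact: (measurable_tnth ord0 measurableT (measurable_itv `]o, o + dyad k])).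
  rewrite muleCA -[X in (_ <= X)%E](_ : (c%:E * (u / c + e)%:E)%E = _); last first.
    by rewrite -EFinM mulrDr cu.
  by rewrite lee_pmul2l.
have [Q [QD Qu PQ]] := POU1_dist_mixture x0o hPn Pnat Pnu.
have QP A : measurable A -> stretch_law o Q A = ((c^-1)%:E * P A)%E.
  by move=> mA; rewrite -PQ// PnE.
exists Q; split; last first.
  have mS : measurable (Sset x0 g1 g2) by exact: measurable_Sset.
  by rewrite PE// PQ// (stretch_law_Sset x0o).
split => //.
- exact: probability_setT.
- have Q0 : Q (~` D0pos x0 o) = 0%E.
    by rewrite probability_setC ?QD ?subee//; exact: measurable_D0pos.
  apply/eqP; rewrite eq_le measure_ge0 andbT -Q0; apply: le_measure; rewrite ?inE.
  + exact: measurableC.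
  + by apply: measurableC; exact: measurable_D0pos.
  + by move=> z nD [].
- move=> i; rewrite -(stretch_law_box x0o)//; have mB := measurable_box x0 (lo i) (hi i).
  have /andP := Pab i; rewrite PE// PQ// ![_ i * c]mulrC !EFinM.
  by rewrite !lee_pmul2l// => -[-> ->].
Qed.

(** The two sets of attained objective values coincide, so the suprema agree whether or not they are
    attained. *)
Lemma DRO_value_eq_moment_value :
  DRO_value x0 o c u a b lo hi g1 g2 = moment_value x0 o c u a b lo hi g1 g2.
Proof.
congr ereal_sup; apply/seteqP; split => r.
  move=> [P [/moment_feasible_of_DRO[Q [Qf QE]] ->]].
  by exists Q.
move=> [Q0 [Qf ->]]; have [Q01 _ _ _] := Qf.
have [Q /eq_measure QE] := probability_of_measure Q01.
rewrite -QE in Qf *.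
exists (mscale (NngNum (ltW c0)) (stretch_law o Q)).
by have [Pf <-] := DRO_feasible_stretch_law (P := mscale (NngNum (ltW c0)) (stretch_law o Q)) Qf (fun A _ => erefl).
Qed.

(** Stretching preserves feasibility and the objective value; optimality is inherited once the two
    optimal values are known to agree. *)
Lemma stretch_law_optimal (Q0 P : {measure set T -> \bar R}) :
  moment_feasible x0 o c u a b lo hi Q0 ->
  (forall A, measurable A -> P A = (c%:E * \int[Q0]_(z in D0 x0)
     \int[@lebesgue_measure R]_(s in `]0%R, 1%R[) (\1_A (stretch o z s))%:E)%E) ->
  DRO_feasible x0 o c u a b lo hi P /\ P (Sset x0 g1 g2) = moment_obj x0 o c g1 g2 Q0.
Proof.
move=> Qf PE; have [Q01 _ _ _] := Qf.
have [Q /eq_measure QE] := probability_of_measure Q01.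
rewrite -QE in Qf PE *; apply: DRO_feasible_stretch_law => // A mA.
have QD : Q (D0 x0) = 1%E.
  apply/eqP; rewrite eq_le probability_le1 /=; last exact: measurable_D0.
  rewrite -(moment_feasible_D0pos Qf); apply: le_measure; rewrite ?inE.
  - exact: measurable_D0pos.
  - exact: measurable_D0.
  - exact: subIsetl.
rewrite PE// (stretch_law_on o (measurable_D0 x0) QD)//; congr (_ * _)%E.
by apply: eq_integral => z _; rewrite unif01_indic//; exact: measurable_slice.
Qed.

End Equivalence.

Theorem mainTheorem18 (R : realType) (m : nat)
  (x0 : 'I_m.+1 -> \bar R) (x10 : R) (c u : R) (n : nat)
  (a b : 'I_n -> R) (lo hi : 'I_n -> 'I_m.+1 -> \bar R)
  (g1 g2 : m.-tuple R -> \bar R) :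
  x0 ord0 = x10%:E ->
  (forall j, x0 j != +oo%E) ->
  0 < c -> 0 <= u ->
  (forall i, 0 <= a i /\ a i <= b i /\ b i <= 1) ->
  (forall i j, (x0 j <= lo i j)%E /\ (lo i j <= hi i j)%E) ->
  measurable_fun (gdom x0) g1 ->
  measurable_fun (gdom x0) g2 ->
  (forall y, gdom x0 y -> (x10%:E <= g1 y)%E /\ (g1 y <= g2 y)%E) ->
  DRO_value x0 x10 c u a b lo hi g1 g2 = moment_value x0 x10 c u a b lo hi g1 g2 /\
  forall Qs : {measure set (m.+1.-tuple R) -> \bar R},
    moment_feasible x0 x10 c u a b lo hi Qs ->
    moment_obj x0 x10 c g1 g2 Qs = moment_value x0 x10 c u a b lo hi g1 g2 ->
    forall Ps : {measure set (m.+1.-tuple R) -> \bar R},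
      (forall A, measurable A ->
         Ps A = (c%:E * \int[Qs]_(z in D0 x0)
                   \int[@lebesgue_measure R]_(s in `]0%R, 1%R[)
                      (\1_A (stretch x10 z s))%:E)%E) ->
      DRO_feasible x0 x10 c u a b lo hi Ps /\
      Ps (Sset x0 g1 g2) = DRO_value x0 x10 c u a b lo hi g1 g2.
Proof.
move=> x0o _ c0 _ _ lohi mg1 mg2 g12; split; first exact: DRO_value_eq_moment_value.
move=> Qs Qf Qopt Ps PsE.
have [Pf PS] := stretch_law_optimal x0o c0 lohi mg1 mg2 g12 Qf PsE.
by split => //; rewrite PS Qopt DRO_value_eq_moment_value.
Qed.
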